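(* $\sqrt3\le \gamma(\mathcal{S}^* )<2.5$.
   Context: $\mathbb{D}=\{z\in\mathbb{C}:|z|<1\}$. $\mathcal{A}_1$ is the class of holomorphic functions $f$ on $\mathbb{D}$ with $f(0)=f'(0)-1=0$. A function $f\in\mathcal{A}_1$ is called starlike if $f$ maps $\mathbb{D}$ univalently onto a domain starlike with respect to the origin (equivalently, $zf'(z)/f(z)$ is holomorphic with positive real part on $\mathbb{D}$); $\mathcal{S}^*$ denotes the class of starlike functions in $\mathcal{A}_1$. For $f\in\mathcal{A}_1$ put $\varphi_f(z)=1+zf''(z)/f'(z)$, and for $\gamma\ge 0$ let $W_\gamma=\{w\in\mathbb{C}:|\operatorname{Im} w|<\gamma\}$. For a subset $\mathcal{F}$ of $\mathcal{A}_1$ define $$\gamma(\mathcal{F})=\sup\{\gamma\ge0:\ \text{for every } f\in\mathcal{A}_1,\ \varphi_f(\mathbb{D})\subset W_\gamma \text{ implies } f\in\mathcal{F}\}.$$ (The condition $\varphi_f(\mathbb{D})\subset W_\gamma$ includes that $f'$ has no zeros in $\mathbb{D}$, since $\varphi_f$ has a pole at any zero of $f'$ in $\mathbb{D}$.) *)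

(* Defs.v *)
From Stdlib Require Import Reals.
From Coquelicot Require Import Coquelicot.
Open Scope R_scope.

Definition disk (z : C) : Prop := Cmod z < 1.

(* Functions on a subset of [C] are represented by total functions [C -> C];
   the definitions below only depend on the values on the (open) subset. *)
Definition holomorphic_on (U : C -> Prop) (f : C -> C) : Prop :=
  forall z : C, U z -> @ex_derive C_AbsRing C_NormedModule f z.

Definition A1 (f : C -> C) : Prop :=
  holomorphic_on disk f /\ f (RtoC 0) = RtoC 0 /\
  (C_derive f (RtoC 0) - RtoC 1)%C = RtoC 0.

Definition univalent_on (U : C -> Prop) (f : C -> C) : Prop :=
  holomorphic_on U f /\
  forall z1 z2 : C, U z1 -> U z2 -> f z1 = f z2 -> z1 = z2.

Definition image (f : C -> C) (U : C -> Prop) (w : C) : Prop :=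
  exists z : C, U z /\ f z = w.

Definition connected (U : C -> Prop) : Prop :=
  forall P Q : C -> Prop,
    @open C_UniformSpace P -> @open C_UniformSpace Q ->
    (forall w : C, U w -> P w \/ Q w) ->
    (exists w : C, U w /\ P w) -> (exists w : C, U w /\ Q w) ->
    exists w : C, U w /\ P w /\ Q w.

Definition domain (U : C -> Prop) : Prop :=
  (exists w : C, U w) /\ @open C_UniformSpace U /\ connected U.

Definition starlike_wrt_origin (U : C -> Prop) : Prop :=
  U (RtoC 0) /\
  forall (w : C) (t : R), U w -> 0 <= t <= 1 -> U (RtoC t * w)%C.

Definition Sstar (f : C -> C) : Prop :=
  A1 f /\ univalent_on disk f /\
  domain (image f disk) /\ starlike_wrt_origin (image f disk).

Definition phi (f : C -> C) (z : C) : C :=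
  (RtoC 1 + z * C_derive (C_derive f) z / C_derive f z)%C.

Definition W (g : R) (w : C) : Prop := Rabs (Im w) < g.

(* [phi f] is meromorphic in the disk, with a pole at every zero of [f'].
   As division in [C] is total, finiteness of [phi f z] is required
   separately from the bound on its imaginary part. *)
Definition phi_maps_disk_into (f : C -> C) (V : C -> Prop) : Prop :=
  forall z : C, disk z -> C_derive f z <> RtoC 0 /\ V (phi f z).

Definition gamma (F : (C -> C) -> Prop) : Rbar :=
  Lub_Rbar (fun g : R => 0 <= g /\
    forall f : C -> C, A1 f -> phi_maps_disk_into f (W g) -> F f).

(* Main.v *)
(** Lower bound: let [q = f / (z f')], so that [z q' = 1 - q phi] and [q 0 = 1]. At a first
    point [z0] where [Re q] vanishes, [q z0 = iy] and Jack's lemma gives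
    [Re (z0 q') <= - (1 + y^2) / 2]; hence [- y Im phi >= (3 + y^2) / 2 >= sqrt 3 |y|],
    which is impossible if [|Im phi| < sqrt 3]. So [Re q > 0], and then every point can be
    moved along [- z q], which decreases [|z|] and moves [f z] straight towards the origin;
    starlikeness and univalence follow by compactness.

    Upper bound: for [T z = (1 + a z) / (1 - b z)] with [a = 8/15] and [b = 9/25], the
    function [f = (T^(7/2) - 1) / (7/2 (a + b))] has [|Im phi| < 249/100]. At a point [z0] with
    [|z0| < 1] and [T z0] the square of a Gaussian rational, [Re (f / (z f')) < 0]; by Schwarz's
    lemma applied to [f^-1 (t f)] this does not happen for starlike functions. *)

Require Import Defs.
From Stdlib Require Import Reals Lra Lia Classical ClassicalEpsilon.
From Coquelicot Require Import Coquelicot.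
Open Scope R_scope.

(** * Continuity and differentiation of complex-valued functions *)

(** The identity [z q' = 1 - q phi] comes from differentiating [z q = f / f'], and [sqrt 3] is the
    minimum of [(3 + y^2) / (2 |y|)], attained at [|y| = sqrt 3]. Both halves meet at the sign of
    [Re (f / (z f'))]: positivity off the origin is shown to suffice for starlikeness, nonnegativity
    to be necessary. The hypothesis on [f] is bare pointwise differentiability, so both halves rest
    on Cauchy theory: holomorphy of [f'], local inversion with uniform first-order control and
    Schwarz's lemma are derived from Goursat's lemma. The latter is stated for the image of a
    rectangle under a map [G], so that each homotopy of closed curves is one application of it and
    winding numbers do not enter. In the example, [a, b < 1] keep the poles of [phi] off the closed
    disk. The exponent is half an odd integer so that [f] is a polynomial in one square root [s] of
    [T]: where [s] is a Gaussian rational, so are [z], [f] and [f'], and the sign of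
    [Re (f / (z f'))] is settled by exact rational arithmetic. The margin between 249/100 and 5/2
    makes the final inequality strict. *)

Definition ccont {X : UniformSpace} (f : X -> C) (x : X) : Prop :=
  forall e : R, 0 < e -> locally x (fun y => Cmod (f y - f x)%C < e).

(* Caratheodory's form of the derivative. The map [i] embeds the source in [C]:
   it is the identity for functions of a complex variable and [RtoC] for curves. *)
Definition cder {X : UniformSpace} (i : X -> C) (f : X -> C) (x : X) (l : C) : Prop :=
  exists h : X -> C,
    locally x (fun y => f y = (f x + h y * (i y - i x))%C) /\
    ccont h x /\ h x = l.

Definition idC (z : C_UniformSpace) : C := z.
Definition ofR (x : R_UniformSpace) : C := RtoC x.

Lemma Cmod_minus_sym (a b : C) : Cmod (a - b)%C = Cmod (b - a)%C.
Proof. rewrite <- Cmod_opp. f_equal. ring. Qed.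

Lemma Cmod_triangle_rev (a b : C) : Cmod a - Cmod b <= Cmod (a - b)%C.
Proof.
  assert (H := Cmod_triangle (a - b)%C b).
  replace (a - b + b)%C with a in H by ring. lra.
Qed.

Lemma Cmod_dist_triangle (a b c : C) : Cmod (a - c)%C <= Cmod (a - b)%C + Cmod (b - c)%C.
Proof. replace (a - c)%C with ((a - b) + (b - c))%C by ring. apply Cmod_triangle. Qed.

Lemma fst_le_Cmod (z : C) : Rabs (fst z) <= Cmod z.
Proof. eapply Rle_trans; [apply Rmax_l | apply Rmax_Cmod]. Qed.

Lemma snd_le_Cmod (z : C) : Rabs (snd z) <= Cmod z.
Proof. eapply Rle_trans; [apply Rmax_r | apply Rmax_Cmod]. Qed.

Lemma Cmod_le_sum (z : C) : Cmod z <= Rabs (fst z) + Rabs (snd z).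
Proof.
  replace z with (RtoC (fst z) + Ci * RtoC (snd z))%C at 1.
  - eapply Rle_trans; [apply Cmod_triangle|].
    rewrite Cmod_mult, Cmod_Ci, !Cmod_R. lra.
  - destruct z as [x y]. unfold Cplus, Cmult, Ci, RtoC. simpl. f_equal; ring.
Qed.

Lemma Cmod_sqr (z : C) : Cmod z * Cmod z = fst z * fst z + snd z * snd z.
Proof. assert (H := Cmod2_alt z). unfold Re, Im in H. simpl in H. lra. Qed.

Lemma locally_C_iff (z : C) (P : C -> Prop) :
  locally (z : C_UniformSpace) P <-> exists d, 0 < d /\ forall w, Cmod (w - z)%C < d -> P w.
Proof.
  split.
  - intros [d Hd]. exists d. split; [apply cond_pos|].
    intros w Hw. apply Hd. apply C_NormedModule_mixin_compat1. exact Hw.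
  - intros [d [Hd H]].
    assert (Hd2 : 0 < d / 2) by lra.
    exists (mkposreal _ Hd2). intros w Hw. apply H.
    destruct Hw as [H1 H2]. simpl in H1, H2.
    unfold ball in H1, H2; simpl in H1, H2; unfold AbsRing_ball, abs, minus, plus, opp in H1, H2; simpl in H1, H2.
    eapply Rle_lt_trans; [apply Cmod_le_sum|].
    replace (fst (w - z)%C) with (fst w + - fst z) by (destruct w, z; reflexivity).
    replace (snd (w - z)%C) with (snd w + - snd z) by (destruct w, z; reflexivity).
    lra.
Qed.

Lemma locally_R_iff (x : R) (P : R -> Prop) :
  locally (x : R_UniformSpace) P <-> exists d, 0 < d /\ forall y, Rabs (y - x) < d -> P y.
Proof.
  split.
  - intros [d Hd]. exists d. split; [apply cond_pos|]. intros w Hw. apply Hd. exact Hw.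
  - intros [d [Hd H]]. exists (mkposreal d Hd). intros y Hy. apply H. exact Hy.
Qed.

Lemma ccont_locally_ball {X : UniformSpace} (f : X -> C) (x : X) (P : C -> Prop) :
  ccont f x -> locally (f x : C_UniformSpace) P -> locally x (fun y => P (f y)).
Proof.
  intros Hf HP. apply locally_C_iff in HP. destruct HP as [d [Hd HP]].
  generalize (Hf d Hd). apply filter_imp. intros y Hy. apply HP, Hy.
Qed.

Lemma ccont_C_iff (f : C -> C) (z : C) :
  @ccont C_UniformSpace f z <->
  forall e, 0 < e -> exists d, 0 < d /\ forall w, Cmod (w - z)%C < d -> Cmod (f w - f z)%C < e.
Proof.
  split; intros H e He; [apply locally_C_iff | apply locally_C_iff]; apply H, He.
Qed.

Lemma ccont_const {X : UniformSpace} (c : C) (x : X) : ccont (fun _ => c) x.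
Proof.
  intros e He. exists (mkposreal 1 Rlt_0_1). intros y _.
  replace (c - c)%C with (RtoC 0) by ring. rewrite Cmod_0. exact He.
Qed.

Lemma ccont_idC (z : C) : ccont idC z.
Proof. intros e He. apply locally_C_iff. exists e. split; auto. Qed.

Lemma ccont_ofR (x : R) : ccont ofR x.
Proof.
  intros e He. apply locally_R_iff. exists e. split; auto.
  intros y Hy. unfold ofR. rewrite <- RtoC_minus, Cmod_R. exact Hy.
Qed.

Lemma ccont_ext_loc {X : UniformSpace} (f g : X -> C) (x : X) :
  locally x (fun y => f y = g y) -> ccont f x -> ccont g x.
Proof.
  intros H Hf e He. assert (Hx := locally_singleton _ _ H).
  generalize (filter_and _ _ H (Hf e He)). apply filter_imp.
  intros y [H1 H2]. rewrite <- H1, <- Hx. exact H2.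
Qed.

Lemma ccont_plus {X : UniformSpace} (f g : X -> C) (x : X) :
  ccont f x -> ccont g x -> ccont (fun y => (f y + g y)%C) x.
Proof.
  intros Hf Hg e He. assert (He2 : 0 < e / 2) by lra.
  generalize (filter_and _ _ (Hf _ He2) (Hg _ He2)). apply filter_imp.
  intros y [H1 H2].
  replace (f y + g y - (f x + g x))%C with ((f y - f x) + (g y - g x))%C by ring.
  eapply Rle_lt_trans; [apply Cmod_triangle|]. lra.
Qed.

Lemma ccont_mult {X : UniformSpace} (f g : X -> C) (x : X) :
  ccont f x -> ccont g x -> ccont (fun y => (f y * g y)%C) x.
Proof.
  intros Hf Hg e He.
  set (M := 1 + Cmod (f x) + Cmod (g x)).
  assert (HM : 1 <= M) by (unfold M; generalize (Cmod_ge_0 (f x)) (Cmod_ge_0 (g x)); lra).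
  set (d := Rmin 1 (e / (2 * M))).
  assert (Hq : 0 < e / (2 * M)) by (apply Rdiv_lt_0_compat; lra).
  assert (Hd : 0 < d) by (unfold d; apply Rmin_pos; lra).
  assert (Hd1 : d <= 1) by apply Rmin_l.
  assert (Hd2 : d * (2 * M) <= e).
  { apply Rle_trans with (e / (2 * M) * (2 * M)).
    - apply Rmult_le_compat_r; [lra | apply Rmin_r].
    - right. field. lra. }
  generalize (filter_and _ _ (Hf _ Hd) (Hg _ Hd)). apply filter_imp.
  intros y [H1 H2].
  replace (f y * g y - f x * g x)%C
    with ((f y - f x) * (g y - g x) + (f x * (g y - g x) + (f y - f x) * g x))%C by ring.
  eapply Rle_lt_trans; [apply Cmod_triangle|].
  eapply Rle_lt_trans; [apply Rplus_le_compat_l, Cmod_triangle|].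
  rewrite !Cmod_mult.
  generalize (Cmod_ge_0 (f x)) (Cmod_ge_0 (g x)) (Cmod_ge_0 (f y - f x)%C) (Cmod_ge_0 (g y - g x)%C).
  intros A1 A2 A3 A4.
  assert (B1 : Cmod (f y - f x)%C * Cmod (g y - g x)%C <= d * 1) by (apply Rmult_le_compat; lra).
  assert (B2 : Cmod (f x) * Cmod (g y - g x)%C <= Cmod (f x) * d) by (apply Rmult_le_compat_l; lra).
  assert (B3 : Cmod (f y - f x)%C * Cmod (g x) <= d * Cmod (g x)) by (apply Rmult_le_compat_r; lra).
  assert (B4 : d * M <= e / 2) by lra.
  unfold M in B4. lra.
Qed.

Lemma ccont_opp {X : UniformSpace} (f : X -> C) (x : X) :
  ccont f x -> ccont (fun y => (- f y)%C) x.
Proof.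
  intros Hf e He. generalize (Hf e He). apply filter_imp. intros y Hy.
  replace (- f y - - f x)%C with (- (f y - f x))%C by ring. rewrite Cmod_opp. exact Hy.
Qed.

Lemma ccont_minus {X : UniformSpace} (f g : X -> C) (x : X) :
  ccont f x -> ccont g x -> ccont (fun y => (f y - g y)%C) x.
Proof. intros Hf Hg. apply (ccont_plus f (fun y => (- g y)%C)); auto. apply ccont_opp, Hg. Qed.

Lemma ccont_neq_0 {X : UniformSpace} (f : X -> C) (x : X) :
  ccont f x -> f x <> RtoC 0 -> locally x (fun y => Cmod (f x) / 2 < Cmod (f y)).
Proof.
  intros Hf H0. assert (Hp := proj1 (Cmod_gt_0 _) H0).
  assert (Hp2 : 0 < Cmod (f x) / 2) by lra.
  generalize (Hf _ Hp2). apply filter_imp. intros y Hy.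
  generalize (Cmod_triangle_rev (f x) (f y)). rewrite Cmod_minus_sym. lra.
Qed.

Lemma Cmod_pos_neq_0 (z : C) : 0 < Cmod z -> z <> RtoC 0.
Proof. apply Cmod_gt_0. Qed.

Lemma ccont_inv {X : UniformSpace} (f : X -> C) (x : X) :
  ccont f x -> f x <> RtoC 0 -> ccont (fun y => (/ f y)%C) x.
Proof.
  intros Hf H0 e He. assert (Hp := proj1 (Cmod_gt_0 _) H0).
  set (m := Cmod (f x)) in *.
  assert (Hd : 0 < e * (m * m / 2)) by (repeat apply Rmult_lt_0_compat; lra).
  generalize (filter_and _ _ (Hf _ Hd) (ccont_neq_0 f x Hf H0)). apply filter_imp.
  intros y [H1 H2]. fold m in H2.
  assert (Hy : f y <> RtoC 0) by (apply Cmod_pos_neq_0; lra).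
  replace (/ f y - / f x)%C with (- (f y - f x) / (f y * f x))%C by (field; auto).
  rewrite Cmod_div by (apply Cmult_neq_0; auto).
  rewrite Cmod_opp, Cmod_mult. fold m.
  apply Rlt_div_l; [apply Rlt_gt, Rmult_lt_0_compat; lra|].
  eapply Rlt_le_trans; [apply H1|].
  apply Rmult_le_compat_l; [lra|]. nra.
Qed.

Lemma ccont_div {X : UniformSpace} (f g : X -> C) (x : X) :
  ccont f x -> ccont g x -> g x <> RtoC 0 -> ccont (fun y => (f y / g y)%C) x.
Proof. intros Hf Hg H0. apply (ccont_mult f (fun y => (/ g y)%C)); auto. apply ccont_inv; auto. Qed.

Lemma ccont_comp {X : UniformSpace} (g : C -> C) (f : X -> C) (x : X) :
  ccont f x -> @ccont C_UniformSpace g (f x) -> ccont (fun y => g (f y)) x.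
Proof. intros Hf Hg e He. exact (ccont_locally_ball f x _ Hf (Hg e He)). Qed.

Lemma cder_ext_loc {X : UniformSpace} (i : X -> C) (f g : X -> C) (x : X) (l : C) :
  locally x (fun y => f y = g y) -> cder i f x l -> cder i g x l.
Proof.
  intros H [h [H1 [H2 H3]]]. exists h. split; [|auto].
  assert (Hx := locally_singleton _ _ H).
  generalize (filter_and _ _ H H1). apply filter_imp.
  intros y [A B]. rewrite <- A, <- Hx. exact B.
Qed.

Lemma cder_ext {X : UniformSpace} (i : X -> C) (f g : X -> C) (x : X) (l : C) :
  (forall y, f y = g y) -> cder i f x l -> cder i g x l.
Proof. intros H. apply cder_ext_loc, filter_forall, H. Qed.

Lemma cder_eq {X : UniformSpace} (i : X -> C) (f : X -> C) (x : X) (l l' : C) :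
  l = l' -> cder i f x l -> cder i f x l'.
Proof. intros ->. auto. Qed.

Lemma cder_cont {X : UniformSpace} (i : X -> C) (f : X -> C) (x : X) (l : C) :
  ccont i x -> cder i f x l -> ccont f x.
Proof.
  intros Hi [h [H1 [H2 H3]]].
  apply (ccont_ext_loc (fun y => (f x + h y * (i y - i x))%C)).
  - generalize H1. apply filter_imp. auto.
  - apply ccont_plus; [apply ccont_const|]. apply ccont_mult; auto.
    apply ccont_minus; auto. apply ccont_const.
Qed.

Lemma cder_const {X : UniformSpace} (i : X -> C) (c : C) (x : X) : cder i (fun _ => c) x (RtoC 0).
Proof.
  exists (fun _ => RtoC 0). split; [|split; [apply ccont_const|reflexivity]].
  apply filter_forall. intros y. ring.
Qed.

Lemma cder_incl {X : UniformSpace} (i : X -> C) (x : X) : cder i i x (RtoC 1).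
Proof.
  exists (fun _ => RtoC 1). split; [|split; [apply ccont_const|reflexivity]].
  apply filter_forall. intros y. ring.
Qed.

Lemma cder_plus {X : UniformSpace} (i : X -> C) (f g : X -> C) (x : X) (a b : C) :
  cder i f x a -> cder i g x b -> cder i (fun y => (f y + g y)%C) x (a + b)%C.
Proof.
  intros [h [H1 [H2 H3]]] [k [K1 [K2 K3]]].
  exists (fun y => (h y + k y)%C). split; [|split; [apply ccont_plus; auto|now rewrite H3, K3]].
  generalize (filter_and _ _ H1 K1). apply filter_imp. intros y [A B]. rewrite A, B. ring.
Qed.

Lemma cder_mult {X : UniformSpace} (i : X -> C) (f g : X -> C) (x : X) (a b : C) :
  ccont i x -> cder i f x a -> cder i g x b ->
  cder i (fun y => (f y * g y)%C) x (a * g x + f x * b)%C.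
Proof.
  intros Hi Hf Hg. assert (Cg := cder_cont i g x b Hi Hg).
  destruct Hf as [h [H1 [H2 H3]]], Hg as [k [K1 [K2 K3]]].
  exists (fun y => (h y * g y + f x * k y)%C). split; [|split; [|now rewrite H3, K3]].
  - generalize (filter_and _ _ H1 K1). apply filter_imp. intros y [A B]. rewrite A.
    replace (g y) with (g x + k y * (i y - i x))%C at 1 by (symmetry; exact B). rewrite B. ring.
  - apply ccont_plus; apply ccont_mult; auto. apply ccont_const.
Qed.

Lemma cder_scal {X : UniformSpace} (i : X -> C) (f : X -> C) (x : X) (c a : C) :
  cder i f x a -> cder i (fun y => (c * f y)%C) x (c * a)%C.
Proof.
  intros [h [H1 [H2 H3]]].
  exists (fun y => (c * h y)%C). split; [|split; [|now rewrite H3]].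
  - generalize H1. apply filter_imp. intros y A. rewrite A. ring.
  - apply ccont_mult; auto. apply ccont_const.
Qed.

Lemma cder_minus {X : UniformSpace} (i : X -> C) (f g : X -> C) (x : X) (a b : C) :
  cder i f x a -> cder i g x b -> cder i (fun y => (f y - g y)%C) x (a - b)%C.
Proof.
  intros Hf Hg. apply (cder_ext i (fun y => (f y + (RtoC (-1)) * g y)%C)).
  - intros y. ring.
  - apply (cder_eq _ _ _ (a + RtoC (-1) * b)%C); [ring|].
    apply cder_plus; auto. apply cder_scal, Hg.
Qed.

Lemma cder_inv {X : UniformSpace} (i : X -> C) (f : X -> C) (x : X) (a : C) :
  ccont i x -> cder i f x a -> f x <> RtoC 0 ->
  cder i (fun y => (/ f y)%C) x (- a / (f x * f x))%C.
Proof.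
  intros Hi Hf H0. assert (Cf := cder_cont i f x a Hi Hf).
  destruct Hf as [h [H1 [H2 H3]]].
  exists (fun y => (- h y / (f y * f x))%C). split; [|split; [|now rewrite H3]].
  - generalize (filter_and _ _ H1 (ccont_neq_0 f x Cf H0)). apply filter_imp. intros y [A B].
    assert (Hy : f y <> RtoC 0).
    { apply Cmod_pos_neq_0. generalize (Cmod_ge_0 (f x)); lra. }
    assert (E : (h y * (i y - i x))%C = (f y - f x)%C) by (rewrite A; ring).
    transitivity (/ f x - (h y * (i y - i x)) / (f y * f x))%C.
    + rewrite E. field. auto.
    + field. auto.
  - apply ccont_div.
    + apply ccont_opp; auto.
    + apply ccont_mult; auto. apply ccont_const.
    + apply Cmult_neq_0; auto.
Qed.

Lemma cder_div {X : UniformSpace} (i : X -> C) (f g : X -> C) (x : X) (a b : C) :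
  ccont i x -> cder i f x a -> cder i g x b -> g x <> RtoC 0 ->
  cder i (fun y => (f y / g y)%C) x ((a * g x - f x * b) / (g x * g x))%C.
Proof.
  intros Hi Hf Hg H0.
  apply (cder_eq _ _ _ (a * / g x + f x * (- b / (g x * g x)))%C); [field; auto|].
  apply (cder_mult i f (fun y => (/ g y)%C)); auto. apply cder_inv; auto.
Qed.

Lemma cder_comp {X : UniformSpace} (i : X -> C) (f : C -> C) (g : X -> C) (x : X) (a b : C) :
  ccont i x -> cder idC f (g x) a -> cder i g x b -> cder i (fun y => f (g y)) x (a * b)%C.
Proof.
  intros Hi Hf Hg. assert (Cg := cder_cont i g x b Hi Hg).
  destruct Hf as [h [H1 [H2 H3]]], Hg as [k [K1 [K2 K3]]].
  exists (fun y => (h (g y) * k y)%C). split; [|split; [|now rewrite H3, K3]].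
  - generalize (filter_and _ _ (ccont_locally_ball g x _ Cg H1) K1).
    apply filter_imp. intros y [A B]. rewrite A. unfold idC. rewrite B at 2. ring.
  - apply ccont_mult; auto. apply (ccont_comp h g); auto.
Qed.

Lemma cder_pow {X : UniformSpace} (i : X -> C) (f : X -> C) (x : X) (a : C) (n : nat) :
  ccont i x -> cder i f x a ->
  cder i (fun y => (f y ^ S n)%C) x (RtoC (INR (S n)) * f x ^ n * a)%C.
Proof.
  intros Hi Hf. induction n as [|n IH].
  - apply (cder_ext i f); [intros y; rewrite Cpow_1_r; reflexivity|].
    apply (cder_eq _ _ _ a); auto. simpl. ring.
  - apply (cder_ext i (fun y => (f y * f y ^ S n)%C)); [intros y; now rewrite (Cpow_S (f y) (S n))|].
    eapply cder_eq; [|apply cder_mult; eauto].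
    rewrite (S_INR (S n)), RtoC_plus, !Cpow_S. ring.
Qed.

(** The difference quotient, completed by the value [l] where [i y = i x], serves as Caratheodory
    factor; the first hypothesis makes the factorisation true at those points as well. *)
Lemma cder_of_estimate {X : UniformSpace} (i : X -> C) (f : X -> C) (x : X) (l : C) :
  (forall y, i y = i x -> f y = f x) ->
  (forall e, 0 < e -> locally x (fun y =>
     Cmod (f y - f x - l * (i y - i x))%C <= e * Cmod (i y - i x)%C)) ->
  cder i f x l.
Proof.
  intros Hinj H.
  exists (fun y => if Ceq_dec (i y) (i x) then l else ((f y - f x) / (i y - i x))%C).
  split; [|split].
  - apply filter_forall. intros y. destruct (Ceq_dec (i y) (i x)) as [E|E].
    + rewrite (Hinj y E), E. ring.
    + field. now apply Cminus_eq_contra.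
  - intros e He. assert (He2 : 0 < e / 2) by lra.
    generalize (H _ He2). apply filter_imp. intros y Hy.
    destruct (Ceq_dec (i x) (i x)) as [_|N]; [|congruence].
    destruct (Ceq_dec (i y) (i x)) as [E|E].
    + replace (l - l)%C with (RtoC 0) by ring. rewrite Cmod_0. exact He.
    + assert (N : (i y - i x)%C <> RtoC 0) by now apply Cminus_eq_contra.
      replace ((f y - f x) / (i y - i x) - l)%C
        with ((f y - f x - l * (i y - i x)) / (i y - i x))%C by (field; auto).
      rewrite Cmod_div by auto.
      apply Cmod_gt_0 in N.
      apply Rlt_div_l; auto.
      eapply Rle_lt_trans; [apply Hy|]. apply Rmult_lt_compat_r; lra.
  - destruct (Ceq_dec (i x) (i x)); congruence.
Qed.

Lemma cder_estimate {X : UniformSpace} (i : X -> C) (f : X -> C) (x : X) (l : C) :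
  cder i f x l ->
  forall e, 0 < e -> locally x (fun y =>
     Cmod (f y - f x - l * (i y - i x))%C <= e * Cmod (i y - i x)%C).
Proof.
  intros [h [H1 [H2 H3]]] e He. subst l.
  generalize (filter_and _ _ H1 (H2 e He)). apply filter_imp. intros y [A B].
  rewrite A.
  replace (f x + h y * (i y - i x) - f x - h x * (i y - i x))%C
    with ((h y - h x) * (i y - i x))%C by ring.
  rewrite Cmod_mult. apply Rmult_le_compat_r; [apply Cmod_ge_0|]. lra.
Qed.

(** Bridge between the derivative used in the definitions of the theorem and Caratheodory's form
    used in the proofs. *)
Lemma is_derive_cder (f : C -> C) (z l : C) :
  @is_derive C_AbsRing C_NormedModule f z l <-> cder idC f z l.
Proof.
  split.
  - intros [_ H]. apply cder_of_estimate; [unfold idC; congruence|].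
    intros e He. specialize (H z (fun P HP => HP) (mkposreal e He)).
    apply locally_C in H. generalize H. apply filter_imp. intros y Hy. unfold idC.
    rewrite Cmult_comm. exact Hy.
  - intros H. split; [apply is_linear_scal_l|].
    intros x Hx. assert (E : z = x).
    { exact (is_filter_lim_locally_unique (K := C_AbsRing) (V := AbsRing_NormedModule C_AbsRing) z x Hx). }
    subst x. intros eps. apply locally_C.
    generalize (cder_estimate _ _ _ _ H eps (cond_pos eps)). apply filter_imp.
    intros y Hy. unfold idC in Hy. rewrite Cmult_comm in Hy. exact Hy.
Qed.

Lemma C_derive_cder (f : C -> C) (z l : C) : cder idC f z l -> C_derive f z = l.
Proof. intros H. apply is_C_derive_unique, is_derive_cder, H. Qed.

Lemma holomorphic_cder (U : C -> Prop) (f : C -> C) (z : C) :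
  holomorphic_on U f -> U z -> cder idC f z (C_derive f z).
Proof.
  intros H Hz. apply is_derive_cder. apply C_derive_correct; [exact z|]. apply H, Hz.
Qed.

(** * Integrals of complex-valued functions of a real variable *)

(** Integrating the two components separately makes the real theory available; the price is the
    factor 2 in the norm estimate [CInt_bound]. That factor is absorbed by the choice of the
    epsilons, and in the maximum principle by taking powers. *)
Definition CInt (f : R -> C) (a b : R) : C :=
  (RInt (fun t => fst (f t)) a b, RInt (fun t => snd (f t)) a b).

Definition cont_on (f : R -> C) (a b : R) : Prop :=
  forall t, a <= t <= b -> @ccont R_UniformSpace f t.

Lemma ccont_fst (f : R -> C) (t : R) :
  @ccont R_UniformSpace f t -> continuous (fun u => fst (f u)) t.
Proof.
  intros H. apply filterlim_locally. intros eps.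
  generalize (H eps (cond_pos eps)). apply filter_imp. intros y Hy.
  eapply Rle_lt_trans; [|exact Hy]. exact (fst_le_Cmod (f y - f t)%C).
Qed.

Lemma ccont_snd (f : R -> C) (t : R) :
  @ccont R_UniformSpace f t -> continuous (fun u => snd (f u)) t.
Proof.
  intros H. apply filterlim_locally. intros eps.
  generalize (H eps (cond_pos eps)). apply filter_imp. intros y Hy.
  eapply Rle_lt_trans; [|exact Hy]. exact (snd_le_Cmod (f y - f t)%C).
Qed.

Lemma cont_on_ex_RInt (f : R -> C) (a b : R) :
  a <= b -> cont_on f a b ->
  ex_RInt (fun t => fst (f t)) a b /\ ex_RInt (fun t => snd (f t)) a b.
Proof.
  intros Hab H. split; apply (ex_RInt_continuous (V := R_CompleteNormedModule)); intros t Ht;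
    rewrite Rmin_left, Rmax_right in Ht by lra.
  - apply ccont_fst, H, Ht.
  - apply ccont_snd, H, Ht.
Qed.

Lemma CInt_ext (f g : R -> C) (a b : R) :
  a <= b -> (forall t, a <= t <= b -> f t = g t) -> CInt f a b = CInt g a b.
Proof.
  intros Hab H. unfold CInt. f_equal; apply RInt_ext; intros t Ht;
    rewrite Rmin_left, Rmax_right in Ht by lra; rewrite H; auto; lra.
Qed.

Lemma CInt_plus (f g : R -> C) (a b : R) :
  a <= b -> cont_on f a b -> cont_on g a b ->
  CInt (fun t => (f t + g t)%C) a b = (CInt f a b + CInt g a b)%C.
Proof.
  intros Hab Hf Hg. destruct (cont_on_ex_RInt f a b Hab Hf), (cont_on_ex_RInt g a b Hab Hg).
  unfold CInt, Cplus; simpl. f_equal; apply (RInt_plus (V := R_CompleteNormedModule)); auto.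
Qed.

Lemma RInt_lin (u v : R -> R) (p q a b : R) :
  ex_RInt u a b -> ex_RInt v a b ->
  RInt (fun t => p * u t + q * v t) a b = p * RInt u a b + q * RInt v a b.
Proof.
  intros Hu Hv. apply is_RInt_unique.
  exact (is_RInt_plus (V := R_NormedModule) _ _ a b _ _
    (is_RInt_scal (V := R_NormedModule) u a b p _ (RInt_correct u a b Hu))
    (is_RInt_scal (V := R_NormedModule) v a b q _ (RInt_correct v a b Hv))).
Qed.

Lemma CInt_scal (f : R -> C) (c : C) (a b : R) :
  a <= b -> cont_on f a b -> CInt (fun t => (c * f t)%C) a b = (c * CInt f a b)%C.
Proof.
  intros Hab Hf. destruct (cont_on_ex_RInt f a b Hab Hf) as [H1 H2].
  unfold CInt, Cmult; simpl. f_equal.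
  - transitivity (RInt (fun t => fst c * fst (f t) + (- snd c) * snd (f t)) a b).
    + apply RInt_ext. intros t _. match goal with |- ?u = ?v => change (@eq R u v) end. ring.
    + rewrite RInt_lin by auto. match goal with |- ?u = ?v => change (@eq R u v) end. ring.
  - rewrite RInt_lin; auto.
Qed.

Lemma CInt_minus (f g : R -> C) (a b : R) :
  a <= b -> cont_on f a b -> cont_on g a b ->
  CInt (fun t => (f t - g t)%C) a b = (CInt f a b - CInt g a b)%C.
Proof.
  intros Hab Hf Hg.
  rewrite (CInt_ext _ (fun t => (f t + RtoC (-1) * g t)%C)); auto.
  - rewrite CInt_plus, CInt_scal; auto. ring.
    intros t Ht. apply ccont_mult; [apply ccont_const|auto].
  - intros t _. ring.
Qed.

Lemma CInt_Chasles (f : R -> C) (a b c : R) :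
  a <= b -> b <= c -> cont_on f a c -> CInt f a c = (CInt f a b + CInt f b c)%C.
Proof.
  intros Hab Hbc Hf.
  destruct (cont_on_ex_RInt f a b Hab) as [H1 H2]; [intros t Ht; apply Hf; lra|].
  destruct (cont_on_ex_RInt f b c Hbc) as [H3 H4]; [intros t Ht; apply Hf; lra|].
  unfold CInt, Cplus; simpl. f_equal; symmetry; apply (RInt_Chasles (V := R_CompleteNormedModule)); auto.
Qed.

Lemma CInt_bound (f : R -> C) (a b M : R) :
  a <= b -> cont_on f a b -> (forall t, a <= t <= b -> Cmod (f t) <= M) ->
  Cmod (CInt f a b) <= 2 * M * (b - a).
Proof.
  intros Hab Hf HM. destruct (cont_on_ex_RInt f a b Hab Hf) as [H1 H2].
  eapply Rle_trans; [apply Cmod_le_sum|]. unfold CInt; simpl.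
  assert (A1 : Rabs (RInt (fun t => fst (f t)) a b) <= (b - a) * M).
  { apply abs_RInt_le_const; auto. intros t Ht.
    eapply Rle_trans; [apply fst_le_Cmod|auto]. }
  assert (A2 : Rabs (RInt (fun t => snd (f t)) a b) <= (b - a) * M).
  { apply abs_RInt_le_const; auto. intros t Ht.
    eapply Rle_trans; [apply snd_le_Cmod|auto]. }
  lra.
Qed.

Lemma cder_ofR_fst (F : R -> C) (t : R) (l : C) :
  cder ofR F t l -> is_derive (fun u => fst (F u)) t (fst l).
Proof.
  intros H. split; [apply is_linear_scal_l|].
  intros x Hx.
  assert (E := is_filter_lim_locally_unique (K := R_AbsRing) (V := AbsRing_NormedModule R_AbsRing) t x Hx).
  subst x.
  intros eps. generalize (cder_estimate _ _ _ _ H eps (cond_pos eps)). apply filter_imp.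
  intros y Hy. unfold ofR in Hy. rewrite <- RtoC_minus, Cmod_R in Hy.
  eapply Rle_trans; [|exact Hy].
  eapply Rle_trans; [|apply fst_le_Cmod].
  right. unfold norm, minus, plus, opp, scal; simpl. unfold abs, mult; simpl. f_equal. ring.
Qed.

Lemma cder_ofR_snd (F : R -> C) (t : R) (l : C) :
  cder ofR F t l -> is_derive (fun u => snd (F u)) t (snd l).
Proof.
  intros H. split; [apply is_linear_scal_l|].
  intros x Hx.
  assert (E := is_filter_lim_locally_unique (K := R_AbsRing) (V := AbsRing_NormedModule R_AbsRing) t x Hx).
  subst x.
  intros eps. generalize (cder_estimate _ _ _ _ H eps (cond_pos eps)). apply filter_imp.
  intros y Hy. unfold ofR in Hy. rewrite <- RtoC_minus, Cmod_R in Hy.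
  eapply Rle_trans; [|exact Hy].
  eapply Rle_trans; [|apply snd_le_Cmod].
  right. unfold norm, minus, plus, opp, scal; simpl. unfold abs, mult; simpl. f_equal. ring.
Qed.

Lemma CInt_derive (F f : R -> C) (a b : R) :
  a <= b -> (forall t, a <= t <= b -> cder ofR F t (f t)) -> cont_on f a b ->
  CInt f a b = (F b - F a)%C.
Proof.
  intros Hab HF Hf. unfold CInt, Cminus, Cplus, Copp; simpl.
  f_equal; apply is_RInt_unique; apply (is_RInt_derive (V := R_CompleteNormedModule) (fun t => _ (F t)));
    intros t Ht; rewrite Rmin_left, Rmax_right in Ht by lra.
  - apply cder_ofR_fst, HF, Ht.
  - apply ccont_fst, Hf, Ht.
  - apply cder_ofR_snd, HF, Ht.
  - apply ccont_snd, Hf, Ht.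
Qed.

Lemma cder_ofR_pair (u v : R -> R) (t a b : R) :
  is_derive u t a -> is_derive v t b -> cder ofR (fun t => (u t, v t)) t (a, b).
Proof.
  intros [_ Hu] [_ Hv]. specialize (Hu t (fun P HP => HP)). specialize (Hv t (fun P HP => HP)).
  apply cder_of_estimate.
  - intros y E. apply RtoC_inj in E. now rewrite E.
  - intros e He. assert (He2 : 0 < e / 2) by lra.
    generalize (filter_and _ _ (Hu (mkposreal _ He2)) (Hv (mkposreal _ He2))).
    apply filter_imp. intros y [A B].
    unfold norm, minus, plus, opp, scal in A, B; simpl in A, B. unfold abs, mult in A, B; simpl in A, B.
    eapply Rle_trans; [apply Cmod_le_sum|].
    unfold ofR. rewrite <- RtoC_minus, Cmod_R. unfold Rminus at 3.
    replace (fst (((u y, v y) - (u t, v t) - (a, b) * RtoC (y - t))%C))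
      with (u y + - u t + - ((y + - t) * a)) by (simpl; ring).
    replace (snd (((u y, v y) - (u t, v t) - (a, b) * RtoC (y - t))%C))
      with (v y + - v t + - ((y + - t) * b)) by (simpl; ring).
    lra.
Qed.

(** * Goursat's lemma *)

Lemma pow2_inv_pos (n : nat) : 0 < / 2 ^ n.
Proof. apply Rinv_0_lt_compat, pow_lt; lra. Qed.

Lemma pow2_inv_S (n : nat) : / 2 ^ S n = / 2 ^ n / 2.
Proof. simpl. rewrite Rinv_mult. lra. Qed.

Lemma pow2_inv_small (K d : R) : 0 < d -> exists n, K * / 2 ^ n <= d.
Proof.
  intros Hd.
  destruct (pow_lt_1_zero (/ 2)) with (y := d / (Rabs K + 1)) as [N HN].
  - rewrite Rabs_pos_eq; lra.
  - apply Rdiv_lt_0_compat; auto. generalize (Rabs_pos K); lra.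
  - exists N. specialize (HN N (le_n N)).
    rewrite pow_inv in HN.
    rewrite Rabs_pos_eq in HN by (left; apply pow2_inv_pos).
    assert (P := pow2_inv_pos N). assert (A := Rabs_pos K). assert (B := Rle_abs K).
    apply Rle_trans with (Rabs K * / 2 ^ N); [apply Rmult_le_compat_r; lra|].
    apply Rle_trans with ((Rabs K + 1) * (d / (Rabs K + 1))).
    + apply Rmult_le_compat; lra.
    + right. field. lra.
Qed.

(** The intervals with left end [x n] and length [L / 2 ^ n] are nested, and the supremum of the
    left ends lies in all of them. *)
Lemma nested_limit (x : nat -> R) (L : R) :
  (forall n, x n <= x (S n) /\ x (S n) + L * / 2 ^ S n <= x n + L * / 2 ^ n) -> 0 <= L ->
  exists c, forall n, x n <= c <= x n + L * / 2 ^ n.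
Proof.
  intros H HL.
  assert (Hm : forall n k, x n <= x (n + k)%nat /\ x (n + k)%nat + L * / 2 ^ (n + k) <= x n + L * / 2 ^ n).
  { intros n k. induction k as [|k IH].
    - rewrite Nat.add_0_r. lra.
    - replace (n + S k)%nat with (S (n + k)) by lia. destruct (H (n + k)%nat). lra. }
  assert (Hb : forall n m, x n <= x m + L * / 2 ^ m).
  { intros n m.
    assert (P : forall k, 0 <= L * / 2 ^ k) by (intros k; apply Rmult_le_pos; [lra|left; apply pow2_inv_pos]).
    destruct (Nat.le_gt_cases n m) as [A|A].
    - destruct (Hm n (m - n)%nat) as [B _]. replace (n + (m - n))%nat with m in B by lia.
      specialize (P m). lra.
    - destruct (Hm m (n - m)%nat) as [_ B]. replace (m + (n - m))%nat with n in B by lia.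
      specialize (P n). lra. }
  destruct (completeness (fun r => exists n, r = x n)) as [c [Hc1 Hc2]].
  - exists (x 0%nat + L * / 2 ^ 0). intros r [n ->]. apply Hb.
  - exists (x 0%nat), 0%nat. reflexivity.
  - exists c. intros n. split.
    + apply Hc1. now exists n.
    + apply Hc2. intros r [m ->]. apply Hb.
Qed.

(** Goursat's bisection, isolated from integrals: by additivity one quarter of a rectangle carries
    at least a quarter of [Cmod B]. Repeated bisection gives rectangles with [Cmod B] at least
    [b / 4 ^ n] shrinking to a point, where the local hypothesis makes it [o(1 / 4 ^ n)]. *)
Lemma additive_rectangle_zero (B : R -> R -> R -> R -> C) (S1 S2 T1 T2 : R) :
  S1 <= S2 -> T1 <= T2 ->
  (forall s1 m s2 t1 t2, S1 <= s1 -> s1 <= m -> m <= s2 -> s2 <= S2 -> T1 <= t1 -> t1 <= t2 -> t2 <= T2 ->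
     B s1 s2 t1 t2 = (B s1 m t1 t2 + B m s2 t1 t2)%C) ->
  (forall s1 s2 t1 m t2, S1 <= s1 -> s1 <= s2 -> s2 <= S2 -> T1 <= t1 -> t1 <= m -> m <= t2 -> t2 <= T2 ->
     B s1 s2 t1 t2 = (B s1 s2 t1 m + B s1 s2 m t2)%C) ->
  (forall s0 t0, S1 <= s0 <= S2 -> T1 <= t0 <= T2 -> forall e, 0 < e -> exists d, 0 < d /\
     forall s1 s2 t1 t2, S1 <= s1 -> s1 <= s0 -> s0 <= s2 -> s2 <= S2 ->
       T1 <= t1 -> t1 <= t0 -> t0 <= t2 -> t2 <= T2 -> s2 - s1 <= d -> t2 - t1 <= d ->
       Cmod (B s1 s2 t1 t2) <= e * ((s2 - s1) + (t2 - t1)) ^ 2) ->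
  B S1 S2 T1 T2 = RtoC 0.
Proof.
  intros HS HT Hs Ht Hloc.
  set (b := Cmod (B S1 S2 T1 T2)).
  set (L := S2 - S1). set (M := T2 - T1).
  assert (HL : 0 <= L) by (unfold L; lra). assert (HM : 0 <= M) by (unfold M; lra).
  (* [p] is the lower left corner of the rectangle reached after [n] bisections. *)
  set (Inv := fun (n : nat) (p : R * R) =>
    S1 <= fst p /\ fst p + L * / 2 ^ n <= S2 /\ T1 <= snd p /\ snd p + M * / 2 ^ n <= T2 /\
    b * / 2 ^ n * / 2 ^ n <= Cmod (B (fst p) (fst p + L * / 2 ^ n) (snd p) (snd p + M * / 2 ^ n))).
  assert (Hstep : forall n (p : {p | Inv n p}), {q : {q | Inv (S n) q} |
     fst (proj1_sig p) <= fst (proj1_sig q) /\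
     fst (proj1_sig q) + L * / 2 ^ S n <= fst (proj1_sig p) + L * / 2 ^ n /\
     snd (proj1_sig p) <= snd (proj1_sig q) /\
     snd (proj1_sig q) + M * / 2 ^ S n <= snd (proj1_sig p) + M * / 2 ^ n }).
  { intros n [[s t] Hp]. apply constructive_indefinite_description. simpl.
    unfold Inv in Hp; simpl in Hp. destruct Hp as [A1 [A2 [A3 [A4 A5]]]].
    set (l := L * / 2 ^ n) in *. set (m := M * / 2 ^ n) in *.
    assert (El : L * / 2 ^ S n = l / 2) by (rewrite pow2_inv_S; unfold l; lra).
    assert (Em : M * / 2 ^ S n = m / 2) by (rewrite pow2_inv_S; unfold m; lra).
    assert (Pl : 0 <= l) by (unfold l; apply Rmult_le_pos; [lra|left; apply pow2_inv_pos]).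
    assert (Pm : 0 <= m) by (unfold m; apply Rmult_le_pos; [lra|left; apply pow2_inv_pos]).
    assert (Eb : b * / 2 ^ S n * / 2 ^ S n = b * / 2 ^ n * / 2 ^ n / 4) by (rewrite pow2_inv_S; lra).
    assert (Split : B s (s + l) t (t + m) =
      Cplus (Cplus (B s (s + l / 2) t (t + m / 2)) (B s (s + l / 2) (t + m / 2) (t + m)))
       (Cplus (B (s + l / 2) (s + l) t (t + m / 2)) (B (s + l / 2) (s + l) (t + m / 2) (t + m)))).
    { rewrite (Hs s (s + l / 2) (s + l)) by lra.
      rewrite (Ht s (s + l / 2) t (t + m / 2) (t + m)) by lra.
      rewrite (Ht (s + l / 2) (s + l) t (t + m / 2) (t + m)) by lra. reflexivity. }
    rewrite Split in A5.
    (* Any of the four quarters, given by its corner [(s', t')], is an admissible successor once it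
       carries its share of [b]. *)
    assert (Key : forall s' t', S1 <= s' -> s' + l / 2 <= S2 -> T1 <= t' -> t' + m / 2 <= T2 ->
      s <= s' -> s' <= s + l / 2 -> t <= t' -> t' <= t + m / 2 ->
      b * / 2 ^ S n * / 2 ^ S n <= Cmod (B s' (s' + l / 2) t' (t' + m / 2)) ->
      exists q : {q | Inv (S n) q}, s <= fst (proj1_sig q) /\
        fst (proj1_sig q) + L * / 2 ^ S n <= s + l /\ t <= snd (proj1_sig q) /\
        snd (proj1_sig q) + M * / 2 ^ S n <= t + m).
    { intros s' t' B1 B2 B3 B4 B5 B6 B7 B8 B9.
      assert (I : Inv (S n) (s', t')).
      { unfold Inv; cbn [fst snd]. rewrite El, Em. repeat split; auto. }
      exists (exist _ (s', t') I). cbn [proj1_sig fst snd]. rewrite El, Em. lra. }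
    destruct (Rle_lt_dec (b * / 2 ^ S n * / 2 ^ S n) (Cmod (B s (s + l / 2) t (t + m / 2)))) as [C1|C1].
    { apply (Key s t); auto; lra. }
    destruct (Rle_lt_dec (b * / 2 ^ S n * / 2 ^ S n) (Cmod (B s (s + l / 2) (t + m / 2) (t + m)))) as [C2|C2].
    { apply (Key s (t + m / 2)); auto; try lra. replace (t + m / 2 + m / 2) with (t + m) by lra. auto. }
    destruct (Rle_lt_dec (b * / 2 ^ S n * / 2 ^ S n) (Cmod (B (s + l / 2) (s + l) t (t + m / 2)))) as [C3|C3].
    { apply (Key (s + l / 2) t); auto; try lra. replace (s + l / 2 + l / 2) with (s + l) by lra. auto. }
    destruct (Rle_lt_dec (b * / 2 ^ S n * / 2 ^ S n) (Cmod (B (s + l / 2) (s + l) (t + m / 2) (t + m)))) as [C4|C4].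
    { apply (Key (s + l / 2) (t + m / 2)); auto; try lra.
      replace (s + l / 2 + l / 2) with (s + l) by lra.
      replace (t + m / 2 + m / 2) with (t + m) by lra. auto. }
    exfalso. rewrite Eb in *.
    assert (T0 := Cmod_triangle (Cplus (B s (s + l / 2) t (t + m / 2)) (B s (s + l / 2) (t + m / 2) (t + m)))
       (Cplus (B (s + l / 2) (s + l) t (t + m / 2)) (B (s + l / 2) (s + l) (t + m / 2) (t + m)))).
    assert (T1' := Cmod_triangle (B s (s + l / 2) t (t + m / 2)) (B s (s + l / 2) (t + m / 2) (t + m))).
    assert (T2' := Cmod_triangle (B (s + l / 2) (s + l) t (t + m / 2)) (B (s + l / 2) (s + l) (t + m / 2) (t + m))).
    lra. }
  assert (I0 : Inv 0%nat (S1, T1)).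
  { unfold Inv. simpl. rewrite Rinv_1, !Rmult_1_r.
    replace (S1 + L) with S2 by (unfold L; lra). replace (T1 + M) with T2 by (unfold M; lra).
    unfold b. lra. }
  set (sq := nat_rect (fun n => {p | Inv n p}) (exist _ (S1, T1) I0) (fun n p => proj1_sig (Hstep n p))).
  assert (Hsq : forall n, fst (proj1_sig (sq n)) <= fst (proj1_sig (sq (S n))) /\
     fst (proj1_sig (sq (S n))) + L * / 2 ^ S n <= fst (proj1_sig (sq n)) + L * / 2 ^ n /\
     snd (proj1_sig (sq n)) <= snd (proj1_sig (sq (S n))) /\
     snd (proj1_sig (sq (S n))) + M * / 2 ^ S n <= snd (proj1_sig (sq n)) + M * / 2 ^ n).
  { intros n. exact (proj2_sig (Hstep n (sq n))). }
  destruct (nested_limit (fun n => fst (proj1_sig (sq n))) L) as [s0 Hs0]; auto.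
  { intros n. destruct (Hsq n) as [X1 [X2 _]]. auto. }
  destruct (nested_limit (fun n => snd (proj1_sig (sq n))) M) as [t0 Ht0]; auto.
  { intros n. destruct (Hsq n) as [_ [_ X]]. auto. }
  assert (Hs00 := Hs0 0%nat). assert (Ht00 := Ht0 0%nat). simpl in Hs00, Ht00.
  rewrite Rinv_1, Rmult_1_r in Hs00, Ht00.
  apply Cmod_eq_0. fold b.
  assert (Hb : 0 <= b) by apply Cmod_ge_0.
  destruct (Rle_lt_dec b 0) as [Hb0|Hb0]; [lra|exfalso].
  (* The summand 1 keeps [D] positive for a degenerate rectangle. With [e = b / (2 D^2)] the local
     bound is at most half of the lower bound [b / 4 ^ n]. *)
  set (D := L + M + 1). assert (HD : 1 <= D) by (unfold D; lra).
  assert (He : 0 < b / (2 * D ^ 2)) by (apply Rdiv_lt_0_compat; nra).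
  destruct (Hloc s0 t0) with (e := b / (2 * D ^ 2)) as [d [Hd Hsm]]; auto.
  { unfold L in *; lra. }
  { unfold M in *; lra. }
  destruct (pow2_inv_small D d Hd) as [n Hn].
  destruct (proj2_sig (sq n)) as [A1 [A2 [A3 [A4 A5]]]].
  specialize (Hs0 n). specialize (Ht0 n). simpl in Hs0, Ht0.
  set (s := fst (proj1_sig (sq n))) in *. set (t := snd (proj1_sig (sq n))) in *.
  assert (P := pow2_inv_pos n). set (r := / 2 ^ n) in *.
  assert (X := Hsm s (s + L * r) t (t + M * r)).
  assert (B1 : L * r <= D * r) by (apply Rmult_le_compat_r; unfold D; lra).
  assert (B2 : M * r <= D * r) by (apply Rmult_le_compat_r; unfold D; lra).
  replace (s + L * r - s) with (L * r) in X by ring.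
  replace (t + M * r - t) with (M * r) in X by ring.
  assert (Y : Cmod (B s (s + L * r) t (t + M * r)) <= b / (2 * D ^ 2) * (L * r + M * r) ^ 2) by (apply X; lra).
  assert (Z : (L * r + M * r) ^ 2 <= D ^ 2 * r ^ 2).
  { replace (D ^ 2 * r ^ 2) with ((D * r) ^ 2) by ring. apply pow_incr. unfold D. nra. }
  assert (W : b / (2 * D ^ 2) * (L * r + M * r) ^ 2 <= b / 2 * r ^ 2).
  { apply Rle_trans with (b / (2 * D ^ 2) * (D ^ 2 * r ^ 2)); [apply Rmult_le_compat_l; lra|].
    right. field. lra. }
  assert (V : 0 < b * r * r) by (repeat apply Rmult_lt_0_compat; auto).
  nra.
Qed.

(** The counterclockwise boundary integral of the form [P ds + Q dt]. For [P = g(G) Gs] and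
    [Q = g(G) Gt] it is the integral of [g dz] along the [G]-image of the boundary. *)
Definition bdry (P Q : R -> R -> C) (s1 s2 t1 t2 : R) : C :=
  (CInt (fun s => P s t1) s1 s2 + CInt (fun t => Q s2 t) t1 t2
   - CInt (fun s => P s t2) s1 s2 - CInt (fun t => Q s1 t) t1 t2)%C.

Lemma bdry_split_s (P Q : R -> R -> C) (s1 m s2 t1 t2 : R) :
  s1 <= m -> m <= s2 ->
  cont_on (fun s => P s t1) s1 s2 -> cont_on (fun s => P s t2) s1 s2 ->
  bdry P Q s1 s2 t1 t2 = (bdry P Q s1 m t1 t2 + bdry P Q m s2 t1 t2)%C.
Proof.
  intros H1 H2 C1 C2. unfold bdry.
  rewrite (CInt_Chasles _ s1 m s2 H1 H2 C1), (CInt_Chasles _ s1 m s2 H1 H2 C2). ring.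
Qed.

Lemma bdry_split_t (P Q : R -> R -> C) (s1 s2 t1 m t2 : R) :
  t1 <= m -> m <= t2 ->
  cont_on (fun t => Q s1 t) t1 t2 -> cont_on (fun t => Q s2 t) t1 t2 ->
  bdry P Q s1 s2 t1 t2 = (bdry P Q s1 s2 t1 m + bdry P Q s1 s2 m t2)%C.
Proof.
  intros H1 H2 C1 C2. unfold bdry.
  rewrite (CInt_Chasles _ t1 m t2 H1 H2 C1), (CInt_Chasles _ t1 m t2 H1 H2 C2). ring.
Qed.

Lemma cont_on_sub (f : R -> C) (a b a' b' : R) :
  a <= a' -> b' <= b -> cont_on f a b -> cont_on f a' b'.
Proof. intros H1 H2 H t Ht. apply H. lra. Qed.

Lemma cont_on_mult (f g : R -> C) (a b : R) :
  cont_on f a b -> cont_on g a b -> cont_on (fun t => (f t * g t)%C) a b.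
Proof. intros Hf Hg t Ht. apply ccont_mult; auto. Qed.

Section Goursat.

Variables (G Gs Gt : R -> R -> C) (S1 S2 T1 T2 L : R) (g g' : C -> C).
Hypothesis HL : 0 < L.
Hypothesis HGs : forall s t, S1 <= s <= S2 -> T1 <= t <= T2 -> cder ofR (fun s => G s t) s (Gs s t).
Hypothesis HGt : forall s t, S1 <= s <= S2 -> T1 <= t <= T2 -> cder ofR (fun t => G s t) t (Gt s t).
Hypothesis HCs : forall t, T1 <= t <= T2 -> cont_on (fun s => Gs s t) S1 S2.
Hypothesis HCt : forall s, S1 <= s <= S2 -> cont_on (fun t => Gt s t) T1 T2.
Hypothesis HLs : forall s t, S1 <= s <= S2 -> T1 <= t <= T2 -> Cmod (Gs s t) <= L.
Hypothesis HLt : forall s t, S1 <= s <= S2 -> T1 <= t <= T2 -> Cmod (Gt s t) <= L.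
Hypothesis Hg : forall s t, S1 <= s <= S2 -> T1 <= t <= T2 -> cder idC g (G s t) (g' (G s t)).

Let P (s t : R) : C := (g (G s t) * Gs s t)%C.
Let Q (s t : R) : C := (g (G s t) * Gt s t)%C.

Lemma goursat_cont_s (h : C -> C) (t : R) :
  (forall s, S1 <= s <= S2 -> @ccont C_UniformSpace h (G s t)) -> T1 <= t <= T2 ->
  cont_on (fun s => (h (G s t) * Gs s t)%C) S1 S2.
Proof.
  intros Hh Ht. apply cont_on_mult; [|apply HCs, Ht].
  intros s Hs. apply (ccont_comp h (fun s => G s t)).
  - apply (cder_cont ofR _ s (Gs s t)); [apply ccont_ofR|auto].
  - apply Hh, Hs.
Qed.

Lemma goursat_cont_t (h : C -> C) (s : R) :
  (forall t, T1 <= t <= T2 -> @ccont C_UniformSpace h (G s t)) -> S1 <= s <= S2 ->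
  cont_on (fun t => (h (G s t) * Gt s t)%C) T1 T2.
Proof.
  intros Hh Hs. apply cont_on_mult; [|apply HCt, Hs].
  intros t Ht. apply (ccont_comp h (fun t => G s t)).
  - apply (cder_cont ofR _ t (Gt s t)); [apply ccont_ofR|auto].
  - apply Hh, Ht.
Qed.

(** The derivative is integrated along a horizontal and a vertical segment; the 2 is the one of
    [CInt_bound]. *)
Lemma goursat_lipschitz (s0 t0 s t : R) :
  S1 <= s0 <= S2 -> T1 <= t0 <= T2 -> S1 <= s <= S2 -> T1 <= t <= T2 ->
  Cmod (G s t - G s0 t0)%C <= 2 * L * (Rabs (s - s0) + Rabs (t - t0)).
Proof.
  intros Hs0 Ht0 Hs Ht.
  assert (A : forall u v x, S1 <= u -> u <= v -> v <= S2 -> T1 <= x <= T2 ->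
     Cmod (G v x - G u x)%C <= 2 * L * (v - u)).
  { intros u v x H1 H2 H3 H4.
    rewrite <- (CInt_derive (fun s => G s x) (fun s => Gs s x) u v); auto.
    - apply CInt_bound; auto; [apply (cont_on_sub _ S1 S2); auto|]. intros r Hr. apply HLs; lra.
    - intros r Hr. apply HGs; lra.
    - apply (cont_on_sub _ S1 S2); auto. }
  assert (B : forall u v x, T1 <= u -> u <= v -> v <= T2 -> S1 <= x <= S2 ->
     Cmod (G x v - G x u)%C <= 2 * L * (v - u)).
  { intros u v x H1 H2 H3 H4.
    rewrite <- (CInt_derive (fun t => G x t) (fun t => Gt x t) u v); auto.
    - apply CInt_bound; auto; [apply (cont_on_sub _ T1 T2); auto|]. intros r Hr. apply HLt; lra.
    - intros r Hr. apply HGt; lra.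
    - apply (cont_on_sub _ T1 T2); auto. }
  assert (A' : Cmod (G s t - G s0 t)%C <= 2 * L * Rabs (s - s0)).
  { destruct (Rle_dec s0 s).
    - rewrite Rabs_pos_eq by lra. apply A; lra.
    - rewrite Cmod_minus_sym, Rabs_minus_sym, Rabs_pos_eq by lra. apply A; lra. }
  assert (B' : Cmod (G s0 t - G s0 t0)%C <= 2 * L * Rabs (t - t0)).
  { destruct (Rle_dec t0 t).
    - rewrite Rabs_pos_eq by lra. apply B; lra.
    - rewrite Cmod_minus_sym, Rabs_minus_sym, Rabs_pos_eq by lra. apply B; lra. }
  generalize (Cmod_dist_triangle (G s t) (G s0 t) (G s0 t0)). lra.
Qed.

(** Each side contributes the difference of [H] at two corners, and these differences cancel around
    the rectangle. It is applied to the first-order Taylor polynomial of [g] at a point. *)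
Lemma goursat_linear (c : C -> C) (H : C -> C) (s1 s2 t1 t2 : R) :
  (forall z, cder idC H z (c z)) -> (forall z, @ccont C_UniformSpace c z) ->
  S1 <= s1 -> s1 <= s2 -> s2 <= S2 -> T1 <= t1 -> t1 <= t2 -> t2 <= T2 ->
  bdry (fun s t => (c (G s t) * Gs s t)%C) (fun s t => (c (G s t) * Gt s t)%C) s1 s2 t1 t2 = RtoC 0.
Proof.
  intros Hc Cc H1 H2 H3 H4 H5 H6. unfold bdry.
  rewrite (CInt_derive (fun s => H (G s t1)) (fun s => (c (G s t1) * Gs s t1)%C) s1 s2); auto.
  2:{ intros s Hs. apply (cder_comp ofR H (fun s => G s t1)); auto; [apply ccont_ofR|apply HGs; lra]. }
  2:{ apply (cont_on_sub _ S1 S2); auto. apply goursat_cont_s; auto; lra. }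
  rewrite (CInt_derive (fun s => H (G s t2)) (fun s => (c (G s t2) * Gs s t2)%C) s1 s2); auto.
  2:{ intros s Hs. apply (cder_comp ofR H (fun s => G s t2)); auto; [apply ccont_ofR|apply HGs; lra]. }
  2:{ apply (cont_on_sub _ S1 S2); auto. apply goursat_cont_s; auto; lra. }
  rewrite (CInt_derive (fun t => H (G s1 t)) (fun t => (c (G s1 t) * Gt s1 t)%C) t1 t2); auto.
  2:{ intros t Ht. apply (cder_comp ofR H (fun t => G s1 t)); auto; [apply ccont_ofR|apply HGt; lra]. }
  2:{ apply (cont_on_sub _ T1 T2); auto. apply goursat_cont_t; auto; lra. }
  rewrite (CInt_derive (fun t => H (G s2 t)) (fun t => (c (G s2 t) * Gt s2 t)%C) t1 t2); auto.
  2:{ intros t Ht. apply (cder_comp ofR H (fun t => G s2 t)); auto; [apply ccont_ofR|apply HGt; lra]. }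
  2:{ apply (cont_on_sub _ T1 T2); auto. apply goursat_cont_t; auto; lra. }
  ring.
Qed.

(** On a small rectangle around a point, [g] differs from its first-order Taylor polynomial [c] by a
    small multiple of the diameter, and [c] integrates to 0. As the sides are also of the order of
    the diameter, the boundary integral is small compared with its square. *)
Lemma goursat : S1 <= S2 -> T1 <= T2 -> bdry P Q S1 S2 T1 T2 = RtoC 0.
Proof.
  intros HS HT.
  assert (Cg : forall s t, S1 <= s <= S2 -> T1 <= t <= T2 -> @ccont C_UniformSpace g (G s t)).
  { intros s t Hs Ht. apply (cder_cont idC g _ (g' (G s t))); [apply ccont_idC|auto]. }
  assert (CP : forall t, T1 <= t <= T2 -> cont_on (fun s => P s t) S1 S2).
  { intros t Ht. apply goursat_cont_s; auto. }
  assert (CQ : forall s, S1 <= s <= S2 -> cont_on (fun t => Q s t) T1 T2).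
  { intros s Hs. apply goursat_cont_t; auto. }
  apply (additive_rectangle_zero (bdry P Q)); auto.
  - intros. apply bdry_split_s; auto; apply (cont_on_sub _ S1 S2); auto; apply CP; lra.
  - intros. apply bdry_split_t; auto; apply (cont_on_sub _ T1 T2); auto; apply CQ; lra.
  - intros s0 t0 Hs0 Ht0 e He.
    (* The sides have total length [2 D], the integrand is at most [e / K * (2 L D) * L], and
       [CInt_bound] adds a factor 2: in all [8 L^2 D^2 e / K], to be [e D^2]. *)
    set (K := 8 * L * L). assert (HK : 0 < K) by (unfold K; nra).
    assert (He' : 0 < e / K) by (apply Rdiv_lt_0_compat; auto).
    assert (X := cder_estimate _ _ _ _ (Hg s0 t0 Hs0 Ht0) _ He').
    apply locally_C_iff in X. destruct X as [d [Hd X]].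
    (* Sides at most [d / (8 L)] keep the image within [2 L * 2 d / (8 L) = d / 2] of [z0]. *)
    exists (d / (8 * L)). split; [apply Rdiv_lt_0_compat; lra|].
    intros s1 s2 t1 t2 A1 A2 A3 A4 B1 B2 B3 B4 D1 D2.
    set (z0 := G s0 t0) in *. set (a := g z0) in *. set (b := g' z0) in *.
    set (c := fun z : C => (a + b * (z - z0))%C).
    set (H := fun z : C => (a * z + b / RtoC 2 * ((z - z0) * (z - z0)))%C).
    assert (Cc : forall z, @ccont C_UniformSpace c z).
    { intros z. unfold c. apply ccont_plus; [apply ccont_const|].
      apply ccont_mult; [apply ccont_const|]. apply ccont_minus; [apply ccont_idC|apply ccont_const]. }
    assert (Hc : forall z, cder idC H z (c z)).
    { intros z. unfold H, c.
      assert (E : cder idC (fun z => (z - z0)%C) z (RtoC 1 - RtoC 0)%C).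
      { apply (cder_minus idC idC (fun _ => z0)); [apply cder_incl|apply cder_const]. }
      eapply cder_eq; [|apply (cder_plus idC (fun z => (a * z)%C) (fun z => (b / RtoC 2 * ((z - z0) * (z - z0)))%C))].
      2: apply (cder_scal idC idC); apply cder_incl.
      2: apply cder_scal, cder_mult; [apply ccont_idC|exact E|exact E].
      unfold idC. field. }
    assert (Z := goursat_linear c H s1 s2 t1 t2 Hc Cc A1 (Rle_trans _ _ _ A2 A3) A4 B1 (Rle_trans _ _ _ B2 B3) B4).
    set (D := (s2 - s1) + (t2 - t1)).
    assert (HD : 0 <= D) by (unfold D; lra).
    assert (Est : forall s t, s1 <= s <= s2 -> t1 <= t <= t2 ->
       Cmod (g (G s t) - c (G s t))%C <= e / K * (2 * L * D)).
    { intros s t Hs Ht.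
      assert (Lip : Cmod (G s t - z0)%C <= 2 * L * D).
      { eapply Rle_trans; [apply goursat_lipschitz; lra|]. apply Rmult_le_compat_l; [lra|].
        assert (Rabs (s - s0) <= s2 - s1) by (apply Rabs_le; lra).
        assert (Rabs (t - t0) <= t2 - t1) by (apply Rabs_le; lra). unfold D; lra. }
      replace (g (G s t) - c (G s t))%C with (g (G s t) - a - b * (G s t - z0))%C by (unfold c; ring).
      eapply Rle_trans; [apply X|apply Rmult_le_compat_l; [lra|exact Lip]].
      eapply Rle_lt_trans; [exact Lip|].
      apply Rle_lt_trans with (2 * L * (2 * (d / (8 * L)))).
      - apply Rmult_le_compat_l; [lra|]. unfold D; lra.
      - replace (2 * L * (2 * (d / (8 * L)))) with (d / 2) by (field; lra). lra. }
    assert (Is : forall t, t1 <= t <= t2 ->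
       Cmod (CInt (fun s => P s t) s1 s2 - CInt (fun s => (c (G s t) * Gs s t)%C) s1 s2)%C
         <= 2 * (e / K * (2 * L * D) * L) * (s2 - s1)).
    { intros t Ht.
      assert (C1 : cont_on (fun s => P s t) s1 s2) by (apply (cont_on_sub _ S1 S2); auto; apply CP; lra).
      assert (C2 : cont_on (fun s => (c (G s t) * Gs s t)%C) s1 s2).
      { apply (cont_on_sub _ S1 S2); auto. apply goursat_cont_s; auto; lra. }
      rewrite <- CInt_minus; auto; [|lra].
      apply CInt_bound; [lra| |].
      - intros s Hs. apply ccont_minus; auto.
      - intros s Hs. unfold P.
        replace (g (G s t) * Gs s t - c (G s t) * Gs s t)%C with ((g (G s t) - c (G s t)) * Gs s t)%C by ring.
        rewrite Cmod_mult. apply Rmult_le_compat; try apply Cmod_ge_0; [apply Est; auto|apply HLs; lra]. }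
    assert (It : forall s, s1 <= s <= s2 ->
       Cmod (CInt (fun t => Q s t) t1 t2 - CInt (fun t => (c (G s t) * Gt s t)%C) t1 t2)%C
         <= 2 * (e / K * (2 * L * D) * L) * (t2 - t1)).
    { intros s Hs.
      assert (C1 : cont_on (fun t => Q s t) t1 t2) by (apply (cont_on_sub _ T1 T2); auto; apply CQ; lra).
      assert (C2 : cont_on (fun t => (c (G s t) * Gt s t)%C) t1 t2).
      { apply (cont_on_sub _ T1 T2); auto. apply goursat_cont_t; auto; lra. }
      rewrite <- CInt_minus; auto; [|lra].
      apply CInt_bound; [lra| |].
      - intros t Ht. apply ccont_minus; auto.
      - intros t Ht. unfold Q.
        replace (g (G s t) * Gt s t - c (G s t) * Gt s t)%C with ((g (G s t) - c (G s t)) * Gt s t)%C by ring.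
        rewrite Cmod_mult. apply Rmult_le_compat; try apply Cmod_ge_0; [apply Est; auto|apply HLt; lra]. }
    assert (J1 := Is t1). assert (J2 := Is t2). assert (J3 := It s1). assert (J4 := It s2).
    unfold bdry in *.
    set (p1 := CInt (fun s => P s t1) s1 s2) in *. set (p2 := CInt (fun s => P s t2) s1 s2) in *.
    set (q1 := CInt (fun t => Q s1 t) t1 t2) in *. set (q2 := CInt (fun t => Q s2 t) t1 t2) in *.
    set (p1' := CInt (fun s => (c (G s t1) * Gs s t1)%C) s1 s2) in *.
    set (p2' := CInt (fun s => (c (G s t2) * Gs s t2)%C) s1 s2) in *.
    set (q1' := CInt (fun t => (c (G s1 t) * Gt s1 t)%C) t1 t2) in *.
    set (q2' := CInt (fun t => (c (G s2 t) * Gt s2 t)%C) t1 t2) in *.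
    replace (p1 + q2 - p2 - q1)%C
      with (((p1 - p1') + (q2 - q2')) + ((- (p2 - p2')) + (- (q1 - q1'))) + (p1' + q2' - p2' - q1'))%C by ring.
    rewrite Z, Cplus_0_r.
    eapply Rle_trans; [apply Cmod_triangle|].
    assert (K1 := Cmod_triangle (p1 - p1')%C (q2 - q2')%C).
    assert (K2 := Cmod_triangle (- (p2 - p2'))%C (- (q1 - q1'))%C).
    rewrite !Cmod_opp in K2.
    specialize (J1 ltac:(lra)). specialize (J2 ltac:(lra)). specialize (J3 ltac:(lra)). specialize (J4 ltac:(lra)).
    apply Rle_trans with (4 * (e / K * (2 * L * D) * L) * D); [unfold D in *; lra|].
    right. unfold K. field. lra.
Qed.

End Goursat.

(** * Cauchy's integral formula *)

Definition holo (U : C -> Prop) (f : C -> C) : Prop :=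
  forall z, U z -> exists l, cder idC f z l.

Definition ball0 (r : R) (z : C) : Prop := Cmod z < r.

Definition expi (t : R) : C := (cos t, sin t).
Definition circ (r t : R) : C := (RtoC r * expi t)%C.
Definition dcirc (r t : R) : C := (Ci * circ r t)%C.

Lemma cder_unique (f : C -> C) (z a b : C) : cder idC f z a -> cder idC f z b -> a = b.
Proof. intros Ha Hb. now rewrite <- (C_derive_cder f z a Ha), <- (C_derive_cder f z b Hb). Qed.

Lemma cder_ccont (f : C -> C) (z l : C) : cder idC f z l -> @ccont C_UniformSpace f z.
Proof. apply cder_cont, ccont_idC. Qed.

Lemma cder_expi (t : R) : cder ofR expi t (Ci * expi t)%C.
Proof.
  apply (cder_eq _ _ _ (- sin t, cos t)).
  - unfold expi, Ci, Cmult. simpl. f_equal; ring.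
  - apply (cder_ofR_pair cos sin).
    + apply is_derive_Reals, derivable_pt_lim_cos.
    + apply is_derive_Reals, derivable_pt_lim_sin.
Qed.

Lemma Cmod_expi (t : R) : Cmod (expi t) = 1.
Proof.
  unfold Cmod, expi. simpl. rewrite !Rmult_1_r.
  rewrite Rplus_comm. change (sqrt ((sin t)² + (cos t)²) = 1). rewrite sin2_cos2. apply sqrt_1.
Qed.

Lemma cder_circ (r t : R) : cder ofR (circ r) t (dcirc r t).
Proof.
  apply (cder_eq _ _ _ (RtoC r * (Ci * expi t))%C); [unfold dcirc, circ; ring|].
  apply cder_scal, cder_expi.
Qed.

Lemma Cmod_circ (r t : R) : 0 <= r -> Cmod (circ r t) = r.
Proof. intros H. unfold circ. rewrite Cmod_mult, Cmod_R, Cmod_expi, Rabs_pos_eq; lra. Qed.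

Lemma Cmod_dcirc (r t : R) : 0 <= r -> Cmod (dcirc r t) = r.
Proof. intros H. unfold dcirc. rewrite Cmod_mult, Cmod_Ci, Cmod_circ; lra. Qed.

Lemma circ_period (r : R) : circ r (2 * PI) = circ r 0.
Proof. unfold circ, expi. now rewrite cos_2PI, sin_2PI, cos_0, sin_0. Qed.

Lemma ccont_circ (r t : R) : @ccont R_UniformSpace (circ r) t.
Proof. apply (cder_cont ofR _ t (dcirc r t)); [apply ccont_ofR|apply cder_circ]. Qed.

Lemma ccont_dcirc (r t : R) : @ccont R_UniformSpace (dcirc r) t.
Proof. apply (ccont_mult (X := R_UniformSpace) (fun _ => Ci)); [apply ccont_const|apply ccont_circ]. Qed.

Lemma circ_minus_bound (r t : R) (w : C) : 0 <= r -> r - Cmod w <= Cmod (circ r t - w)%C.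
Proof. intros H. rewrite <- (Cmod_circ r t H) at 1. apply Cmod_triangle_rev. Qed.

Lemma circ_neq (r t : R) (w : C) : 0 <= r -> Cmod w < r -> (circ r t - w)%C <> RtoC 0.
Proof. intros H Hw. apply Cmod_pos_neq_0. generalize (circ_minus_bound r t w H). lra. Qed.

Lemma CInt_const (c : C) (a b : R) : a <= b -> CInt (fun _ => c) a b = (c * RtoC (b - a))%C.
Proof.
  intros Hab. rewrite (CInt_derive (fun t => c * ofR t)%C (fun _ => c)); auto.
  - unfold ofR. rewrite RtoC_minus. ring.
  - intros t _. apply (cder_eq _ _ _ (c * RtoC 1)%C); [ring|]. apply cder_scal, cder_incl.
  - intros t _. apply ccont_const.
Qed.

Definition cauchy_kernel (r : R) (w : C) (t : R) : C := (dcirc r t / (circ r t - w))%C.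

Lemma ccont_cauchy_kernel (r : R) (w : C) (t : R) :
  0 <= r -> Cmod w < r -> @ccont R_UniformSpace (cauchy_kernel r w) t.
Proof.
  intros Hr Hw. apply ccont_div; [apply ccont_dcirc| |apply circ_neq; auto].
  apply ccont_minus; [apply ccont_circ|apply ccont_const].
Qed.

Lemma Cmod_cauchy_kernel (r : R) (w : C) (t : R) :
  0 <= r -> Cmod w < r -> Cmod (cauchy_kernel r w t) <= r / (r - Cmod w).
Proof.
  intros Hr Hw. unfold cauchy_kernel. rewrite Cmod_div by (apply circ_neq; auto).
  rewrite Cmod_dcirc by auto. unfold Rdiv. apply Rmult_le_compat_l; auto.
  apply Rinv_le_contravar; [lra|]. apply circ_minus_bound; auto.
Qed.

(* Homotopy of the circle translated by [-w] to the circle, avoiding [0]. *)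
Lemma CInt_cauchy_kernel (r : R) (w : C) :
  Cmod w < r -> CInt (cauchy_kernel r w) 0 (2 * PI) = (RtoC (2 * PI) * Ci)%C.
Proof.
  intros Hw. assert (Hr : 0 < r) by (generalize (Cmod_ge_0 w); lra).
  assert (HPI := PI_RGT_0).
  assert (Nz : forall s t, 0 <= s <= 1 -> (circ r t - RtoC s * w)%C <> RtoC 0).
  { intros s t Hs. apply circ_neq; [lra|]. rewrite Cmod_mult, Cmod_R, Rabs_pos_eq by lra.
    generalize (Cmod_ge_0 w). nra. }
  assert (B := goursat (fun s t => (circ r t - RtoC s * w)%C) (fun s t => (- w)%C) (fun s t => dcirc r t)
    0 1 0 (2 * PI) r (fun z => (/ z)%C) (fun z => (- RtoC 1 / (z * z))%C) Hr).
  assert (B0 := B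
    ltac:(intros s t Hs Ht; apply (cder_eq _ _ _ (RtoC 0 - (RtoC 1 * w + ofR s * RtoC 0))%C);
       [unfold ofR; ring| apply (cder_minus ofR (fun _ => circ r t)); [apply cder_const|
        apply (cder_mult ofR ofR (fun _ => w)); [apply ccont_ofR|apply cder_incl|apply cder_const]]])
    ltac:(intros s t Hs Ht; apply (cder_eq _ _ _ (dcirc r t - RtoC 0)%C);
       [ring| apply (cder_minus ofR (circ r) (fun _ => _)); [apply cder_circ|apply cder_const]])
    ltac:(intros t Ht s Hs; apply ccont_const)
    ltac:(intros s Hs t Ht; apply ccont_dcirc)
    ltac:(intros s t Hs Ht; cbv beta; rewrite Cmod_opp; lra)
    ltac:(intros s t Hs Ht; cbv beta; rewrite Cmod_dcirc; lra)
    ltac:(intros s t Hs Ht; apply (cder_inv idC idC); [apply ccont_idC|apply cder_incl|apply Nz; auto])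
    ltac:(lra) ltac:(lra)).
  (* By periodicity the sides [t = 0] and [t = 2 PI] cancel, so the integrals over the closed curves
     [s = 0] and [s = 1] agree. *)
  clear B. unfold bdry in B0. rewrite circ_period in B0.
  match type of B0 with (?p1 + ?q2 - ?p2 - ?q1)%C = _ =>
    assert (E : q2 = q1) by (transitivity (p1 + q2 - p2 - q1 + q1)%C; [ring|rewrite B0; ring]) end.
  transitivity (CInt (fun t => (/ (circ r t - RtoC 1 * w) * dcirc r t)%C) 0 (2 * PI)).
  { apply CInt_ext; [lra|]. intros t _. unfold cauchy_kernel, Cdiv. rewrite Cmult_1_l. ring. }
  rewrite E.
  rewrite (CInt_ext _ (fun _ => Ci)); [|lra|].
  - rewrite CInt_const by lra. rewrite Rminus_0_r. ring.
  - intros t _. specialize (Nz 0 t ltac:(lra)). unfold dcirc.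
    replace (circ r t - RtoC 0 * w)%C with (circ r t) in * by ring. field. exact Nz.
Qed.

(* Homotopy of the circle to the point [w] by the homotheties of centre [w]. *)
Lemma cauchy_formula_kernel (R0 r : R) (f : C -> C) (w : C) :
  holo (ball0 R0) f -> r < R0 -> Cmod w < r ->
  CInt (fun t => (f (circ r t) * cauchy_kernel r w t)%C) 0 (2 * PI)
    = (f w * (RtoC (2 * PI) * Ci))%C.
Proof.
  intros Hf HR Hw. assert (Hr : 0 < r) by (generalize (Cmod_ge_0 w); lra).
  assert (HPI := PI_RGT_0).
  set (G := fun s t => (w + RtoC s * (circ r t - w))%C).
  assert (HG : forall s t, 0 <= s <= 1 -> Cmod (G s t) <= r).
  { intros s t Hs. unfold G.
    replace (w + RtoC s * (circ r t - w))%C with (RtoC (1 - s) * w + RtoC s * circ r t)%C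
      by (rewrite RtoC_minus; ring).
    eapply Rle_trans; [apply Cmod_triangle|].
    rewrite !Cmod_mult, !Cmod_R, !Rabs_pos_eq, Cmod_circ by lra. nra. }
  assert (Cf : forall z, Cmod z <= r -> @ccont C_UniformSpace f z).
  { intros z Hz. destruct (Hf z) as [l Hl]; [unfold ball0; lra|]. apply (cder_ccont f z l Hl). }
  assert (Cfc : forall t, @ccont R_UniformSpace (fun t => f (circ r t)) t).
  { intros t. apply (ccont_comp f (circ r)); [apply ccont_circ|]. apply Cf. rewrite Cmod_circ; lra. }
  assert (CK := fun t => ccont_cauchy_kernel r w t (Rlt_le _ _ Hr) Hw).
  assert (CG : forall s t, 0 <= s <= 1 -> @ccont R_UniformSpace (fun t => f (G s t)) t).
  { intros s t Hs. apply (ccont_comp f (fun t => G s t)); [|apply Cf, HG, Hs].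
    unfold G. apply ccont_plus; [apply ccont_const|]. apply ccont_mult; [apply ccont_const|].
    apply ccont_minus; [apply ccont_circ|apply ccont_const]. }
  set (I := CInt (fun t => (f (circ r t) * cauchy_kernel r w t)%C) 0 (2 * PI)).
  (* The integrand [f z / (z - w)] is singular at [w], so the homotopy stops at the scale [e > 0];
     continuity of [f] at [w] then gives the limit. *)
  assert (Hhom : forall e, 0 < e <= 1 ->
    I = CInt (fun t => (f (G e t) * cauchy_kernel r w t)%C) 0 (2 * PI)).
  { intros e He.
    (* [goursat] takes the derivative as a total function; the default 0 outside the ball is never
       met, as [G] stays inside. *)
    set (f' := fun z => match excluded_middle_informative (ball0 R0 z) with
                        | left H => proj1_sig (constructive_indefinite_description _ (Hf z H))
                        | right _ => RtoC 0 end).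
    assert (Hf' : forall z, ball0 R0 z -> cder idC f z (f' z)).
    { intros z Hz. unfold f'. destruct (excluded_middle_informative (ball0 R0 z)); [|contradiction].
      apply proj2_sig. }
    assert (Nz : forall s t, e <= s <= 1 -> (G s t - w)%C <> RtoC 0).
    { intros s t Hs. unfold G. replace (w + RtoC s * (circ r t - w) - w)%C with (RtoC s * (circ r t - w))%C by ring.
      apply Cmult_neq_0; [|apply circ_neq; lra]. intros E. apply RtoC_inj in E. lra. }
    assert (HL : 0 < 2 * r) by lra.
    assert (B := goursat G (fun s t => (circ r t - w)%C) (fun s t => (RtoC s * dcirc r t)%C)
      e 1 0 (2 * PI) (2 * r) (fun z => (f z / (z - w))%C)
      (fun z => ((f' z * (z - w) - f z * (RtoC 1 - RtoC 0)) / ((z - w) * (z - w)))%C) HL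
      ltac:(intros s t Hs Ht; apply (cder_eq _ _ _ (RtoC 0 + (RtoC 1 * (circ r t - w) + ofR s * RtoC 0))%C);
        [unfold ofR; ring| apply (cder_plus ofR (fun _ => w)); [apply cder_const|
         apply (cder_mult ofR ofR (fun _ => _)); [apply ccont_ofR|apply cder_incl|apply cder_const]]])
      ltac:(intros s t Hs Ht; apply (cder_eq _ _ _ (RtoC 0 + RtoC s * (dcirc r t - RtoC 0))%C);
        [ring| apply (cder_plus ofR (fun _ => w)); [apply cder_const|
         apply (cder_scal ofR); apply (cder_minus ofR (circ r) (fun _ => _)); [apply cder_circ|apply cder_const]]])
      ltac:(intros t Ht s Hs; apply ccont_const)
      ltac:(intros s Hs t Ht; apply ccont_mult; [apply ccont_const|apply ccont_dcirc])
      ltac:(intros s t Hs Ht; cbv beta; unfold Cminus; eapply Rle_trans; [apply Cmod_triangle|];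
        rewrite Cmod_opp, Cmod_circ; lra)
      ltac:(intros s t Hs Ht; cbv beta; rewrite Cmod_mult, Cmod_R, Rabs_pos_eq, Cmod_dcirc by lra; nra)
      ltac:(intros s t Hs Ht; apply (cder_div idC f (fun z => (z - w)%C));
        [apply ccont_idC|apply Hf'; generalize (HG s t ltac:(lra)); unfold ball0; lra
        |apply (cder_minus idC idC (fun _ => w)); [apply cder_incl|apply cder_const]|apply Nz; lra])
      ltac:(lra) ltac:(lra)).
    unfold bdry in B.
    match type of B with (?p1 + ?q2 - ?p2 - ?q1)%C = _ =>
      assert (E12 : p2 = p1);
      [|rewrite E12 in B; assert (E : q2 = q1) by (transitivity (p1 + q2 - p1 - q1 + q1)%C; [ring|rewrite B; ring])]
    end.
    { apply CInt_ext; [lra|]. intros s _. unfold G. now rewrite circ_period. }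
    transitivity (CInt (fun t => (f (G 1 t) / (G 1 t - w) * (RtoC 1 * dcirc r t))%C) 0 (2 * PI)).
    - apply CInt_ext; [lra|]. intros t _. unfold G, cauchy_kernel.
      replace (w + RtoC 1 * (circ r t - w))%C with (circ r t) by ring. field. apply circ_neq; lra.
    - rewrite E. apply CInt_ext; [lra|]. intros t _. unfold cauchy_kernel.
      assert (N1 := Nz e t ltac:(lra)). unfold G at 2.
      replace (w + RtoC e * (circ r t - w) - w)%C with (RtoC e * (circ r t - w))%C by ring.
      field. split; [apply circ_neq; lra|]. intros E'. apply RtoC_inj in E'. lra. }
  rewrite <- (CInt_cauchy_kernel r w Hw).
  rewrite <- CInt_scal by (try lra; intros t _; apply CK).
  apply Ceq_minus, Cmod_eq_0. apply Rle_antisym; [|apply Cmod_ge_0].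
  apply le_epsilon. intros eta Heta. rewrite Rplus_0_l.
  set (M := r / (r - Cmod w)).
  assert (HM : 0 < M) by (apply Rdiv_lt_0_compat; lra).
  (* The denominator collects the 2 of [CInt_bound], the length [2 PI] of the interval and the bound
     [M] of the kernel. *)
  set (k := eta / (2 * (2 * PI) * M)).
  assert (Hk : 0 < k) by (apply Rdiv_lt_0_compat; auto; apply Rmult_lt_0_compat; lra).
  destruct (proj1 (ccont_C_iff f w) (Cf w (Rlt_le _ _ Hw)) k Hk) as [d [Hd Hfw]].
  (* Points of the circle are within [2 r] of [w], so the scaled circle is within [d / 2] of [w]. *)
  set (e := Rmin 1 (d / (4 * r))).
  assert (He : 0 < e <= 1).
  { split; [apply Rmin_pos; [lra|apply Rdiv_lt_0_compat; lra]|apply Rmin_l]. }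
  assert (He2 : e * (2 * r) < d).
  { apply Rle_lt_trans with (d / (4 * r) * (2 * r)).
    - apply Rmult_le_compat_r; [lra|apply Rmin_r].
    - replace (d / (4 * r) * (2 * r)) with (d / 2) by (field; lra). lra. }
  fold I. rewrite (Hhom e He).
  rewrite <- CInt_minus.
  - replace eta with (2 * (k * M) * (2 * PI - 0)).
    2:{ unfold k. field. split; [lra|]. lra. }
    apply CInt_bound; [lra| |].
    + intros t _. apply ccont_minus; apply ccont_mult; auto; [apply CG; lra|apply ccont_const].
    + intros t _.
      replace (f (G e t) * cauchy_kernel r w t - f w * cauchy_kernel r w t)%C
        with ((f (G e t) - f w) * cauchy_kernel r w t)%C by ring.
      rewrite Cmod_mult. apply Rmult_le_compat; try apply Cmod_ge_0; [|apply Cmod_cauchy_kernel; lra].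
      left. apply Hfw. unfold G.
      replace (w + RtoC e * (circ r t - w) - w)%C with (RtoC e * (circ r t - w))%C by ring.
      rewrite Cmod_mult, Cmod_R, Rabs_pos_eq by lra.
      eapply Rle_lt_trans; [apply Rmult_le_compat_l; [lra|]|exact He2].
      unfold Cminus. eapply Rle_trans; [apply Cmod_triangle|]. rewrite Cmod_opp, Cmod_circ; lra.
  - lra.
  - intros t _. apply ccont_mult; auto. apply CG; lra.
  - intros t _. apply ccont_mult; auto. apply ccont_const.
Qed.

Lemma two_pi_i_neq_0 : (RtoC (2 * PI) * Ci)%C <> RtoC 0.
Proof.
  apply Cmult_neq_0; [|apply Ci_nz]. intros E. apply RtoC_inj in E. generalize PI_RGT_0. lra.
Qed.

(** The kernel is separated into a density independent of [w] and the factor [/ (circ r t - w)],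
    which is the shape differentiated under the integral below. *)
Lemma cauchy_formula (R0 r : R) (f : C -> C) (w : C) :
  holo (ball0 R0) f -> r < R0 -> Cmod w < r ->
  f w = CInt (fun t => (f (circ r t) * dcirc r t / (RtoC (2 * PI) * Ci) * / (circ r t - w))%C) 0 (2 * PI).
Proof.
  intros Hf HR Hw. assert (Hr : 0 < r) by (generalize (Cmod_ge_0 w); lra).
  assert (HPI := PI_RGT_0). assert (N := two_pi_i_neq_0).
  assert (F := cauchy_formula_kernel R0 r f w Hf HR Hw).
  rewrite (CInt_ext _ (fun t => (/ (RtoC (2 * PI) * Ci) * (f (circ r t) * cauchy_kernel r w t))%C)); [|lra|].
  - rewrite CInt_scal, F; [field; auto|lra|].
    + split; [apply Ci_nz|]. intros E. apply RtoC_inj in E. lra.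
    + intros t _. apply ccont_mult; [|apply ccont_cauchy_kernel; lra].
      apply (ccont_comp f (circ r)); [apply ccont_circ|].
      destruct (Hf (circ r t)) as [l Hl]; [unfold ball0; rewrite Cmod_circ; lra|].
      apply (cder_ccont f _ l Hl).
  - intros t _. unfold cauchy_kernel, Cdiv. ring.
Qed.

(** * Differentiation under the integral and Cauchy-type integrals *)

(** The error of the first-order expansion of the integrand is quadratic in [w - w0] uniformly in
    [t], hence so is its integral. *)
Lemma cder_CInt_param (phi : R -> C) (k : R -> C -> C) (k' : R -> C) (w0 : C) (a b B d : R) :
  a <= b -> 0 < d -> 0 <= B ->
  (forall w, Cmod (w - w0)%C < d -> cont_on (fun t => k t w) a b) ->
  cont_on k' a b -> cont_on phi a b ->
  (forall t w, a <= t <= b -> Cmod (w - w0)%C < d ->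
     Cmod (phi t * (k t w - k t w0 - (w - w0) * k' t))%C <= B * Cmod (w - w0)%C ^ 2) ->
  cder idC (fun w => CInt (fun t => (phi t * k t w)%C) a b) w0 (CInt (fun t => (phi t * k' t)%C) a b).
Proof.
  intros Hab Hd HB Ck Ck' Cphi HE. apply cder_of_estimate; [intros y E; unfold idC in E; now rewrite E|].
  intros e He. apply locally_C_iff.
  (* The summand 1 only makes [K] positive, so that [e / K] is defined. *)
  set (K := 2 * B * (b - a) + 1). assert (HK : 0 < K) by (unfold K; nra).
  exists (Rmin d (e / K)). split; [apply Rmin_pos; auto; apply Rdiv_lt_0_compat; auto|].
  intros w Hw. unfold idC.
  assert (W1 : Cmod (w - w0)%C < d) by (eapply Rlt_le_trans; [exact Hw|apply Rmin_l]).
  assert (W2 : Cmod (w - w0)%C < e / K) by (eapply Rlt_le_trans; [exact Hw|apply Rmin_r]).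
  assert (W0 : Cmod (w0 - w0)%C < d) by (replace (w0 - w0)%C with (RtoC 0) by ring; rewrite Cmod_0; auto).
  assert (C1 := Ck w W1). assert (C0 := Ck w0 W0).
  rewrite (Cmult_comm _ (w - w0)%C).
  rewrite <- CInt_scal; auto; [|apply cont_on_mult; auto].
  rewrite <- CInt_minus; auto; [|apply cont_on_mult; auto..].
  rewrite <- CInt_minus; auto.
  2:{ intros t Ht. apply ccont_minus; apply ccont_mult; auto. }
  2:{ intros t Ht. apply ccont_mult; [apply ccont_const|apply ccont_mult; auto]. }
  apply Rle_trans with (2 * (B * Cmod (w - w0)%C ^ 2) * (b - a)).
  - apply CInt_bound; auto.
    + intros t Ht. apply ccont_minus; [apply ccont_minus; apply ccont_mult; auto|].
      apply ccont_mult; [apply ccont_const|apply ccont_mult; auto].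
    + intros t Ht.
      replace (phi t * k t w - phi t * k t w0 - (w - w0) * (phi t * k' t))%C
        with (phi t * (k t w - k t w0 - (w - w0) * k' t))%C by ring. auto.
  - assert (P := Cmod_ge_0 (w - w0)%C).
    assert (Q : K * Cmod (w - w0)%C <= e).
    { apply Rle_trans with (K * (e / K)); [apply Rmult_le_compat_l; lra|]. right. field. lra. }
    assert (S : (2 * B * (b - a)) * Cmod (w - w0)%C <= e).
    { eapply Rle_trans; [|exact Q]. apply Rmult_le_compat_r; auto. unfold K. lra. }
    replace (2 * (B * Cmod (w - w0)%C ^ 2) * (b - a))
      with ((2 * B * (b - a)) * Cmod (w - w0)%C * Cmod (w - w0)%C) by ring.
    apply Rmult_le_compat_r; auto.
Qed.

Lemma continuous_bounded (f : R -> C) (a b : R) :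
  a <= b -> cont_on f a b -> exists M, 0 <= M /\ forall t, a <= t <= b -> Cmod (f t) <= M.
Proof.
  intros Hab Hf.
  destruct (continuity_ab_maj (fun t => Cmod (f t)) a b Hab) as [m [Hm _]].
  - intros t Ht. apply continuity_pt_filterlim. apply filterlim_locally. intros eps.
    generalize (Hf t Ht eps (cond_pos eps)). apply filter_imp. intros y Hy.
    eapply Rle_lt_trans; [|exact Hy].
    unfold minus, plus, opp, abs; simpl. apply Rabs_le.
    assert (X := Cmod_triangle_rev (f y) (f t)). assert (Y := Cmod_triangle_rev (f t) (f y)).
    rewrite Cmod_minus_sym in Y. lra.
  - exists (Cmod (f m)). split; [apply Cmod_ge_0|exact Hm].
Qed.

Section CauchyType.

Variables (r : R) (phi : R -> C) (M : R) (w0 : C).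
Hypothesis Hphi : forall t, @ccont R_UniformSpace phi t.
Hypothesis HM : 0 <= M /\ forall t, 0 <= t <= 2 * PI -> Cmod (phi t) <= M.
Hypothesis Hw0 : Cmod w0 < r.

(** Half the distance from [w0] to the circle: points within [d] of [w0] keep distance at least [d]
    from the circle. *)
Let d := (r - Cmod w0) / 2.

Lemma cauchy_type_bound (w : C) (t : R) :
  Cmod (w - w0)%C < d -> (circ r t - w)%C <> RtoC 0 /\ Cmod (/ (circ r t - w))%C <= / d.
Proof.
  intros Hw. assert (Hr : 0 < r) by (generalize (Cmod_ge_0 w0); lra).
  assert (X : Cmod w < Cmod w0 + d).
  { replace w with ((w - w0) + w0)%C by ring. eapply Rle_lt_trans; [apply Cmod_triangle|]. lra. }
  assert (Y : d <= Cmod (circ r t - w)%C).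
  { eapply Rle_trans; [|apply circ_minus_bound; lra]. unfold d in *. lra. }
  assert (N : (circ r t - w)%C <> RtoC 0) by (apply Cmod_pos_neq_0; unfold d in *; lra).
  split; auto. rewrite Cmod_inv by auto. apply Rinv_le_contravar; auto. unfold d; lra.
Qed.

Lemma cauchy_type_cont (w : C) (t : R) :
  Cmod (w - w0)%C < d -> @ccont R_UniformSpace (fun t => (/ (circ r t - w))%C) t.
Proof.
  intros Hw. apply ccont_inv; [|apply cauchy_type_bound, Hw].
  apply ccont_minus; [apply ccont_circ|apply ccont_const].
Qed.

Lemma cauchy_type_center : Cmod (w0 - w0)%C < d.
Proof. replace (w0 - w0)%C with (RtoC 0) by ring. rewrite Cmod_0. unfold d; lra. Qed.

(** With [u] and [v] the kernels at [w0] and [w], two uses of [v - u = (w - w0) u v] give the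
    remainder [(w - w0)^2 u^2 v], at most [|w - w0|^2 / d^3]. *)
Lemma cder_cauchy_type_1 :
  cder idC (fun w => CInt (fun t => (phi t * / (circ r t - w))%C) 0 (2 * PI)) w0
    (CInt (fun t => (phi t * (/ (circ r t - w0) * / (circ r t - w0)))%C) 0 (2 * PI)).
Proof.
  assert (HPI := PI_RGT_0). assert (Hd : 0 < d) by (unfold d; lra).
  assert (Hd' : 0 < / d) by (apply Rinv_0_lt_compat; auto).
  apply (cder_CInt_param phi (fun t w => (/ (circ r t - w))%C)
    (fun t => (/ (circ r t - w0) * / (circ r t - w0))%C) w0 0 (2 * PI) (M * (/ d * / d * / d)) d); auto.
  - lra.
  - apply Rmult_le_pos; [apply HM|]. left. repeat apply Rmult_lt_0_compat; auto.
  - intros w Hw t _. apply cauchy_type_cont, Hw.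
  - intros t _. apply ccont_mult; apply cauchy_type_cont, cauchy_type_center.
  - intros t _. apply Hphi.
  - intros t w Ht Hw.
    destruct (cauchy_type_bound w t Hw) as [N1 B1].
    destruct (cauchy_type_bound w0 t cauchy_type_center) as [N0 B0].
    set (u := (/ (circ r t - w0))%C) in *. set (v := (/ (circ r t - w))%C) in *.
    assert (E : (v - u)%C = ((w - w0) * u * v)%C) by (unfold u, v; field; auto).
    replace (phi t * (v - u - (w - w0) * (u * u)))%C with (phi t * (u * u * v) * ((w - w0) * (w - w0)))%C.
    2:{ rewrite E. replace ((w - w0) * u * v - (w - w0) * (u * u))%C with ((w - w0) * u * (v - u))%C by ring.
        rewrite E. ring. }
    rewrite !Cmod_mult. simpl. rewrite Rmult_1_r.
    apply Rmult_le_compat_r; [apply Rmult_le_pos; apply Cmod_ge_0|].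
    repeat apply Rmult_le_compat; auto; try apply Cmod_ge_0; repeat apply Rmult_le_pos; try apply Cmod_ge_0.
    apply HM, Ht.
Qed.

(** The same identity [v - u = (w - w0) u v] turns the remainder of the squared kernel into
    [(w - w0)^2 u^2 v (v + 2 u)]. *)
Lemma cder_cauchy_type_2 :
  cder idC (fun w => CInt (fun t => (phi t * (/ (circ r t - w) * / (circ r t - w)))%C) 0 (2 * PI)) w0
    (CInt (fun t => (phi t * (RtoC 2 * (/ (circ r t - w0) * / (circ r t - w0) * / (circ r t - w0))))%C) 0 (2 * PI)).
Proof.
  assert (HPI := PI_RGT_0). assert (Hd : 0 < d) by (unfold d; lra).
  assert (Hd' : 0 < / d) by (apply Rinv_0_lt_compat; auto).
  apply (cder_CInt_param phi (fun t w => (/ (circ r t - w) * / (circ r t - w))%C)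
    (fun t => (RtoC 2 * (/ (circ r t - w0) * / (circ r t - w0) * / (circ r t - w0)))%C)
    w0 0 (2 * PI) (M * (/ d * / d * / d * (3 * / d))) d); auto.
  - lra.
  - apply Rmult_le_pos; [apply HM|]. left. repeat apply Rmult_lt_0_compat; auto; lra.
  - intros w Hw t _. apply ccont_mult; apply cauchy_type_cont, Hw.
  - intros t _. apply ccont_mult; [apply ccont_const|].
    repeat apply ccont_mult; apply cauchy_type_cont, cauchy_type_center.
  - intros t _. apply Hphi.
  - intros t w Ht Hw.
    destruct (cauchy_type_bound w t Hw) as [N1 B1].
    destruct (cauchy_type_bound w0 t cauchy_type_center) as [N0 B0].
    set (u := (/ (circ r t - w0))%C) in *. set (v := (/ (circ r t - w))%C) in *.
    assert (E : (v - u)%C = ((w - w0) * u * v)%C) by (unfold u, v; field; auto).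
    replace (phi t * (v * v - u * u - (w - w0) * (RtoC 2 * (u * u * u))))%C
      with (phi t * (u * u * v * (v + RtoC 2 * u)) * ((w - w0) * (w - w0)))%C.
    2:{ replace (v * v - u * u)%C with ((v - u) * (v + u))%C by ring. rewrite E.
        replace ((w - w0) * u * v * (v + u) - (w - w0) * (RtoC 2 * (u * u * u)))%C
          with ((w - w0) * u * ((v - u) * (v + RtoC 2 * u)))%C by ring.
        rewrite E. ring. }
    rewrite !Cmod_mult. simpl. rewrite Rmult_1_r.
    apply Rmult_le_compat_r; [apply Rmult_le_pos; apply Cmod_ge_0|].
    repeat apply Rmult_le_compat; auto; try apply Cmod_ge_0; repeat apply Rmult_le_pos; try apply Cmod_ge_0.
    + apply HM, Ht.
    + eapply Rle_trans; [apply Cmod_triangle|]. rewrite Cmod_mult, Cmod_R, Rabs_pos_eq by lra. lra.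
Qed.

End CauchyType.

Lemma holo_circ_cont (R0 r t : R) (f : C -> C) :
  holo (ball0 R0) f -> 0 <= r < R0 -> @ccont R_UniformSpace (fun t => f (circ r t)) t.
Proof.
  intros Hf Hr. apply (ccont_comp f (circ r)); [apply ccont_circ|].
  destruct (Hf (circ r t)) as [l Hl]; [unfold ball0; rewrite Cmod_circ; lra|].
  apply (cder_ccont f _ l Hl).
Qed.

Lemma locally_ball0 (r : R) (z : C) :
  Cmod z < r -> locally (z : C_UniformSpace) (ball0 r).
Proof.
  intros Hz. apply locally_C_iff. exists (r - Cmod z). split; [lra|].
  intros w Hw. unfold ball0. replace w with ((w - z) + z)%C by ring.
  eapply Rle_lt_trans; [apply Cmod_triangle|]. lra.
Qed.

(** Differentiating Cauchy's formula once expresses [f'] near [w] by the squared kernel, and that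
    integral can be differentiated again. *)
Lemma holo_derivative (R0 : R) (f f' : C -> C) :
  (forall z, ball0 R0 z -> cder idC f z (f' z)) -> holo (ball0 R0) f'.
Proof.
  intros Hf w Hw. unfold ball0 in Hw.
  assert (HPI := PI_RGT_0). assert (Pw := Cmod_ge_0 w).
  set (r := (Cmod w + R0) / 2).
  assert (Hr : Cmod w < r < R0) by (unfold r; lra).
  assert (Hh : holo (ball0 R0) f) by (intros z Hz; eexists; apply Hf, Hz).
  set (phi := fun t => (f (circ r t) * dcirc r t / (RtoC (2 * PI) * Ci))%C).
  assert (Cphi : forall t, @ccont R_UniformSpace phi t).
  { intros t. apply ccont_div; [|apply ccont_const|apply two_pi_i_neq_0].
    apply ccont_mult; [apply (holo_circ_cont R0); auto; lra|apply ccont_dcirc]. }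
  destruct (continuous_bounded phi 0 (2 * PI)) as [M HM]; [lra|intros t _; apply Cphi|].
  eexists. eapply cder_ext_loc; [|apply (cder_cauchy_type_2 r phi M w Cphi HM (proj1 Hr))].
  generalize (locally_ball0 r w (proj1 Hr)). apply filter_imp. intros z Hz.
  apply (cder_unique f z); [|apply Hf; unfold ball0 in *; lra].
  eapply cder_ext_loc; [|apply (cder_cauchy_type_1 r phi M z Cphi HM Hz)].
  generalize (locally_ball0 r z Hz). apply filter_imp. intros y Hy. symmetry.
  apply (cauchy_formula R0 r f y Hh); [lra|exact Hy].
Qed.

(** A removable singularity: subtracting Cauchy's formula at 0 from that at [w] leaves [w] times a
    Cauchy-type integral, with the density divided by [circ r t]. This integral is the quotient near
    0; elsewhere [f z / z] is. *)
Lemma holo_divide (R0 : R) (f : C -> C) :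
  0 < R0 -> holo (ball0 R0) f -> f (RtoC 0) = RtoC 0 ->
  exists g, holo (ball0 R0) g /\ forall z, f z = (z * g z)%C.
Proof.
  intros HR Hf F0.
  assert (HPI := PI_RGT_0).
  set (r := R0 / 2). assert (Hr : 0 < r < R0) by (unfold r; lra).
  set (phi := fun t => (f (circ r t) * dcirc r t / (RtoC (2 * PI) * Ci))%C).
  assert (Cphi : forall t, @ccont R_UniformSpace phi t).
  { intros t. apply ccont_div; [|apply ccont_const|apply two_pi_i_neq_0].
    apply ccont_mult; [apply (holo_circ_cont R0); auto; lra|apply ccont_dcirc]. }
  assert (N : forall t, circ r t <> RtoC 0).
  { intros t. apply Cmod_pos_neq_0. rewrite Cmod_circ; lra. }
  set (psi := fun t => (phi t / circ r t)%C).
  assert (Cpsi : forall t, @ccont R_UniformSpace psi t).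
  { intros t. apply ccont_div; auto. apply ccont_circ. }
  destruct (continuous_bounded psi 0 (2 * PI)) as [M HM]; [lra|intros t _; apply Cpsi|].
  set (H := fun w => CInt (fun t => (psi t * / (circ r t - w))%C) 0 (2 * PI)).
  assert (HfH : forall w, Cmod w < r -> f w = (w * H w)%C).
  { intros w Hw.
    assert (Z : Cmod (RtoC 0) < r) by (rewrite Cmod_0; lra).
    assert (F1 := cauchy_formula R0 r f w Hf (proj2 Hr) Hw).
    assert (F2 := cauchy_formula R0 r f _ Hf (proj2 Hr) Z).
    replace (f w) with (f w - f (RtoC 0))%C by (rewrite F0; ring).
    rewrite F1, F2. unfold H.
    assert (Cinv : forall v t, Cmod v < r -> @ccont R_UniformSpace (fun t => (/ (circ r t - v))%C) t).
    { intros v t Hv. apply ccont_inv; [|apply circ_neq; lra].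
      apply ccont_minus; [apply ccont_circ|apply ccont_const]. }
    rewrite <- CInt_scal, <- CInt_minus; try lra.
    2, 3, 4: intros t _; apply ccont_mult; auto.
    apply CInt_ext; [lra|]. intros t _. fold (phi t). unfold psi.
    replace (circ r t - RtoC 0)%C with (circ r t) by ring.
    field. split; auto. apply circ_neq; lra. }
  exists (fun z => if Ceq_dec z (RtoC 0) then H z else (f z / z)%C). split.
  - intros w Hw. destruct (Ceq_dec w (RtoC 0)) as [->|Hw0].
    + assert (Z : Cmod (RtoC 0) < r) by (rewrite Cmod_0; lra).
      eexists. eapply cder_ext_loc; [|apply (cder_cauchy_type_1 r psi M _ Cpsi HM Z)].
      generalize (locally_ball0 r _ Z). apply filter_imp. intros y Hy.
      destruct (Ceq_dec y (RtoC 0)) as [E|E]; [reflexivity|].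
      rewrite (HfH y Hy). unfold H. field. exact E.
    + destruct (Hf w Hw) as [l Hl]. eexists.
      eapply cder_ext_loc.
      2: apply (cder_div idC f idC w); [apply ccont_idC|exact Hl|apply cder_incl|exact Hw0].
      apply locally_C_iff. exists (Cmod w). split; [now apply Cmod_gt_0|]. intros y Hy.
      destruct (Ceq_dec y (RtoC 0)) as [->|E]; [|reflexivity].
      exfalso. replace (RtoC 0 - w)%C with (- w)%C in Hy by ring. rewrite Cmod_opp in Hy. lra.
  - intros z. destruct (Ceq_dec z (RtoC 0)) as [->|E].
    + rewrite F0. ring.
    + field. exact E.
Qed.

(** * Maximum principle and Schwarz's lemma *)

Lemma holo_pow (U : C -> Prop) (f : C -> C) (n : nat) : holo U f -> holo U (fun z => (f z ^ n)%C).
Proof.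
  intros Hf z Hz. destruct n as [|n].
  - exists (RtoC 0). apply (cder_ext idC (fun _ => RtoC 1)); [reflexivity|]. apply cder_const.
  - destruct (Hf z Hz) as [l Hl]. eexists. apply cder_pow; [apply ccont_idC|exact Hl].
Qed.

(** If [M < x], then [(M / x) ^ n] tends to 0 and cannot stay above [1 / K]. This is what removes a
    constant factor from an estimate valid for all powers. *)
Lemma pow_bound_le (x M K : R) :
  0 <= M -> (forall n, x ^ n <= K * M ^ n) -> x <= M.
Proof.
  intros HM H. destruct (Rle_lt_dec x M) as [|Hx]; [auto|exfalso].
  assert (Hq : Rabs (M / x) < 1).
  { rewrite Rabs_pos_eq by (apply Rle_div_r; lra). apply Rlt_div_l; lra. }
  assert (HK : 0 < Rabs K + 1) by (generalize (Rabs_pos K); lra).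
  destruct (pow_lt_1_zero (M / x) Hq (/ (Rabs K + 1)) ltac:(apply Rinv_0_lt_compat; auto)) as [N HN].
  specialize (HN N (le_n N)). specialize (H N).
  assert (Px : 0 < x ^ N) by (apply pow_lt; lra).
  assert (E : M ^ N = (M / x) ^ N * x ^ N).
  { rewrite <- Rpow_mult_distr. f_equal. field. lra. }
  assert (Q : 0 <= (M / x) ^ N) by (apply pow_le, Rle_div_r; lra).
  rewrite Rabs_pos_eq in HN by auto.
  assert (A : (Rabs K + 1) * (M / x) ^ N < 1).
  { apply Rlt_le_trans with ((Rabs K + 1) * / (Rabs K + 1)).
    - apply Rmult_lt_compat_l; auto.
    - right. field. lra. }
  assert (B : K * (M / x) ^ N < 1).
  { eapply Rle_lt_trans; [|exact A]. apply Rmult_le_compat_r; auto. generalize (Rle_abs K). lra. }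
  rewrite E in H. nra.
Qed.

(* Landau's trick: Cauchy's estimate is applied to all powers of [f]. *)
Lemma maximum_principle (R0 r M : R) (f : C -> C) (w : C) :
  holo (ball0 R0) f -> r < R0 -> (forall z, Cmod z = r -> Cmod (f z) <= M) -> Cmod w < r ->
  Cmod (f w) <= M.
Proof.
  intros Hf HR HM Hw.
  assert (HPI := PI_RGT_0). assert (Pw := Cmod_ge_0 w).
  assert (M0 : 0 <= M).
  { eapply Rle_trans; [apply (Cmod_ge_0 (f (circ r 0)))|]. apply HM, Cmod_circ. lra. }
  apply (pow_bound_le _ M (2 * (r / (r - Cmod w)))); auto.
  intros n. assert (Hn := holo_pow _ _ n Hf).
  assert (F := cauchy_formula_kernel R0 r _ w Hn HR Hw).
  assert (E : Cmod (f w ^ n * (RtoC (2 * PI) * Ci))%C <= 2 * (M ^ n * (r / (r - Cmod w))) * (2 * PI - 0)).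
  { rewrite <- F. apply CInt_bound; [lra| |].
    - intros t _. apply ccont_mult; [apply (holo_circ_cont R0 r t _ Hn); lra|apply ccont_cauchy_kernel; lra].
    - intros t _. rewrite Cmod_mult. apply Rmult_le_compat; try apply Cmod_ge_0.
      + rewrite Cmod_pow. apply pow_incr. split; [apply Cmod_ge_0|]. apply HM, Cmod_circ. lra.
      + apply Cmod_cauchy_kernel; lra. }
  rewrite !Cmod_mult, Cmod_Ci, Cmod_R, Rabs_pos_eq, Cmod_pow in E by lra.
  apply Rmult_le_reg_r with (2 * PI); [lra|]. lra.
Qed.

(** The maximum principle bounds [f z / z] by [1 / r] for all [r] below [R0]. The radius is left
    free since Jack's lemma uses the ball reaching up to the first boundary point. *)
Lemma schwarz (R0 : R) (f : C -> C) (z : C) :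
  holo (ball0 R0) f -> f (RtoC 0) = RtoC 0 -> (forall z, Cmod z < R0 -> Cmod (f z) <= 1) ->
  Cmod z < R0 -> R0 * Cmod (f z) <= Cmod z.
Proof.
  intros Hf F0 HB Hz. assert (Pz := Cmod_ge_0 z).
  destruct (holo_divide R0 f ltac:(lra) Hf F0) as [g [Hg Eg]].
  assert (A : forall r, Cmod z < r < R0 -> r * Cmod (f z) <= Cmod z).
  { intros r Hr.
    assert (G : Cmod (g z) <= / r).
    { apply (maximum_principle R0 r (/ r) g z); auto; try lra. intros y Hy.
      assert (X := HB y ltac:(lra)). rewrite Eg, Cmod_mult, Hy in X.
      apply Rmult_le_reg_l with r; [lra|]. rewrite Rinv_r by lra. exact X. }
    rewrite Eg, Cmod_mult.
    apply Rle_trans with (r * (Cmod z * / r)).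
    - apply Rmult_le_compat_l; [lra|]. apply Rmult_le_compat_l; lra.
    - right. field. lra. }
  apply Rnot_lt_le. intros Hc.
  assert (P := Cmod_ge_0 (f z)).
  assert (Pf : 0 < Cmod (f z)) by (destruct (Rle_lt_dec (Cmod (f z)) 0); [nra|auto]).
  (* If [R0 * Cmod (f z)] exceeded [Cmod z], both numbers would be below [R0], and a radius strictly
     between [m] and [R0] would contradict the bound just proved. *)
  set (m := Rmax (Cmod z) (Cmod z / Cmod (f z))).
  assert (Hm : m < R0).
  { unfold m. apply Rmax_lub_lt; auto. apply Rlt_div_l; auto. }
  assert (M1 : Cmod z <= m) by apply Rmax_l.
  assert (M2 : Cmod z / Cmod (f z) <= m) by apply Rmax_r.
  apply Rle_div_l in M2; auto.
  specialize (A ((m + R0) / 2) ltac:(lra)). nra.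
Qed.

(** * Local inversion *)

(** Strict differentiability, with both points varying, as Newton's iteration requires: [f u - f v]
    is the integral of [f'] along the segment, and [f'] is continuous because it is holomorphic. *)
Lemma strong_derivative (R0 : R) (f f' : C -> C) (z0 : C) (e : R) :
  (forall z, ball0 R0 z -> cder idC f z (f' z)) -> ball0 R0 z0 -> 0 < e ->
  exists d, 0 < d /\ (forall z, Cmod (z - z0)%C < d -> ball0 R0 z) /\
    forall u v, Cmod (u - z0)%C < d -> Cmod (v - z0)%C < d ->
      Cmod (f u - f v - f' z0 * (u - v))%C <= e * Cmod (u - v)%C.
Proof.
  intros Hf Hz0 He. assert (He2 : 0 < e / 2) by lra.
  assert (Hf' := holo_derivative R0 f f' Hf).
  assert (Cf' : forall z, ball0 R0 z -> @ccont C_UniformSpace f' z).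
  { intros z Hz. destruct (Hf' z Hz) as [l Hl]. apply (cder_ccont f' z l Hl). }
  destruct (proj1 (locally_C_iff _ _) (filter_and _ _ (locally_ball0 R0 z0 Hz0) (Cf' z0 Hz0 _ He2)))
    as [d [Hd H]].
  exists d. split; [auto|split; [intros z Hz; apply H, Hz|]].
  intros u v Hu Hv.
  set (g := fun t => (v + ofR t * (u - v))%C).
  assert (Hg : forall t, 0 <= t <= 1 -> Cmod (g t - z0)%C < d).
  { intros t Ht. unfold g, ofR.
    replace (v + RtoC t * (u - v) - z0)%C with (RtoC (1 - t) * (v - z0) + RtoC t * (u - z0))%C
      by (rewrite RtoC_minus; ring).
    eapply Rle_lt_trans; [apply Cmod_triangle|].
    rewrite !Cmod_mult, !Cmod_R, !Rabs_pos_eq by lra.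
    destruct (Rle_lt_dec t (1 / 2)); nra. }
  assert (Dg : forall t, cder ofR g t (u - v)%C).
  { intros t. apply (cder_eq _ _ _ (RtoC 0 + (RtoC 1 * (u - v) + ofR t * RtoC 0))%C); [ring|].
    apply (cder_plus ofR (fun _ => v)); [apply cder_const|].
    apply (cder_mult ofR ofR (fun _ => _)); [apply ccont_ofR|apply cder_incl|apply cder_const]. }
  assert (Cg : cont_on (fun t => f' (g t)) 0 1).
  { intros t Ht. apply (ccont_comp f' g); [|apply Cf', H, Hg, Ht].
    apply (cder_cont ofR g t (u - v)%C); [apply ccont_ofR|apply Dg]. }
  assert (Cc : forall c, cont_on (fun _ => c) 0 1) by (intros c t _; apply ccont_const).
  assert (E : (f u - f v)%C = CInt (fun t => (f' (g t) * (u - v))%C) 0 1).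
  { rewrite (CInt_derive (fun t => f (g t)) (fun t => (f' (g t) * (u - v))%C)).
    - unfold g, ofR. f_equal; [f_equal; ring|f_equal; f_equal; ring].
    - lra.
    - intros t Ht. apply (cder_comp ofR f g); [apply ccont_ofR|apply Hf, H, Hg, Ht|apply Dg].
    - apply cont_on_mult; auto. }
  assert (E0 : (f' z0 * (u - v))%C = CInt (fun _ => (f' z0 * (u - v))%C) 0 1).
  { rewrite CInt_const by lra. rewrite Rminus_0_r. ring. }
  rewrite E, E0, <- CInt_minus; [|lra|apply cont_on_mult; auto|auto].
  replace (e * Cmod (u - v)%C) with (2 * (e / 2 * Cmod (u - v)%C) * (1 - 0)) by field.
  apply CInt_bound; [lra| |].
  - intros t Ht. apply ccont_minus; [apply cont_on_mult with (a := 0) (b := 1); auto|apply ccont_const].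
  - intros t Ht. replace (f' (g t) * (u - v) - f' z0 * (u - v))%C with ((f' (g t) - f' z0) * (u - v))%C by ring.
    rewrite Cmod_mult. apply Rmult_le_compat_r; [apply Cmod_ge_0|]. left. apply H, Hg, Ht.
Qed.

(** Newton's iteration with the fixed slope [a = f' z0]: strict differentiability with error
    [Cmod a / 2] makes [T] contract by 1/2 near [z0]. The solvable values and the distance of the
    solution are explicit, for later use at first order. *)
Lemma local_inverse (R0 : R) (f f' : C -> C) (z0 : C) :
  (forall z, ball0 R0 z -> cder idC f z (f' z)) -> ball0 R0 z0 -> f' z0 <> RtoC 0 ->
  exists d, 0 < d /\ (forall z, Cmod (z - z0)%C < d -> ball0 R0 z) /\
    (forall u v, Cmod (u - z0)%C < d -> Cmod (v - z0)%C < d -> f u = f v -> u = v) /\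
    forall w, 4 * Cmod (w - f z0)%C < Cmod (f' z0) * d ->
      exists u, Cmod (f' z0) * Cmod (u - z0)%C <= 2 * Cmod (w - f z0)%C /\ f u = w.
Proof.
  intros Hf Hz0 Ha. set (a := f' z0) in *.
  assert (Pa : 0 < Cmod a) by now apply Cmod_gt_0.
  assert (Pa2 : 0 < Cmod a / 2) by lra.
  destruct (strong_derivative R0 f f' z0 _ Hf Hz0 Pa2) as [d [Hd [Hin H]]]. fold a in H.
  exists d. split; [auto|split; [auto|split]].
  { intros u v Hu Hv E. specialize (H u v Hu Hv). rewrite E in H.
    replace (f v - f v - a * (u - v))%C with (- (a * (u - v)))%C in H by ring.
    rewrite Cmod_opp, Cmod_mult in H. assert (P := Cmod_ge_0 (u - v)%C).
    apply Ceq_minus, Cmod_eq_0. nra. }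
  intros w Hw.
  (* [k] is the length of the first step; the geometric series keeps all iterates within [2 k] of
     [z0]. *)
  set (k := Cmod (w - f z0)%C / Cmod a).
  assert (Pk : 0 <= k) by (apply Rle_div_r; auto; rewrite Rmult_0_l; apply Cmod_ge_0).
  assert (Ek : Cmod a * k = Cmod (w - f z0)%C) by (unfold k; field; lra).
  assert (Kd : 4 * k < d) by (apply Rmult_lt_reg_l with (Cmod a); lra).
  set (T := fun u => (u - (f u - w) / a)%C).
  set (x := nat_rect (fun _ => C) z0 (fun _ u => T u)).
  assert (Hx : forall n, Cmod (x n - z0)%C <= 2 * k * (1 - / 2 ^ n) /\ Cmod (x (S n) - x n)%C <= k * / 2 ^ n).
  { intros n. induction n as [|n [IH1 IH2]].
    - simpl. split.
      + replace (z0 - z0)%C with (RtoC 0) by ring. rewrite Cmod_0. lra.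
      + unfold T. replace (z0 - (f z0 - w) / a - z0)%C with ((w - f z0) / a)%C by (field; auto).
        rewrite Cmod_div by auto. fold k. lra.
    - assert (P := pow2_inv_pos n). rewrite pow2_inv_S.
      assert (B1 : Cmod (x (S n) - z0)%C <= 2 * k * (1 - / 2 ^ n / 2)).
      { eapply Rle_trans; [apply (Cmod_dist_triangle _ (x n))|]. nra. }
      split; auto.
      assert (D1 : Cmod (x (S n) - z0)%C < d) by nra.
      assert (D0 : Cmod (x n - z0)%C < d) by nra.
      specialize (H _ _ D1 D0).
      replace (x (S (S n)) - x (S n))%C with (- ((f (x (S n)) - f (x n) - a * (x (S n) - x n)) / a))%C.
      2:{ change (x (S (S n))) with (T (x (S n))). unfold T at 1.
          replace (a * (x (S n) - x n))%C with (- (f (x n) - w))%C.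
          - field. auto.
          - change (x (S n)) with (T (x n)). unfold T. field. auto. }
      rewrite Cmod_opp, Cmod_div by auto. apply Rle_div_l; auto. nra. }
  assert (Lim : exists u, forall n, Cmod (x n - u)%C <= 4 * k * / 2 ^ n).
  { assert (A : forall p : C -> R, (forall y z, p (y - z)%C = p y - p z) -> (forall z, Rabs (p z) <= Cmod z) ->
       exists c, forall n, Rabs (p (x n) - c) <= 2 * k * / 2 ^ n).
    { intros p Hp1 Hp2.
      (* Intervals of length [4 k / 2 ^ n] centred at [p (x n)] are nested, since a step has length
         at most [k / 2 ^ n]. *)
      destruct (nested_limit (fun n => p (x n) - 2 * k * / 2 ^ n) (4 * k)) as [c Hc]; [|lra|].
      - intros n. destruct (Hx n) as [_ B]. assert (X := Hp2 (x (S n) - x n)%C). rewrite Hp1 in X.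
        apply Rabs_le_between in X. rewrite pow2_inv_S. lra.
      - exists c. intros n. specialize (Hc n). apply Rabs_le. lra. }
    destruct (A fst) as [c1 Hc1]; [reflexivity|apply fst_le_Cmod|].
    destruct (A snd) as [c2 Hc2]; [reflexivity|apply snd_le_Cmod|].
    exists (c1, c2). intros n. specialize (Hc1 n). specialize (Hc2 n).
    eapply Rle_trans; [apply Cmod_le_sum|].
    change (Rabs (fst (x n) - c1) + Rabs (snd (x n) - c2) <= 4 * k * / 2 ^ n). lra. }
  destruct Lim as [u Hu]. exists u.
  assert (Bu : Cmod (u - z0)%C <= 2 * k).
  { apply le_epsilon. intros eta Heta. destruct (pow2_inv_small (4 * k) eta Heta) as [n Hn].
    eapply Rle_trans; [apply (Cmod_dist_triangle _ (x n))|]. rewrite Cmod_minus_sym.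
    destruct (Hx n) as [B _]. specialize (Hu n). assert (P := pow2_inv_pos n). nra. }
  split.
  { rewrite <- Ek. apply Rle_trans with (Cmod a * (2 * k)); [apply Rmult_le_compat_l; lra|lra]. }
  apply Ceq_minus, Cmod_eq_0. apply Rle_antisym; [|apply Cmod_ge_0].
  apply le_epsilon. intros eta Heta. rewrite Rplus_0_l.
  (* 7 = 1 + 2 + 4: the step from [x n], the strict differentiability error and the linear term, the
     last two at distance [4 k / 2 ^ n] from the limit. *)
  destruct (pow2_inv_small (7 * (Cmod a * k)) eta Heta) as [n Hn].
  eapply Rle_trans; [|exact Hn].
  destruct (Hx n) as [B1 B2]. specialize (Hu n). assert (P := pow2_inv_pos n).
  assert (D1 : Cmod (x n - z0)%C < d) by nra. assert (D0 : Cmod (u - z0)%C < d) by nra.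
  specialize (H _ _ D1 D0).
  assert (E : Cmod (f (x n) - w)%C = Cmod a * Cmod (x (S n) - x n)%C).
  { rewrite <- Cmod_mult. change (x (S n)) with (T (x n)). unfold T.
    replace (a * (x n - (f (x n) - w) / a - x n))%C with (- (f (x n) - w))%C by (field; auto).
    now rewrite Cmod_opp. }
  replace (f u - w)%C with ((f (x n) - w) + (- (f (x n) - f u - a * (x n - u)) + - (a * (x n - u))))%C by ring.
  eapply Rle_trans; [apply Cmod_triangle|].
  eapply Rle_trans; [apply Rplus_le_compat_l, Cmod_triangle|].
  rewrite !Cmod_opp, E, Cmod_mult.
  apply Rle_trans with (Cmod a * (k * / 2 ^ n) + (Cmod a / 2 * (4 * k * / 2 ^ n) + Cmod a * (4 * k * / 2 ^ n))).
  - assert (Cmod a * Cmod (x (S n) - x n)%C <= Cmod a * (k * / 2 ^ n)) by (apply Rmult_le_compat_l; lra).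
    assert (Cmod a * Cmod (x n - u)%C <= Cmod a * (4 * k * / 2 ^ n)) by (apply Rmult_le_compat_l; lra).
    assert (Cmod a / 2 * Cmod (x n - u)%C <= Cmod a / 2 * (4 * k * / 2 ^ n)) by (apply Rmult_le_compat_l; lra).
    lra.
  - right. field. apply pow_nonzero. lra.
Qed.

(* Moving [f z0] towards the origin moves [z0] by [- e f/f' + o(e)]. *)
Lemma radial_preimage (R0 : R) (f f' : C -> C) (z0 : C) (k d0 : R) :
  (forall z, ball0 R0 z -> cder idC f z (f' z)) -> ball0 R0 z0 -> f' z0 <> RtoC 0 ->
  0 < k -> 0 < d0 ->
  exists e0, 0 < e0 /\ forall e, 0 < e < e0 -> exists u,
    Cmod (u - z0)%C < d0 /\ f u = (RtoC (1 - e) * f z0)%C /\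
    Cmod (u - (z0 - RtoC e * (f z0 / f' z0)))%C <= k * e.
Proof.
  intros Hf Hz0 Ha Hk Hd0.
  assert (Pa : 0 < Cmod (f' z0)) by now apply Cmod_gt_0.
  destruct (local_inverse R0 f f' z0 Hf Hz0 Ha) as [d [Hd [_ [_ Hinv]]]].
  set (a := Cmod (f' z0)) in *. set (m := Cmod (f z0)). assert (Pm : 0 <= m) by apply Cmod_ge_0.
  (* The preimage is within [2 e m / a] of [z0], so the error after division by [f' z0] is at most
     [e1 * 2 e m / a^2], below [k e]; the 1 covers [f z0 = 0]. *)
  set (e1 := k * a ^ 2 / (2 * m + 1)).
  assert (He1 : 0 < e1) by (apply Rdiv_lt_0_compat; [apply Rmult_lt_0_compat; [lra|apply pow_lt; lra]|lra]).
  destruct (strong_derivative R0 f f' z0 e1 Hf Hz0 He1) as [d1 [Hd1 [_ H1]]].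
  set (q := Rmin d (Rmin d0 d1)).
  assert (Hq : 0 < q) by (repeat apply Rmin_pos; auto).
  assert (Q1 : q <= d) by apply Rmin_l.
  assert (Q2 : q <= d0) by (eapply Rle_trans; [apply Rmin_r|apply Rmin_l]).
  assert (Q3 : q <= d1) by (eapply Rle_trans; [apply Rmin_r|apply Rmin_r]).
  exists (a * q / (4 * m + 1)). split; [apply Rdiv_lt_0_compat; [nra|lra]|].
  intros e [He0 He].
  apply Rlt_div_r in He; [|lra].
  assert (Em : Cmod (RtoC (1 - e) * f z0 - f z0)%C = e * m).
  { rewrite RtoC_minus. replace ((RtoC 1 - RtoC e) * f z0 - f z0)%C with (- (RtoC e * f z0))%C by ring.
    rewrite Cmod_opp, Cmod_mult, Cmod_R, Rabs_pos_eq by lra. reflexivity. }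
  destruct (Hinv (RtoC (1 - e) * f z0)%C) as [u [Hu1 Hu2]].
  { rewrite Em. nra. }
  rewrite Em in Hu1.
  assert (Bu : Cmod (u - z0)%C < q).
  { apply Rmult_lt_reg_l with a; auto. nra. }
  exists u. split; [lra|split; [auto|]].
  assert (Z0 : Cmod (z0 - z0)%C < d1) by (replace (z0 - z0)%C with (RtoC 0) by ring; rewrite Cmod_0; auto).
  specialize (H1 u z0 ltac:(lra) Z0). rewrite Hu2 in H1.
  replace (u - (z0 - RtoC e * (f z0 / f' z0)))%C
    with (- ((RtoC (1 - e) * f z0 - f z0 - f' z0 * (u - z0)) / f' z0))%C
    by (rewrite RtoC_minus; field; auto).
  rewrite Cmod_opp, Cmod_div by auto. fold a. apply Rle_div_l; auto.
  eapply Rle_trans; [exact H1|].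
  apply Rmult_le_reg_l with a; auto.
  apply Rle_trans with (e1 * (2 * (e * m))).
  - replace (a * (e1 * Cmod (u - z0)%C)) with (e1 * (a * Cmod (u - z0)%C)) by ring.
    apply Rmult_le_compat_l; lra.
  - apply Rle_trans with (e1 * (2 * m + 1) * e); [nra|].
    right. unfold e1. field. lra.
Qed.

Lemma Rlt_pow2_pos (x y : R) : 0 <= x -> x < y -> x ^ 2 < y ^ 2.
Proof. intros. nra. Qed.

(** The real inner product. [Cdot z (f z / f' z)] is [|z|^2 Re (f / (z f'))], so its sign tests
    starlikeness without dividing by [z]. *)
Definition Cdot (z w : C) : R := fst z * fst w + snd z * snd w.

Lemma Cmod_sub_sqr (z b : C) (e : R) :
  Cmod (z - RtoC e * b)%C ^ 2 = Cmod z ^ 2 - 2 * e * Cdot z b + e ^ 2 * Cmod b ^ 2.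
Proof. rewrite !Cmod2_alt. destruct z, b. unfold Cdot, Re, Im. simpl. ring. Qed.

Lemma Cdot_neq_0 (z b : C) : Cdot z b <> 0 -> 0 < Cmod z.
Proof.
  intros H. apply Cmod_gt_0. intros ->. apply H. unfold Cdot. simpl. ring.
Qed.

Lemma radial_preimage_inside (R0 : R) (f f' : C -> C) (z0 : C) (d0 : R) :
  (forall z, ball0 R0 z -> cder idC f z (f' z)) -> ball0 R0 z0 -> f' z0 <> RtoC 0 ->
  0 < Cdot z0 (f z0 / f' z0)%C -> 0 < d0 ->
  exists e0, 0 < e0 /\ forall e, 0 < e < e0 -> exists u,
    Cmod (u - z0)%C < d0 /\ f u = (RtoC (1 - e) * f z0)%C /\ Cmod u < Cmod z0.
Proof.
  intros Hf Hz0 Ha. set (b := (f z0 / f' z0)%C). set (p := Cdot z0 b). intros Hp Hd0.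
  assert (Pz : 0 < Cmod z0) by (apply (Cdot_neq_0 z0 b); fold p; lra).
  (* [p / Cmod z0] is the rate at which [Cmod (z0 - e b)] decreases at [e = 0]. Half of it absorbs
     the quadratic term; half of the rest, the error of [radial_preimage]. *)
  set (c := p / (2 * Cmod z0)).
  assert (Hc : 0 < c) by (apply Rdiv_lt_0_compat; lra).
  assert (Ec : 2 * c * Cmod z0 = p) by (unfold c; field; lra).
  destruct (radial_preimage R0 f f' z0 (c / 2) d0 Hf Hz0 Ha ltac:(lra) Hd0) as [e0 [He0 H]].
  set (B := Cmod b ^ 2). assert (HB : 0 <= B) by (unfold B; apply pow2_ge_0).
  (* The second bound keeps [Cmod z0 - c e] positive for squaring; the third makes the quadratic
     term [e^2 B] smaller than [e p]. *)
  exists (Rmin e0 (Rmin (Cmod z0 / c) (p / (B + 1)))). split.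
  { repeat apply Rmin_pos; auto; apply Rdiv_lt_0_compat; lra. }
  intros e [E0 E1]. apply Rmin_Rgt_l in E1. destruct E1 as [E1 E2]. apply Rmin_Rgt_l in E2.
  destruct E2 as [E2 E3]. apply Rlt_div_r in E2; auto. apply Rlt_div_r in E3; [|lra].
  destruct (H e ltac:(lra)) as [u [H1 [H2 H3]]]. exists u. split; [auto|split; [auto|]].
  fold b in H3.
  assert (S := Cmod_sub_sqr z0 b e). fold p B in S.
  set (v := (z0 - RtoC e * b)%C) in *.
  assert (V : Cmod v <= Cmod z0 - c * e).
  { apply Rnot_lt_le. intros N.
    assert (W : (Cmod z0 - c * e) ^ 2 < Cmod v ^ 2) by (apply Rlt_pow2_pos; lra).
    rewrite S in W. nra. }
  replace u with ((u - v) + v)%C by ring.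
  eapply Rle_lt_trans; [apply Cmod_triangle|]. nra.
Qed.

Lemma radial_preimage_outside (R0 : R) (f f' : C -> C) (z0 : C) (d0 : R) :
  (forall z, ball0 R0 z -> cder idC f z (f' z)) -> ball0 R0 z0 -> f' z0 <> RtoC 0 ->
  Cdot z0 (f z0 / f' z0)%C < 0 -> 0 < d0 ->
  exists e0, 0 < e0 /\ forall e, 0 < e < e0 -> exists u,
    Cmod (u - z0)%C < d0 /\ f u = (RtoC (1 - e) * f z0)%C /\ Cmod z0 < Cmod u.
Proof.
  intros Hf Hz0 Ha. set (b := (f z0 / f' z0)%C). set (p := Cdot z0 b). intros Hp Hd0.
  assert (Pz : 0 < Cmod z0) by (apply (Cdot_neq_0 z0 b); fold p; lra).
  set (c := - p / (2 * Cmod z0)).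
  assert (Hc : 0 < c) by (apply Rdiv_lt_0_compat; lra).
  assert (Ec : 2 * c * Cmod z0 = - p) by (unfold c; field; lra).
  destruct (radial_preimage R0 f f' z0 (c / 2) d0 Hf Hz0 Ha ltac:(lra) Hd0) as [e0 [He0 H]].
  set (B := Cmod b ^ 2). assert (HB : 0 <= B) by (unfold B; apply pow2_ge_0).
  exists (Rmin e0 (- p / c ^ 2)). split.
  { repeat apply Rmin_pos; auto; apply Rdiv_lt_0_compat; nra. }
  intros e [E0 E1]. apply Rmin_Rgt_l in E1. destruct E1 as [E1 E2].
  apply Rlt_div_r in E2; [|nra].
  destruct (H e ltac:(lra)) as [u [H1 [H2 H3]]]. exists u. split; [auto|split; [auto|]].
  fold b in H3.
  assert (S := Cmod_sub_sqr z0 b e). fold p B in S.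
  set (v := (z0 - RtoC e * b)%C) in *.
  assert (V : Cmod z0 + c * e <= Cmod v).
  { apply Rnot_lt_le. intros N.
    assert (W : Cmod v ^ 2 < (Cmod z0 + c * e) ^ 2) by (apply Rlt_pow2_pos; [apply Cmod_ge_0|lra]).
    rewrite S in W. nra. }
  assert (X := Cmod_triangle_rev v u). rewrite Cmod_minus_sym in X. nra.
Qed.

(** * A sufficient condition for starlikeness *)

(** [Q y d] is to be read as: the margin [d] works at [y]. Margins that are locally uniform are
    uniform on the closed ball. *)
Lemma compact_ball (rho : R) (Q : C -> R -> Prop) :
  (forall y d d', Q y d -> d' <= d -> Q y d') ->
  (forall z, Cmod z <= rho -> exists d, 0 < d /\ forall y, Cmod y <= rho -> Cmod (y - z)%C < d -> Q y d) ->
  exists d, 0 < d /\ forall y, Cmod y <= rho -> Q y d.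
Proof.
  intros Hmon H.
  (* The available compactness is that of a square. At its points outside the ball the gauge is
     chosen so small that the neighbourhood misses the ball. The factor 2 passes from coordinatewise
     distance to [Cmod]. *)
  assert (Hd : forall z : C, {d : posreal | (Cmod z <= rho ->
     forall y, Cmod y <= rho -> Cmod (y - z)%C < 2 * d -> Q y d) /\
     (rho < Cmod z -> forall y, Cmod (y - z)%C < 2 * d -> rho < Cmod y)}).
  { intros z. apply constructive_indefinite_description.
    destruct (Rle_lt_dec (Cmod z) rho) as [Hz|Hz].
    - destruct (H z Hz) as [d [Hd Hq]]. assert (Hd2 : 0 < d / 2) by lra.
      exists (mkposreal _ Hd2). simpl. split; [|intros; lra].
      intros _ y Hy1 Hy2. apply (Hmon y d); [apply Hq; auto; lra|lra].
    - assert (Hd2 : 0 < (Cmod z - rho) / 2) by lra.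
      exists (mkposreal _ Hd2). simpl. split; [intros; lra|].
      intros _ y Hy. assert (X := Cmod_triangle_rev z y). rewrite Cmod_minus_sym in X. lra. }
  destruct (compactness_value_2d (- rho) rho (- rho) rho (fun a b => proj1_sig (Hd (a, b)))) as [d Hval].
  exists d. split; [apply cond_pos|]. intros [y1 y2] Hy.
  assert (X1 := fst_le_Cmod (y1, y2)). assert (X2 := snd_le_Cmod (y1, y2)). simpl in X1, X2.
  apply NNPP. intros Hn. apply (Hval y1 y2).
  - apply Rabs_le_between; lra.
  - apply Rabs_le_between; lra.
  - intros [u [v [_ [_ [H1 [H2 H3]]]]]]. apply Hn.
    destruct (proj2_sig (Hd (u, v))) as [A B].
    set (e := proj1_sig (Hd (u, v))) in *.
    assert (Hdist : Cmod ((y1, y2) - (u, v))%C < 2 * e).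
    { eapply Rle_lt_trans; [apply Cmod_le_sum|]. simpl.
      change (Rabs (y1 - u) + Rabs (y2 - v) < 2 * e). lra. }
    destruct (Rle_lt_dec (Cmod (u, v)) rho) as [Hz|Hz].
    + apply (Hmon _ e); [apply A; auto|auto].
    + exfalso. specialize (B Hz _ Hdist). lra.
Qed.

Lemma compact_ball_pair (rho : R) (Q : C -> C -> R -> Prop) :
  (forall x y d d', Q x y d -> d' <= d -> Q x y d') ->
  (forall a b, Cmod a <= rho -> Cmod b <= rho -> exists d, 0 < d /\ forall x y,
     Cmod x <= rho -> Cmod y <= rho -> Cmod (x - a)%C < d -> Cmod (y - b)%C < d -> Q x y d) ->
  exists d, 0 < d /\ forall x y, Cmod x <= rho -> Cmod y <= rho -> Q x y d.
Proof.
  intros Hmon H.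
  destruct (compact_ball rho (fun x d => forall y, Cmod y <= rho -> Q x y d)) as [d [Hd HQ]].
  - intros x d d' A B y Hy. apply (Hmon x y d); auto.
  - intros a Ha.
    destruct (compact_ball rho (fun y d => forall x, Cmod x <= rho -> Cmod (x - a)%C < d -> Q x y d)) as [d [Hd HQ]].
    + intros y d d' A B x Hx Hxa. apply (Hmon x y d); auto. apply A; auto. lra.
    + intros b Hb. destruct (H a b Ha Hb) as [d [Hd HQ]]. exists d. split; auto.
    + exists d. split; auto.
  - exists d. split; auto.
Qed.

Lemma glb_exists (E : R -> Prop) (l : R) :
  (forall x, E x -> l <= x) -> (exists x, E x) ->
  exists m, (forall x, E x -> m <= x) /\ forall e, 0 < e -> exists x, E x /\ x < m + e.
Proof.
  intros Hl [x0 Hx0].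
  destruct (completeness (fun y => E (- y))) as [M [HM1 HM2]].
  - exists (- l). intros y Hy. specialize (Hl _ Hy). lra.
  - exists (- x0). now rewrite Ropp_involutive.
  - exists (- M). split.
    + intros x Hx. assert (X : - x <= M) by (apply HM1; now rewrite Ropp_involutive). lra.
    + intros e He. apply NNPP. intros Hn.
      assert (X : M <= M - e); [|lra].
      apply HM2. intros y Hy. apply Rnot_lt_le. intros Hlt. apply Hn. exists (- y). split; auto. lra.
Qed.

Section Starlike.

Variables (f f' : C -> C).
Hypothesis Hf : forall z, disk z -> cder idC f z (f' z).
Hypothesis Hf0 : f (RtoC 0) = RtoC 0.
Hypothesis Hnz : forall z, disk z -> f' z <> RtoC 0.
Hypothesis Hpos : forall z, disk z -> z <> RtoC 0 -> 0 < Cdot z (f z / f' z)%C.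

Lemma disk_cont (z : C) : disk z -> @ccont C_UniformSpace f z.
Proof. intros Hz. apply (cder_ccont f z (f' z)), Hf, Hz. Qed.

Lemma starlike_zero (z : C) : disk z -> f z = RtoC 0 -> z = RtoC 0.
Proof.
  intros Hz E. apply NNPP. intros N. specialize (Hpos z Hz N). rewrite E in Hpos.
  replace (RtoC 0 / f' z)%C with (RtoC 0) in Hpos by (field; auto).
  unfold Cdot in Hpos. simpl in Hpos. lra.
Qed.

Lemma image_open : @open C_UniformSpace (image f disk).
Proof.
  intros w [z [Hz E]]. subst w. apply locally_C_iff.
  destruct (local_inverse 1 f f' z Hf Hz (Hnz z Hz)) as [d [Hd [Hin [_ H]]]].
  assert (Pa : 0 < Cmod (f' z)) by (apply Cmod_gt_0; auto).
  exists (Cmod (f' z) * d / 4). split; [assert (0 < Cmod (f' z) * d) by (apply Rmult_lt_0_compat; auto); lra|].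
  intros w Hw. destruct (H w ltac:(lra)) as [u [Hu1 Hu2]]. exists u. split; auto.
  apply (Hin u). apply Rmult_lt_reg_l with (Cmod (f' z)); auto.
  assert (0 < Cmod (f' z) * d) by (apply Rmult_lt_0_compat; auto). lra.
Qed.

(** Among the factors [s >= t] for which [s w] has a preimage in the closed ball through [z0], the
    least one is attained by compactness. If it exceeded [t], moving its preimage inwards would stay
    in the ball and lower it. *)
Lemma image_starlike : starlike_wrt_origin (image f disk).
Proof.
  assert (D0 : disk (RtoC 0)) by (unfold disk; rewrite Cmod_0; lra).
  split; [now exists (RtoC 0)|].
  intros w t [z0 [Hz0 Ew]] Ht.
  destruct (Ceq_dec z0 (RtoC 0)) as [->|Nz].
  { exists (RtoC 0). split; auto. rewrite <- Ew, Hf0. ring. }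
  destruct (Req_dec t 0) as [->|Nt].
  { exists (RtoC 0). split; auto. rewrite Hf0. ring. }
  assert (Nw : w <> RtoC 0) by (intros E; apply Nz, starlike_zero; auto; now rewrite Ew).
  assert (Pw := proj1 (Cmod_gt_0 w) Nw).
  set (rho := Cmod z0).
  destruct (glb_exists (fun s => t <= s /\ exists u, Cmod u <= rho /\ f u = (RtoC s * w)%C) t)
    as [m [Hm1 Hm2]].
  { intros x [Hx _]. exact Hx. }
  { exists 1. split; [lra|]. exists z0. split; [apply Rle_refl|]. rewrite Ew. ring. }
  assert (Htm : t <= m).
  { apply Rnot_lt_le. intros Hlt. destruct (Hm2 (t - m) ltac:(lra)) as [x [[Hx _] Hx2]]. lra. }
  assert (Att : exists u, Cmod u <= rho /\ f u = (RtoC m * w)%C).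
  { apply NNPP. intros Hn.
    destruct (compact_ball rho (fun y d => d <= Cmod (f y - RtoC m * w)%C)) as [d [Hd HQ]].
    - intros; lra.
    - intros z Hz.
      assert (Nf : (f z - RtoC m * w)%C <> RtoC 0).
      { intros E. apply Hn. exists z. split; auto. now apply Ceq_minus. }
      assert (Cfz : @ccont C_UniformSpace (fun y => (f y - RtoC m * w)%C) z).
      { apply ccont_minus; [apply disk_cont; unfold disk, rho in *; unfold disk in Hz0; lra|apply ccont_const]. }
      assert (X := ccont_neq_0 _ _ Cfz Nf). apply locally_C_iff in X. destruct X as [d [Hd X]].
      apply Cmod_gt_0 in Nf.
      exists (Rmin d (Cmod (f z - RtoC m * w)%C / 2)). split; [apply Rmin_pos; auto; lra|].
      intros y _ Hy. eapply Rle_trans; [apply Rmin_r|]. left. apply X.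
      eapply Rlt_le_trans; [exact Hy|apply Rmin_l].
    - destruct (Hm2 (d / Cmod w)) as [x [[Hx1 [u [Hu1 Hu2]]] Hx2]].
      { apply Rdiv_lt_0_compat; auto. }
      specialize (HQ u Hu1). rewrite Hu2 in HQ.
      replace (RtoC x * w - RtoC m * w)%C with (RtoC (x - m) * w)%C in HQ by (rewrite RtoC_minus; ring).
      assert (Hmx : m <= x) by (apply Hm1; split; auto; exists u; auto).
      rewrite Cmod_mult, Cmod_R, Rabs_pos_eq in HQ by lra.
      assert (Y : (x - m) * Cmod w < d / Cmod w * Cmod w) by (apply Rmult_lt_compat_r; lra).
      replace (d / Cmod w * Cmod w) with d in Y by (field; lra). lra. }
  destruct Att as [u [Hu1 Hu2]].
  assert (Du : disk u) by (unfold disk, rho in *; unfold disk in Hz0; lra).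
  destruct (Rle_lt_dec m t) as [Hmt|Hmt].
  { exists u. split; auto. rewrite Hu2. f_equal. f_equal. lra. }
  exfalso.
  assert (Nu : u <> RtoC 0).
  { intros E. rewrite E, Hf0 in Hu2. symmetry in Hu2. revert Hu2. apply Cmult_neq_0; auto.
    intros E'. apply RtoC_inj in E'. lra. }
  destruct (radial_preimage_inside 1 f f' u 1 Hf Du (Hnz u Du) (Hpos u Du Nu) Rlt_0_1) as [e0 [He0 H]].
  (* The second bound keeps the new factor [(1 - e) m] at least [t]. *)
  set (e := Rmin (e0 / 2) ((m - t) / m)).
  assert (He : 0 < e) by (apply Rmin_pos; [lra|apply Rdiv_lt_0_compat; lra]).
  assert (He1 : e <= e0 / 2) by apply Rmin_l.
  assert (He2 : e <= (m - t) / m) by apply Rmin_r.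
  apply Rle_div_r in He2; [|lra].
  destruct (H e ltac:(lra)) as [v [_ [Hv2 Hv3]]].
  assert (X : m <= (1 - e) * m); [|nra].
  apply Hm1. split; [nra|]. exists v. split; [lra|]. rewrite Hv2, Hu2, RtoC_mult. ring.
Qed.

(** Connectedness is reduced to a segment from 0: when [P] contains 0 and [Q] contains [v], the last
    parameter approached from [P] yields a common point. *)
Lemma image_domain : Defs.domain (image f disk).
Proof.
  destruct image_starlike as [U0 US].
  split; [exists (RtoC 0); exact U0|split; [exact image_open|]].
  assert (Key : forall P Q : C -> Prop, @open C_UniformSpace P -> @open C_UniformSpace Q ->
    (forall w, image f disk w -> P w \/ Q w) -> P (RtoC 0) ->
    (exists w, image f disk w /\ Q w) -> exists w, image f disk w /\ P w /\ Q w).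
  { intros P Q OP OQ Hcov HP0 [v [Uv Qv]].
    destruct (completeness (fun t => 0 <= t <= 1 /\ P (RtoC t * v)%C)) as [m [Hm1 Hm2]].
    { exists 1. intros x [Hx _]. lra. }
    { exists 0. split; [lra|]. now replace (RtoC 0 * v)%C with (RtoC 0) by ring. }
    assert (M0 : 0 <= m).
    { apply Hm1. split; [lra|]. now replace (RtoC 0 * v)%C with (RtoC 0) by ring. }
    assert (M1 : m <= 1) by (apply Hm2; intros x [Hx _]; lra).
    assert (Um := US v m Uv (conj M0 M1)).
    assert (Near : forall O, @open C_UniformSpace O -> O (RtoC m * v)%C ->
       exists d, 0 < d /\ forall s, Rabs (s - m) < d -> O (RtoC s * v)%C).
    { intros O OO HO. specialize (OO _ HO). apply locally_C_iff in OO. destruct OO as [d [Hd HOd]].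
      assert (Pv := Cmod_ge_0 v).
      exists (d / (Cmod v + 1)). split; [apply Rdiv_lt_0_compat; lra|].
      intros s Hs. apply HOd. apply Rlt_div_r in Hs; [|lra].
      replace (RtoC s * v - RtoC m * v)%C with (RtoC (s - m) * v)%C by (rewrite RtoC_minus; ring).
      rewrite Cmod_mult, Cmod_R. assert (Pa := Rabs_pos (s - m)). lra. }
    destruct (Hcov _ Um) as [Pm|Qm].
    - destruct (Req_dec m 1) as [E|N].
      + exists v. split; auto. split; auto. replace v with (RtoC m * v)%C; auto. rewrite E. ring.
      + exfalso. destruct (Near P OP Pm) as [d [Hd HN]].
        set (s := m + Rmin (d / 2) (1 - m)).
        assert (S1 : 0 < Rmin (d / 2) (1 - m)) by (apply Rmin_pos; lra).
        assert (S2 : Rmin (d / 2) (1 - m) <= d / 2) by apply Rmin_l.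
        assert (S3 : Rmin (d / 2) (1 - m) <= 1 - m) by apply Rmin_r.
        assert (X : s <= m); [|unfold s in X; lra].
        apply Hm1. split; [unfold s; lra|]. apply HN. unfold s.
        replace (m + Rmin (d / 2) (1 - m) - m) with (Rmin (d / 2) (1 - m)) by ring.
        rewrite Rabs_pos_eq; lra.
    - destruct (Near Q OQ Qm) as [d [Hd HN]].
      assert (Hs : exists s, (0 <= s <= 1 /\ P (RtoC s * v)%C) /\ m - d < s).
      { apply NNPP. intros Hn. assert (X : m <= m - d); [|lra].
        apply Hm2. intros x Hx. apply Rnot_lt_le. intros Hlt. apply Hn. exists x. auto. }
      destruct Hs as [s [[Hs1 Hs2] Hs3]].
      exists (RtoC s * v)%C. split; [apply US; auto|split; auto].
      apply HN. assert (s <= m) by (apply Hm1; auto). rewrite Rabs_left1; lra. }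
  intros P Q OP OQ Hcov HP HQ.
  destruct (Hcov _ U0) as [HP0|HQ0].
  - apply Key; auto.
  - destruct (Key Q P OQ OP) as [w [Hw1 [Hw2 Hw3]]]; auto.
    + intros w Hw. destruct (Hcov w Hw); auto.
    + exists w. auto.
Qed.

(* Among the pairs of distinct points with a common value, one with minimal
   [|f|] could be moved towards the origin. *)
Lemma starlike_injective (z1 z2 : C) : disk z1 -> disk z2 -> f z1 = f z2 -> z1 = z2.
Proof.
  intros Hz1 Hz2 E12. apply NNPP. intros N12.
  set (rho := Rmax (Cmod z1) (Cmod z2)).
  assert (Hrho : rho < 1) by (apply Rmax_lub_lt; auto).
  assert (Hdisk : forall z, Cmod z <= rho -> disk z) by (intros z Hz; unfold disk; lra).
  destruct (glb_exists (fun m => exists x y, Cmod x <= rho /\ Cmod y <= rho /\ x <> y /\ f x = f y /\ m = Cmod (f x)) 0)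
    as [m [Hm1 Hm2]].
  { intros m [x [y [_ [_ [_ [_ ->]]]]]]. apply Cmod_ge_0. }
  { exists (Cmod (f z1)), z1, z2. repeat split; auto; [apply Rmax_l|apply Rmax_r]. }
  (* It is shown that values of pairs near any [(a, b)] stay above [m] by a margin, against the
     choice of [m]. Near a diagonal point local injectivity excludes pairs; where [f a <> f b]
     continuity does; if [Cmod (f a) > m] the margin is immediate; equality is refuted by moving
     both points. *)
  destruct (compact_ball_pair rho (fun x y d => x <> y -> f x = f y -> m + d <= Cmod (f x))) as [d [Hd HQ]].
  - intros x y d d' A B X Y. specialize (A X Y). lra.
  - intros a b Ha Hb. assert (Da := Hdisk a Ha). assert (Db := Hdisk b Hb).
    destruct (Ceq_dec a b) as [<-|Nab].
    { destruct (local_inverse 1 f f' a Hf Da (Hnz a Da)) as [d [Hd [_ [Hinj _]]]].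
      exists d. split; auto. intros x y _ _ Hx Hy Nxy Exy. exfalso. apply Nxy, Hinj; auto. }
    destruct (Ceq_dec (f a) (f b)) as [Eab|Nfab].
    2:{ assert (P : 0 < Cmod (f a - f b)%C) by now apply Cmod_gt_0, Cminus_eq_contra.
        set (e := Cmod (f a - f b)%C / 2). assert (He : 0 < e) by (unfold e; lra).
        destruct (proj1 (ccont_C_iff f a) (disk_cont a Da) e He) as [d1 [Hd1 C1]].
        destruct (proj1 (ccont_C_iff f b) (disk_cont b Db) e He) as [d2 [Hd2 C2]].
        exists (Rmin d1 d2). split; [apply Rmin_pos; auto|].
        intros x y _ _ Hx Hy _ Exy. exfalso.
        assert (X1 : Cmod (f x - f a)%C < e) by (apply C1; eapply Rlt_le_trans; [exact Hx|apply Rmin_l]).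
        assert (X2 : Cmod (f y - f b)%C < e) by (apply C2; eapply Rlt_le_trans; [exact Hy|apply Rmin_r]).
        assert (T := Cmod_dist_triangle (f a) (f x) (f b)).
        rewrite (Cmod_minus_sym (f a) (f x)) in T. rewrite Exy in T at 2. unfold e in *. lra. }
    assert (Hma : m <= Cmod (f a)) by (apply Hm1; exists a, b; repeat split; auto).
    destruct (Rle_lt_dec (Cmod (f a)) m) as [Hle|Hlt].
    + exfalso.
      assert (Na : a <> RtoC 0).
      { intros E. apply Nab. rewrite E. symmetry. apply starlike_zero; auto. now rewrite <- Eab, E. }
      assert (Nb : b <> RtoC 0).
      { intros E. apply Nab. rewrite E. apply starlike_zero; auto. now rewrite Eab, E. }
      assert (Nfa : f a <> RtoC 0) by (intros E; apply Na, starlike_zero; auto).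
      assert (Pfa := proj1 (Cmod_gt_0 _) Nfa).
      (* Each point moves by less than half of [Cmod (a - b)], so the two stay distinct. *)
      assert (Pab : 0 < Cmod (a - b)%C / 2).
      { assert (0 < Cmod (a - b)%C) by now apply Cmod_gt_0, Cminus_eq_contra. lra. }
      destruct (radial_preimage_inside 1 f f' a _ Hf Da (Hnz a Da) (Hpos a Da Na) Pab) as [e1 [He1 H1]].
      destruct (radial_preimage_inside 1 f f' b _ Hf Db (Hnz b Db) (Hpos b Db Nb) Pab) as [e2 [He2 H2]].
      set (e := Rmin (Rmin (e1 / 2) (e2 / 2)) 1).
      assert (P0 : 0 < e) by (repeat apply Rmin_pos; lra).
      assert (P1 : e <= e1 / 2) by (eapply Rle_trans; [apply Rmin_l|apply Rmin_l]).
      assert (P2 : e <= e2 / 2) by (eapply Rle_trans; [apply Rmin_l|apply Rmin_r]).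
      assert (P3 : e <= 1) by apply Rmin_r.
      destruct (H1 e ltac:(lra)) as [a' [A1 [A2 A3]]].
      destruct (H2 e ltac:(lra)) as [b' [B1 [B2 B3]]].
      assert (X : m <= Cmod (f a')).
      { apply Hm1. exists a', b'. repeat split; try lra.
        - intros E. subst b'. assert (T := Cmod_dist_triangle a a' b).
          rewrite (Cmod_minus_sym a a') in T. lra.
        - now rewrite A2, B2, Eab. }
      rewrite A2, Cmod_mult, Cmod_R, Rabs_pos_eq in X by lra. nra.
    + set (e := (Cmod (f a) - m) / 2). assert (He : 0 < e) by (unfold e; lra).
      destruct (proj1 (ccont_C_iff f a) (disk_cont a Da) e He) as [d1 [Hd1 C1]].
      exists (Rmin d1 e). split; [apply Rmin_pos; auto|].
      intros x y _ _ Hx _ _ _.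
      assert (X1 : Cmod (f x - f a)%C < e) by (apply C1; eapply Rlt_le_trans; [exact Hx|apply Rmin_l]).
      assert (X2 : Rmin d1 e <= e) by apply Rmin_r.
      assert (T := Cmod_triangle_rev (f a) (f x)). rewrite Cmod_minus_sym in T. unfold e in *. lra.
  - destruct (Hm2 d Hd) as [mm [[x [y [Hx [Hy [Nxy [Exy ->]]]]]] Hlt]].
    specialize (HQ x y Hx Hy Nxy Exy). lra.
Qed.

End Starlike.

(** * The lower bound *)

Lemma holo_div (U : C -> Prop) (f g : C -> C) :
  holo U f -> holo U g -> (forall z, U z -> g z <> RtoC 0) -> holo U (fun z => (f z / g z)%C).
Proof.
  intros Hf Hg Hn z Hz. destruct (Hf z Hz) as [a Ha]. destruct (Hg z Hz) as [b Hb].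
  eexists. apply cder_div; [apply ccont_idC|exact Ha|exact Hb|auto].
Qed.

Lemma derive_nonneg_of_left_max (G : R -> R) (x l d : R) :
  is_derive G x l -> 0 < d -> (forall y, x - d < y < x -> G y <= G x) -> 0 <= l.
Proof.
  intros HG Hd H. apply Rnot_lt_le. intros Hl.
  apply is_derive_Reals in HG.
  destruct (HG (- l / 2) ltac:(lra)) as [e He].
  set (h := - Rmin (e / 2) (d / 2)).
  assert (Pe := cond_pos e).
  assert (P1 : 0 < Rmin (e / 2) (d / 2)) by (apply Rmin_pos; lra).
  assert (P2 : Rmin (e / 2) (d / 2) <= e / 2) by apply Rmin_l.
  assert (P3 : Rmin (e / 2) (d / 2) <= d / 2) by apply Rmin_r.
  assert (Hh : h < 0) by (unfold h; lra).
  specialize (He h ltac:(lra)). specialize (H (x + h) ltac:(unfold h; lra)).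
  assert (X : Rabs h < e) by (rewrite Rabs_left by lra; unfold h; lra).
  specialize (He X). apply Rabs_lt_between in He.
  assert (Y : (G (x + h) - G x) / h < l / 2) by lra.
  assert (Z : (G (x + h) - G x) / h * h = G (x + h) - G x) by (field; lra).
  nra.
Qed.

(** A point of least modulus with [Re q <= 0] exists by compactness. Were [Re q] negative there, it
    would remain so slightly closer to the origin. *)
Lemma first_boundary_point (q : C -> C) (z1 : C) :
  holo disk q -> 0 < Re (q (RtoC 0)) -> disk z1 -> Re (q z1) <= 0 ->
  exists z0, disk z0 /\ Re (q z0) = 0 /\ forall z, Cmod z < Cmod z0 -> 0 < Re (q z).
Proof.
  intros Hq H0 Hz1 H1.
  assert (Cq : forall z, disk z -> @ccont C_UniformSpace q z).
  { intros z Hz. destruct (Hq z Hz) as [l Hl]. apply (cder_ccont q z l Hl). }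
  assert (Near : forall z e, disk z -> 0 < e -> exists d, 0 < d /\
     forall y, Cmod (y - z)%C < d -> Rabs (Re (q y) - Re (q z)) < e).
  { intros z e Hz He. destruct (proj1 (ccont_C_iff q z) (Cq z Hz) e He) as [d [Hd H]].
    exists d. split; auto. intros y Hy. eapply Rle_lt_trans; [|apply H, Hy].
    apply (fst_le_Cmod (q y - q z)%C). }
  set (rho := Cmod z1).
  destruct (glb_exists (fun m => exists z, Cmod z <= rho /\ Re (q z) <= 0 /\ m = Cmod z) 0) as [m [Hm1 Hm2]].
  { intros m [z [_ [_ ->]]]. apply Cmod_ge_0. }
  { exists (Cmod z1), z1. repeat split; auto. apply Rle_refl. }
  assert (Hin : forall z, Cmod z < m -> Cmod z <= rho -> 0 < Re (q z)).
  { intros z Hz Hz'. apply Rnot_le_lt. intros N. assert (X : m <= Cmod z); [|lra].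
    apply Hm1. exists z. auto. }
  assert (Hrho : m <= rho) by (apply Hm1; exists z1; repeat split; auto; apply Rle_refl).
  assert (Att : exists z, Cmod z <= m /\ Re (q z) <= 0).
  { apply NNPP. intros Hn.
    destruct (compact_ball rho (fun y d => Re (q y) <= 0 -> m + d <= Cmod y)) as [d [Hd HQ]].
    - intros y d d' A B Y. specialize (A Y). lra.
    - intros z Hz. assert (Dz : disk z) by (unfold disk, rho in *; unfold disk in Hz1; lra).
      destruct (Rle_lt_dec (Re (q z)) 0) as [Hle|Hlt].
      + assert (Hmz : m < Cmod z).
        { apply Rnot_le_lt. intros N. apply Hn. exists z. auto. }
        exists ((Cmod z - m) / 2). split; [lra|]. intros y _ Hy _.
        assert (T := Cmod_triangle_rev z y). rewrite Cmod_minus_sym in T. lra.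
      + destruct (Near z (Re (q z)) Dz Hlt) as [d [Hd HN]]. exists d. split; auto.
        intros y _ Hy Hqy. exfalso. specialize (HN y Hy). apply Rabs_lt_between in HN. lra.
    - destruct (Hm2 d Hd) as [x [[z [Hz1' [Hz2 ->]]] Hlt]]. specialize (HQ z Hz1' Hz2). lra. }
  destruct Att as [z0 [Hz0 Hqz0]].
  assert (D0 : disk z0) by (unfold disk, rho in *; unfold disk in Hz1; lra).
  assert (Em : Cmod z0 = m).
  { apply Rle_antisym; auto. apply Hm1. exists z0. repeat split; auto. lra. }
  exists z0. split; auto. split.
  2:{ intros z Hz. apply Hin; lra. }
  apply Rle_antisym; auto. apply Rnot_lt_le. intros Hneg.
  destruct (Near z0 (- Re (q z0)) D0 ltac:(lra)) as [d [Hd HN]].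
  assert (Pm : 0 < Cmod z0).
  { apply Cmod_gt_0. intros E. rewrite E in Hqz0. lra. }
  set (e := Rmin (1 / 2) (d / 2)).
  assert (P1 : 0 < e) by (apply Rmin_pos; lra).
  assert (P2 : e <= 1 / 2) by apply Rmin_l.
  assert (P3 : e <= d / 2) by apply Rmin_r.
  assert (Ey : Cmod (RtoC (1 - e) * z0)%C = (1 - e) * Cmod z0) by (rewrite Cmod_mult, Cmod_R, Rabs_pos_eq; lra).
  assert (Hy : Cmod (RtoC (1 - e) * z0 - z0)%C < d).
  { rewrite RtoC_minus. replace ((RtoC 1 - RtoC e) * z0 - z0)%C with (- (RtoC e * z0))%C by ring.
    rewrite Cmod_opp, Cmod_mult, Cmod_R, Rabs_pos_eq by lra. unfold disk in D0. nra. }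
  specialize (HN _ Hy). apply Rabs_lt_between in HN.
  assert (X : 0 < Re (q (RtoC (1 - e) * z0)%C)) by (apply Hin; rewrite Ey; nra). lra.
Qed.

(** Hence the Cayley transform has modulus below 1 exactly where [Re q > 0]. *)
Lemma Cmod_cayley (q : C) : Cmod (RtoC 1 + q)%C ^ 2 - Cmod (RtoC 1 - q)%C ^ 2 = 4 * Re q.
Proof. rewrite !Cmod2_alt. destruct q. unfold Re, Im. simpl. ring. Qed.

(* Jack's lemma, for the Cayley transform [(1 - q) / (1 + q)]. *)
Lemma boundary_derivative (q : C -> C) (z0 l : C) :
  holo disk q -> q (RtoC 0) = RtoC 1 -> disk z0 -> Re (q z0) = 0 ->
  (forall z, Cmod z < Cmod z0 -> 0 < Re (q z)) -> cder idC q z0 l ->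
  Re (z0 * l)%C <= - (1 + Im (q z0) ^ 2) / 2.
Proof.
  intros Hq Hq0 Hz0 Hre Hin Hl. unfold disk in Hz0.
  set (m := Cmod z0).
  assert (Hm : 0 < m).
  { apply Cmod_gt_0. intros E. rewrite E, Hq0 in Hre. simpl in Hre. lra. }
  assert (Hlt : forall z, Cmod z < m -> Cmod (RtoC 1 - q z)%C < Cmod (RtoC 1 + q z)%C).
  { intros z Hz. specialize (Hin z Hz). assert (X := Cmod_cayley (q z)).
    assert (Y := Cmod_ge_0 (RtoC 1 + q z)%C). nra. }
  assert (Hnz : forall z, Cmod z < m -> (RtoC 1 + q z)%C <> RtoC 0).
  { intros z Hz. apply Cmod_pos_neq_0. specialize (Hlt z Hz). generalize (Cmod_ge_0 (RtoC 1 - q z)%C). lra. }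
  assert (Hom : holo (ball0 m) (fun z => ((RtoC 1 - q z) / (RtoC 1 + q z))%C)).
  { assert (Hqm : holo (ball0 m) q) by (intros z Hz; apply Hq; unfold ball0, disk, m in *; lra).
    apply (holo_div _ (fun z => (RtoC 1 - q z)%C) (fun z => (RtoC 1 + q z)%C)); auto.
    - intros z Hz. destruct (Hqm z Hz) as [a Ha]. eexists.
      apply (cder_minus idC (fun _ => RtoC 1) q); [apply cder_const|exact Ha].
    - intros z Hz. destruct (Hqm z Hz) as [a Ha]. eexists.
      apply (cder_plus idC (fun _ => RtoC 1) q); [apply cder_const|exact Ha]. }
  assert (Schw : forall z, Cmod z < m -> m * Cmod (RtoC 1 - q z)%C <= Cmod z * Cmod (RtoC 1 + q z)%C).
  { intros z Hz. assert (P : 0 < Cmod (RtoC 1 + q z)%C) by (apply Cmod_gt_0, Hnz, Hz).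
    assert (S := schwarz m _ z Hom). cbv beta in S.
    rewrite Cmod_div in S by (apply Hnz, Hz).
    apply Rmult_le_reg_r with (/ Cmod (RtoC 1 + q z)%C); [apply Rinv_0_lt_compat; auto|].
    replace (Cmod z * Cmod (RtoC 1 + q z)%C * / Cmod (RtoC 1 + q z)%C) with (Cmod z) by (field; lra).
    eapply Rle_trans; [|apply S; auto].
    - unfold Rdiv. lra.
    - rewrite Hq0. replace (RtoC 1 - RtoC 1)%C with (RtoC 0) by ring. unfold Cdiv. ring.
    - intros y Hy. rewrite Cmod_div by (apply Hnz, Hy).
      assert (P' : 0 < Cmod (RtoC 1 + q y)%C) by (apply Cmod_gt_0, Hnz, Hy).
      apply Rle_div_l; auto. specialize (Hlt y Hy). lra. }
  set (Q := fun s => q (ofR s * z0)%C).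
  assert (E1 : (ofR 1 * z0)%C = z0) by (unfold ofR; ring).
  assert (DQ : cder ofR Q 1 (z0 * l)%C).
  { apply (cder_eq _ _ _ (l * (RtoC 1 * z0 + ofR 1 * RtoC 0))%C); [ring|].
    apply (cder_comp ofR q (fun s => (ofR s * z0)%C)); [apply ccont_ofR|rewrite E1; exact Hl|].
    apply (cder_mult ofR ofR (fun _ => z0)); [apply ccont_ofR|apply cder_incl|apply cder_const]. }
  set (X := fun s => fst (Q s)). set (Y := fun s => snd (Q s)).
  assert (DX : is_derive X 1 (fst (z0 * l)%C)) by (apply cder_ofR_fst, DQ).
  assert (DY : is_derive Y 1 (snd (z0 * l)%C)) by (apply cder_ofR_snd, DQ).
  assert (X1 : X 1 = 0) by (unfold X, Q; rewrite E1; exact Hre).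
  assert (Y1 : Y 1 = Im (q z0)) by (unfold Y, Q; rewrite E1; reflexivity).
  (* [G s] is [|1 - Q s|^2 - s^2 |1 + Q s|^2], so Schwarz's lemma on the radius of [z0] says
     [G s <= 0 = G 1] for [s < 1], and the derivative of [G] at 1 is nonnegative. *)
  set (G := fun s => (1 + X s * X s + Y s * Y s) * (1 - s * s) - 2 * X s * (1 + s * s)).
  set (dx := fst (z0 * l)%C) in *. set (dy := snd (z0 * l)%C) in *.
  assert (DG : is_derive G 1 (-2 * (1 + Im (q z0) ^ 2) - 4 * dx)).
  { unfold G. auto_derive.
    - repeat split; first [exists dx; exact DX | exists dy; exact DY].
    - rewrite (is_derive_unique (fun x : R => X x) 1 dx DX), (is_derive_unique (fun x : R => Y x) 1 dy DY), X1, Y1. ring. }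
  assert (HG : 0 <= -2 * (1 + Im (q z0) ^ 2) - 4 * dx).
  { apply (derive_nonneg_of_left_max G 1 _ 1 DG Rlt_0_1).
    intros s Hs.
    assert (G1 : G 1 = 0) by (unfold G; rewrite X1; ring). rewrite G1.
    assert (Es : Cmod (ofR s * z0)%C = s * m).
    { unfold ofR. rewrite Cmod_mult, Cmod_R, Rabs_pos_eq; [reflexivity|lra]. }
    assert (S := Schw (ofR s * z0)%C ltac:(rewrite Es; nra)). rewrite Es in S. fold (Q s) in S.
    assert (S' : Cmod (RtoC 1 - Q s)%C <= s * Cmod (RtoC 1 + Q s)%C).
    { apply Rmult_le_reg_l with m; auto. lra. }
    assert (S2 : Cmod (RtoC 1 - Q s)%C ^ 2 <= (s * Cmod (RtoC 1 + Q s)%C) ^ 2).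
    { apply pow_incr. split; [apply Cmod_ge_0|exact S']. }
    rewrite Rpow_mult_distr, !Cmod2_alt in S2. unfold G, X, Y.
    destruct (Q s) as [a b]. unfold Re, Im in S2. simpl in S2 |- *. nra. }
  change (dx <= - (1 + Im (q z0) ^ 2) / 2). lra.
Qed.

Lemma Cdot_mult_r (z w : C) : Cdot z (z * w)%C = Cmod z ^ 2 * Re w.
Proof. rewrite Cmod2_alt. destruct z, w. unfold Cdot, Re, Im. simpl. ring. Qed.

Lemma strip_Cdot_pos (f : C -> C) :
  Defs.A1 f -> phi_maps_disk_into f (W (sqrt 3)) ->
  forall z, disk z -> z <> RtoC 0 -> 0 < Cdot z (f z / C_derive f z)%C.
Proof.
  intros [Hf [F0 F1]] Hphi.
  set (f1 := C_derive f) in *. set (f2 := C_derive f1).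
  assert (D1 : forall z, ball0 1 z -> cder idC f z (f1 z)).
  { intros z Hz. apply (holomorphic_cder disk); auto. }
  assert (Hf1 := holo_derivative 1 f f1 D1).
  assert (D2 : forall z, disk z -> cder idC f1 z (f2 z)).
  { intros z Hz. destruct (Hf1 z Hz) as [l Hl]. unfold f2. now rewrite (C_derive_cder _ _ _ Hl). }
  assert (Nz : forall z, disk z -> f1 z <> RtoC 0) by (intros z Hz; apply Hphi, Hz).
  assert (Hfh : holo (ball0 1) f) by (intros z Hz; eexists; apply D1, Hz).
  destruct (holo_divide 1 f Rlt_0_1 Hfh F0) as [g [Hg Eg]].
  set (q := fun z => (g z / f1 z)%C).
  assert (Hq : holo disk q) by (apply holo_div; auto).
  assert (D0 : disk (RtoC 0)) by (unfold disk; rewrite Cmod_0; lra).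
  assert (F1' : f1 (RtoC 0) = RtoC 1) by (apply Ceq_minus, F1).
  assert (Eq : forall z, (z * q z)%C = (f z / f1 z)%C).
  { intros z. unfold q. rewrite Eg. unfold Cdiv. ring. }
  (* The two derivatives of [z q = f / f'], by the product and the quotient rule, are compared. *)
  assert (Dzq : forall z l, disk z -> cder idC q z l -> (z * l)%C = (RtoC 1 - q z * phi f z)%C).
  { intros z l Hz Hl.
    assert (A : cder idC (fun z => (z * q z)%C) z (RtoC 1 * q z + z * l)%C).
    { apply (cder_mult idC idC q); [apply ccont_idC|apply cder_incl|exact Hl]. }
    assert (B : cder idC (fun z => (z * q z)%C) z ((f1 z * f1 z - f z * f2 z) / (f1 z * f1 z))%C).
    { apply (cder_ext idC (fun z => (f z / f1 z)%C)); [intros y; symmetry; apply Eq|].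
      apply cder_div; [apply ccont_idC|apply D1, Hz|apply D2, Hz|apply Nz, Hz]. }
    assert (E := cder_unique _ _ _ _ A B).
    replace (z * l)%C with ((RtoC 1 * q z + z * l) - q z)%C by ring.
    rewrite E. unfold phi. fold f1. fold f2. unfold q. rewrite Eg. field. apply Nz, Hz. }
  (* The value of [q] at 0 is read off from the differential equation, where [phi f 0 = 1]. *)
  assert (Q0 : q (RtoC 0) = RtoC 1).
  { destruct (Hq _ D0) as [l Hl].
    assert (E := Dzq _ _ D0 Hl). unfold phi in E. rewrite !Cmult_0_l in E.
    unfold Cdiv in E. rewrite Cmult_0_l, Cplus_0_r, Cmult_1_r in E.
    symmetry. apply Ceq_minus. now symmetry. }
  assert (Pos : forall z, disk z -> 0 < Re (q z)).
  { intros z1 Hz1. apply Rnot_le_lt. intros Hneg.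
    destruct (first_boundary_point q z1 Hq) as [z0 [Hz0 [Hre Hin]]]; auto.
    { rewrite Q0. simpl. lra. }
    destruct (Hq z0 Hz0) as [l Hl].
    assert (B := boundary_derivative q z0 l Hq Q0 Hz0 Hre Hin Hl).
    rewrite (Dzq z0 l Hz0 Hl) in B.
    assert (Him := proj2 (Hphi z0 Hz0)). unfold W in Him.
    destruct (phi f z0) as [a b]. destruct (q z0) as [x y].
    unfold Re, Im in *. simpl in Hre, B, Him. subst x.
    assert (S3 : sqrt 3 * sqrt 3 = 3) by (apply sqrt_sqrt; lra).
    assert (Hb : b * b < 3).
    { rewrite <- S3, <- (Rabs_pos_eq (sqrt 3)) by apply sqrt_pos.
      assert (X := Rabs_pos b). assert (Y := Rabs_pos_eq (sqrt 3) (sqrt_pos 3)).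
      replace (b * b) with (Rabs b * Rabs b) by (rewrite <- Rabs_mult; apply Rabs_pos_eq; nra).
      nra. }
    (* As [q z0 = i y], the real part of [1 - q phi] is [1 + y b]. Squaring [C1] with [b^2 < 3]
       forces [(3 - y^2)^2 <= 0]; then [y^2 = 3] gives [b^2 >= 3], a contradiction. *)
    assert (C1 : y * b <= - (3 + y * y) / 2) by nra.
    assert (C2 : (3 + y * y) / 2 * ((3 + y * y) / 2) <= (y * b) * (y * b)) by nra.
    assert (C3 : (y * b) * (y * b) <= y * y * 3) by nra.
    assert (C4 : (3 - y * y) * (3 - y * y) <= 0) by nra.
    assert (C5 : y * y = 3) by nra.
    nra. }
  intros z Hz Nz0. rewrite <- Eq, Cdot_mult_r.
  apply Rmult_lt_0_compat; [|apply Pos, Hz]. apply pow_lt. now apply Cmod_gt_0.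
Qed.

Lemma strip_sqrt3_starlike (f : C -> C) : Defs.A1 f -> phi_maps_disk_into f (W (sqrt 3)) -> Sstar f.
Proof.
  intros HA Hphi. assert (HP := strip_Cdot_pos f HA Hphi).
  assert (Hnz : forall z, disk z -> C_derive f z <> RtoC 0) by (intros z Hz; apply Hphi, Hz).
  destruct HA as [Hf [F0 F1]] eqn:EA.
  assert (D1 : forall z, disk z -> cder idC f z (C_derive f z)) by (intros z Hz; apply (holomorphic_cder disk); auto).
  split; [exact HA|split; [split; [exact Hf|]|split]].
  - intros z1 z2. apply (starlike_injective f (C_derive f)); auto.
  - apply (image_domain f (C_derive f)); auto.
  - apply (image_starlike f (C_derive f)); auto.
Qed.

(** * The upper bound *)

(* Schwarz's lemma applied to [f^-1 (t f)]. *)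
Lemma Sstar_preimage_le (f : C -> C) (t : R) (z u : C) :
  Sstar f -> (forall z, disk z -> C_derive f z <> RtoC 0) -> 0 <= t <= 1 ->
  disk z -> disk u -> f u = (RtoC t * f z)%C -> Cmod u <= Cmod z.
Proof.
  intros [[Hf [F0 _]] [[_ Hinj] [_ [_ Hstar]]]] Hnz Ht Hz Hu Eu.
  set (f1 := C_derive f) in *.
  assert (D1 : forall z, disk z -> cder idC f z (f1 z)) by (intros y Hy; apply (holomorphic_cder disk); auto).
  assert (Hex : forall y : C, {v : C | disk y -> disk v /\ f v = (RtoC t * f y)%C}).
  { intros y. apply constructive_indefinite_description.
    destruct (classic (disk y)) as [Hy|Hy].
    - destruct (Hstar (f y) t) as [v [Hv Ev]]; [exists y; auto|auto|]. exists v. auto.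
    - exists (RtoC 0). contradiction. }
  set (w := fun y => proj1_sig (Hex y)).
  assert (Hw : forall y, disk y -> disk (w y) /\ f (w y) = (RtoC t * f y)%C).
  { intros y. exact (proj2_sig (Hex y)). }
  assert (D0 : disk (RtoC 0)) by (unfold disk; rewrite Cmod_0; lra).
  assert (W0 : w (RtoC 0) = RtoC 0).
  { destruct (Hw _ D0) as [A B]. apply Hinj; auto. rewrite B, F0. ring. }
  (* Local inversion at [w y] solves [f v = t f x] near [w y], and univalence identifies [v] with
     [w x]. *)
  assert (Wc : forall y, disk y -> @ccont C_UniformSpace w y).
  { intros y Hy. destruct (Hw y Hy) as [A B].
    assert (N := Hnz _ A). assert (Pa := proj1 (Cmod_gt_0 _) N).
    destruct (local_inverse 1 f f1 (w y) D1 A N) as [d [Hd [Hin [_ Hinv]]]].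
    intros e He.
    set (k := Cmod (f1 (w y)) * Rmin d e / 4).
    assert (Hm : 0 < Rmin d e) by (apply Rmin_pos; auto).
    assert (Hk : 0 < k) by (unfold k; assert (0 < Cmod (f1 (w y)) * Rmin d e) by (apply Rmult_lt_0_compat; auto); lra).
    generalize (filter_and _ _ (locally_ball0 1 y Hy) (cder_ccont f y _ (D1 y Hy) k Hk)).
    apply filter_imp. intros x [Hx Hfx].
    assert (Est : Cmod (RtoC t * f x - f (w y))%C < k).
    { rewrite B. replace (RtoC t * f x - RtoC t * f y)%C with (RtoC t * (f x - f y))%C by ring.
      rewrite Cmod_mult, Cmod_R, Rabs_pos_eq by lra. assert (X := Cmod_ge_0 (f x - f y)%C). nra. }
    destruct (Hinv (RtoC t * f x)%C) as [v [Hv1 Hv2]].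
    { assert (Cmod (f1 (w y)) * Rmin d e <= Cmod (f1 (w y)) * d) by (apply Rmult_le_compat_l; [lra|apply Rmin_l]).
      unfold k in Est. lra. }
    assert (Hv3 : Cmod (v - w y)%C < Rmin d e).
    { apply Rmult_lt_reg_l with (Cmod (f1 (w y))); auto. unfold k in Est.
      assert (0 < Cmod (f1 (w y)) * Rmin d e) by (apply Rmult_lt_0_compat; auto). lra. }
    destruct (Hw x Hx) as [A' B'].
    assert (Ev : w x = v).
    { apply Hinj; auto.
      - apply Hin. eapply Rlt_le_trans; [exact Hv3|apply Rmin_l].
      - now rewrite B', Hv2. }
    rewrite Ev. eapply Rlt_le_trans; [exact Hv3|apply Rmin_r]. }
  (* With Caratheodory factors [h] of [f] at [w y] and [k] of [f] at [y], the equation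
     [f (w x) = t f x] reads [h (w x) (w x - w y) = t k x (x - y)]; dividing by [h (w x)] gives a
     factor for [w]. *)
  assert (Wh : holo (ball0 1) w).
  { intros y Hy. destruct (Hw y Hy) as [A B].
    assert (Cw := Wc y Hy).
    destruct (D1 (w y) A) as [h [H1 [H2 H3]]].
    destruct (D1 y Hy) as [k [K1 [K2 K3]]].
    assert (Chw : @ccont C_UniformSpace (fun x => h (w x)) y) by (apply (ccont_comp h w); auto).
    assert (N : h (w y) <> RtoC 0) by (rewrite H3; apply Hnz, A).
    exists (RtoC t * k y / h (w y))%C. exists (fun x => (RtoC t * k x / h (w x))%C).
    split; [|split; [|reflexivity]].
    - generalize (filter_and _ _ (filter_and _ _ (locally_ball0 1 y Hy) K1)
        (filter_and _ _ (ccont_locally_ball w y _ Cw H1) (ccont_neq_0 _ _ Chw N))).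
      apply filter_imp. intros x [[X1 X2] [X3 X4]]. unfold idC in *.
      assert (Nx : h (w x) <> RtoC 0).
      { apply Cmod_pos_neq_0. generalize (Cmod_ge_0 (h (w y))). lra. }
      destruct (Hw x X1) as [A' B'].
      assert (E : (h (w x) * (w x - w y))%C = (RtoC t * (k x * (x - y)))%C).
      { transitivity (f (w x) - f (w y))%C; [rewrite X3; ring|]. rewrite B', B, X2. ring. }
      transitivity (w y + (h (w x) * (w x - w y)) / h (w x))%C; [field; auto|]. rewrite E. field. auto.
    - apply ccont_div; auto. apply ccont_mult; auto. apply ccont_const. }
  destruct (Hw z Hz) as [A B].
  assert (E : u = w z) by (apply Hinj; auto; now rewrite Eu, B).
  rewrite E. rewrite <- (Rmult_1_l (Cmod (w z))). apply (schwarz 1 w); auto.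
  intros y Hy. left. apply Hw, Hy.
Qed.

(** If the sign were negative, moving [f z0] towards 0 would move the preimage outwards, against
    [Sstar_preimage_le]. *)
Lemma Sstar_Cdot_nonneg (f : C -> C) (z0 : C) :
  Sstar f -> (forall z, disk z -> C_derive f z <> RtoC 0) -> disk z0 ->
  0 <= Cdot z0 (f z0 / C_derive f z0)%C.
Proof.
  intros HS Hnz Hz0. apply Rnot_lt_le. intros Hneg.
  assert (D1 : forall z, disk z -> cder idC f z (C_derive f z)).
  { intros y Hy. apply (holomorphic_cder disk); auto. apply HS. }
  assert (Hd : 0 < 1 - Cmod z0) by (unfold disk in Hz0; lra).
  destruct (radial_preimage_outside 1 f (C_derive f) z0 _ D1 Hz0 (Hnz z0 Hz0) Hneg Hd) as [e0 [He0 H]].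
  set (e := Rmin (e0 / 2) 1).
  assert (P0 : 0 < e) by (apply Rmin_pos; lra).
  assert (P1 : e <= e0 / 2) by apply Rmin_l. assert (P2 : e <= 1) by apply Rmin_r.
  destruct (H e ltac:(lra)) as [u [H1 [H2 H3]]].
  assert (Du : disk u).
  { unfold disk. replace u with ((u - z0) + z0)%C by ring.
    eapply Rle_lt_trans; [apply Cmod_triangle|]. lra. }
  assert (X := Sstar_preimage_le f (1 - e) z0 u HS Hnz ltac:(lra) Hz0 Du H2). lra.
Qed.

(** * Principal square root on the right half-plane *)

Definition Csqrt (w : C) : C :=
  let p := sqrt ((Cmod w + fst w) / 2) in (p, snd w / (2 * p)).

Lemma Csqrt_spec (w : C) : 0 < fst w -> (Csqrt w * Csqrt w)%C = w /\ 0 < fst (Csqrt w).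
Proof.
  intros Hw. unfold Csqrt. set (r := Cmod w).
  assert (Hr : 0 <= r) by apply Cmod_ge_0.
  assert (Er : r * r = fst w * fst w + snd w * snd w) by apply Cmod_sqr.
  set (p := sqrt ((r + fst w) / 2)).
  assert (Hp : 0 < p) by (apply sqrt_lt_R0; lra).
  assert (Ep : p * p = (r + fst w) / 2) by (apply sqrt_sqrt; lra).
  split; [|exact Hp]. destruct w as [x y]. simpl in *. unfold Cmult; simpl.
  f_equal.
  - apply Rmult_eq_reg_r with (4 * (p * p)); [|nra].
    transitivity (4 * (p * p) * (p * p) - y * y); [field; lra|]. rewrite Ep. nra.
  - field. lra.
Qed.

Lemma Csqrt_diff (w v : C) : 0 < fst w -> 0 < fst v ->
  ((Csqrt w - Csqrt v) * (Csqrt w + Csqrt v))%C = (w - v)%C.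
Proof.
  intros Hw Hv. destruct (Csqrt_spec w Hw) as [A _], (Csqrt_spec v Hv) as [B _].
  transitivity (Csqrt w * Csqrt w - Csqrt v * Csqrt v)%C; [ring|now rewrite A, B].
Qed.

Lemma Csqrt_unique (w s : C) : 0 < fst w -> 0 < fst s -> (s * s)%C = w -> Csqrt w = s.
Proof.
  intros Hw Hs E. destruct (Csqrt_spec w Hw) as [A B].
  apply Ceq_minus.
  assert (N : (Csqrt w + s)%C <> RtoC 0).
  { intros E'. apply (f_equal fst) in E'. change (fst (Csqrt w) + fst s = 0) in E'. lra. }
  assert (X : ((Csqrt w - s) * (Csqrt w + s))%C = RtoC 0).
  { replace ((Csqrt w - s) * (Csqrt w + s))%C with (Csqrt w * Csqrt w - s * s)%C by ring.
    rewrite A, E. ring. }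
  apply NNPP. intros N'. exact (Cmult_neq_0 _ _ N' N X).
Qed.

Lemma locally_Re_pos (w : C) : 0 < fst w -> locally (w : C_UniformSpace) (fun v => 0 < fst v).
Proof.
  intros Hw. apply locally_C_iff. exists (fst w). split; auto. intros v Hv.
  assert (X := fst_le_Cmod (v - w)%C). simpl in X. apply Rabs_le_between in X. lra.
Qed.

(** The factor is [1 / (Csqrt v + Csqrt w)], since the difference of the roots times their sum is
    [v - w]. The sum stays away from 0 because its real part exceeds that of [Csqrt w]. *)
Lemma cder_Csqrt (w : C) : 0 < fst w -> cder idC Csqrt w (/ (RtoC 2 * Csqrt w))%C.
Proof.
  intros Hw. destruct (Csqrt_spec w Hw) as [_ P].
  assert (Nz : forall v, 0 < fst v -> (Csqrt v + Csqrt w)%C <> RtoC 0).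
  { intros v Hv E. destruct (Csqrt_spec v Hv) as [_ P']. apply (f_equal fst) in E.
    change (fst (Csqrt v) + fst (Csqrt w) = 0) in E. lra. }
  assert (Cs : @ccont C_UniformSpace Csqrt w).
  { intros e He. set (p := fst (Csqrt w)) in *.
    assert (Hd : 0 < e * p) by (apply Rmult_lt_0_compat; auto).
    generalize (filter_and _ _ (locally_Re_pos w Hw) (ccont_idC w _ Hd)). apply filter_imp.
    intros v [Hv Hvw]. unfold idC in Hvw. destruct (Csqrt_spec v Hv) as [_ P'].
    rewrite <- (Csqrt_diff v w Hv Hw), Cmod_mult in Hvw.
    assert (X := fst_le_Cmod (Csqrt v + Csqrt w)%C).
    assert (Y : p <= Cmod (Csqrt v + Csqrt w)%C).
    { eapply Rle_trans; [|exact X]. eapply Rle_trans; [|apply Rle_abs].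
      change (fst (Csqrt v + Csqrt w)%C) with (fst (Csqrt v) + fst (Csqrt w)). unfold p. lra. }
    assert (Z := Cmod_ge_0 (Csqrt v - Csqrt w)%C).
    apply Rmult_lt_reg_r with p; auto. eapply Rle_lt_trans; [|exact Hvw].
    apply Rmult_le_compat_l; auto. }
  exists (fun v => (/ (Csqrt v + Csqrt w))%C). split; [|split].
  - generalize (locally_Re_pos w Hw). apply filter_imp. intros v Hv. unfold idC.
    rewrite <- (Csqrt_diff v w Hv Hw). field. apply Nz, Hv.
  - apply ccont_inv; [|apply Nz, Hw]. apply ccont_plus; auto. apply ccont_const.
  - f_equal. ring.
Qed.

(** * A function with narrow [phi] that is not starlike *)

Definition ex_a : R := 8 / 15.
Definition ex_b : R := 9 / 25.
Definition ex_u (z : C) : C := (RtoC 1 + RtoC ex_a * z)%C.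
Definition ex_v (z : C) : C := (RtoC 1 - RtoC ex_b * z)%C.
(** The square root of [T]: the half-integral powers of [T] become integral powers of [ex_s]. *)
Definition ex_s (z : C) : C := Csqrt (ex_u z / ex_v z)%C.

(* With [T z = (1 + a z) / (1 - b z)] one has [(T^(7/2))' = (7/2) (a + b) T^(5/2) / (1 - b z)^2]
   and [z f''/f' = (5/2) a z / (1 + a z) + (9/2) b z / (1 - b z)]. The values [a = 8/15],
   [b = 9/25] were found by a numerical search. *)
Definition ex_f (z : C) : C := ((ex_s z ^ 7 - RtoC 1) / RtoC (7 / 2 * (ex_a + ex_b)))%C.
Definition ex_f1 (z : C) : C := (ex_s z ^ 5 / (ex_v z * ex_v z))%C.

Lemma ex_disk_bounds (z : C) : disk z -> -1 < fst z < 1 /\ fst z * fst z + snd z * snd z < 1.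
Proof.
  intros Hz. unfold disk in Hz. assert (P := Cmod_ge_0 z). rewrite <- Cmod_sqr.
  assert (X := fst_le_Cmod z). apply Rabs_le_between in X. split; [lra|nra].
Qed.

Lemma ex_u_neq_0 (z : C) : disk z -> ex_u z <> RtoC 0.
Proof.
  intros Hz E. destruct (ex_disk_bounds z Hz) as [B _]. apply (f_equal fst) in E.
  unfold ex_u, ex_a in E. simpl in E. lra.
Qed.

Lemma ex_v_neq_0 (z : C) : disk z -> ex_v z <> RtoC 0.
Proof.
  intros Hz E. destruct (ex_disk_bounds z Hz) as [B _]. apply (f_equal fst) in E.
  unfold ex_v, ex_b in E. simpl in E. lra.
Qed.

(** The numerator of the real part is [1 + (a - b) x - a b |z|^2]; its positivity keeps [T] in the
    domain of [Csqrt]. *)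
Lemma ex_T_pos (z : C) : disk z -> 0 < fst (ex_u z / ex_v z)%C.
Proof.
  intros Hz. destruct (ex_disk_bounds z Hz) as [B R]. destruct z as [x y].
  unfold ex_u, ex_v, ex_a, ex_b. simpl in *.
  match goal with |- 0 < ?e => replace e with
    ((1 + (8 / 15 - 9 / 25) * x - 8 / 15 * (9 / 25) * (x * x + y * y)) /
     ((1 - 9 / 25 * x) * (1 - 9 / 25 * x) + (9 / 25 * y) * (9 / 25 * y))) end.
  - apply Rdiv_lt_0_compat; nra.
  - field. apply Rgt_not_eq, Rlt_gt. nra.
Qed.

Lemma cder_ex_v (z : C) : cder idC ex_v z (- RtoC ex_b)%C.
Proof.
  apply (cder_eq _ _ _ (RtoC 0 - RtoC ex_b * RtoC 1)%C); [ring|].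
  apply (cder_minus idC (fun _ => RtoC 1)); [apply cder_const|apply cder_scal, cder_incl].
Qed.

Lemma cder_ex_s (z : C) : disk z ->
  cder idC ex_s z (RtoC (ex_a + ex_b) / (RtoC 2 * (ex_v z * ex_v z) * ex_s z))%C.
Proof.
  intros Hz. assert (Nv := ex_v_neq_0 z Hz). assert (HT := ex_T_pos z Hz).
  destruct (Csqrt_spec _ HT) as [A B]. fold (ex_s z) in A, B.
  assert (Ns : ex_s z <> RtoC 0) by (intros E; rewrite E in B; simpl in B; lra).
  eapply cder_eq; [|apply (cder_comp idC Csqrt (fun z => (ex_u z / ex_v z)%C))].
  2: apply ccont_idC. 2: apply cder_Csqrt, HT.
  2: apply cder_div; [apply ccont_idC| |apply cder_ex_v|exact Nv].
  2: apply (cder_plus idC (fun _ => RtoC 1)); [apply cder_const|apply cder_scal, cder_incl].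
  fold (ex_s z). rewrite RtoC_plus.
  replace ((RtoC 0 + RtoC ex_a * RtoC 1) * ex_v z - ex_u z * - RtoC ex_b)%C
    with (RtoC ex_a + RtoC ex_b)%C by (unfold ex_u, ex_v; ring).
  field. auto.
Qed.

Lemma ex_s_neq_0 (z : C) : disk z -> ex_s z <> RtoC 0.
Proof.
  intros Hz E. destruct (Csqrt_spec _ (ex_T_pos z Hz)) as [A B]. fold (ex_s z) in B.
  rewrite E in B. simpl in B. lra.
Qed.

Lemma ex_const_neq_0 : RtoC (7 / 2 * (ex_a + ex_b)) <> RtoC 0.
Proof. intros E. apply RtoC_inj in E. unfold ex_a, ex_b in E. lra. Qed.

Lemma cder_ex_f (z : C) : disk z -> cder idC ex_f z (ex_f1 z).
Proof.
  intros Hz. assert (Nv := ex_v_neq_0 z Hz). assert (Ns := ex_s_neq_0 z Hz).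
  assert (Nc := ex_const_neq_0). set (c := 7 / 2 * (ex_a + ex_b)) in *.
  apply (cder_ext idC (fun z => (/ RtoC c * (ex_s z ^ 7 - RtoC 1))%C)).
  { intros y. unfold ex_f, Cdiv. fold c. ring. }
  eapply cder_eq; [|apply cder_scal, cder_minus; [apply (cder_pow idC ex_s z _ 6 (ccont_idC z) (cder_ex_s z Hz))|apply cder_const]].
  unfold ex_f1. replace (ex_a + ex_b) with (2 / 7 * c) by (unfold c; field).
  rewrite RtoC_mult, RtoC_div by lra. replace (INR 7) with 7 by (simpl; lra).
  field. repeat split; auto.
Qed.

Lemma cder_ex_f1 (z : C) : disk z ->
  cder idC ex_f1 z (ex_f1 z * (RtoC (5 / 2 * (ex_a + ex_b)) / (ex_u z * ex_v z) + RtoC (2 * ex_b) / ex_v z))%C.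
Proof.
  intros Hz. assert (Nv := ex_v_neq_0 z Hz). assert (Ns := ex_s_neq_0 z Hz). assert (Nu := ex_u_neq_0 z Hz).
  assert (Cv : cder idC (fun z => (ex_v z * ex_v z)%C) z (- RtoC ex_b * ex_v z + ex_v z * - RtoC ex_b)%C).
  { apply cder_mult; [apply ccont_idC|apply cder_ex_v|apply cder_ex_v]. }
  eapply cder_eq; [|apply (cder_div idC (fun z => (ex_s z ^ 5)%C) (fun z => (ex_v z * ex_v z)%C))].
  2: apply ccont_idC. 2: apply (cder_pow idC ex_s z _ 4 (ccont_idC z) (cder_ex_s z Hz)).
  2: exact Cv. 2: now apply Cmult_neq_0.
  destruct (Csqrt_spec _ (ex_T_pos z Hz)) as [A _]. fold (ex_s z) in A.
  unfold ex_f1. rewrite !RtoC_mult, RtoC_div by lra. replace (INR 5) with 5 by (simpl; lra).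
  (* As [s^2 = u / v], eliminating [u] leaves an identity of rational functions in [s] and [v]. *)
  assert (U : ex_u z = (ex_s z * ex_s z * ex_v z)%C) by (rewrite A; field; auto).
  rewrite U. field. auto.
Qed.

Lemma ex_f1_neq_0 (z : C) : disk z -> ex_f1 z <> RtoC 0.
Proof.
  intros Hz. assert (Nv := ex_v_neq_0 z Hz). assert (Ns := ex_s_neq_0 z Hz).
  unfold ex_f1, Cdiv. apply Cmult_neq_0; [now apply Cpow_nz|].
  intros E. apply C1_nz. rewrite <- (Cinv_r (ex_v z * ex_v z)%C) by now apply Cmult_neq_0.
  rewrite E. ring.
Qed.

Lemma C_derive_ex_f (z : C) : disk z -> C_derive ex_f z = ex_f1 z.
Proof. intros Hz. apply C_derive_cder, cder_ex_f, Hz. Qed.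

(** Partial fractions from [a v + b u = a + b]; the coefficients are [4 / 3 = (5/2) a] and
    [81 / 50 = (9/2) b]. *)
Lemma phi_ex_f (z : C) : disk z ->
  phi ex_f z = (RtoC 1 + RtoC (4 / 3) * (z / ex_u z) + RtoC (81 / 50) * (z / ex_v z))%C.
Proof.
  intros Hz. assert (Nv := ex_v_neq_0 z Hz). assert (Nu := ex_u_neq_0 z Hz). assert (N1 := ex_f1_neq_0 z Hz).
  unfold phi.
  rewrite (C_derive_cder (C_derive ex_f) z
    (ex_f1 z * (RtoC (5 / 2 * (ex_a + ex_b)) / (ex_u z * ex_v z) + RtoC (2 * ex_b) / ex_v z))%C).
  - rewrite C_derive_ex_f by auto.
    transitivity (RtoC 1 + z * (RtoC (5 / 2 * (ex_a + ex_b)) / (ex_u z * ex_v z) + RtoC (2 * ex_b) / ex_v z))%C;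
      [field; auto|].
    replace (RtoC (5 / 2 * (ex_a + ex_b))) with (RtoC (4 / 3) * ex_v z + RtoC (9 / 10) * ex_u z)%C.
    + replace (2 * ex_b) with (81 / 50 - 9 / 10) by (unfold ex_b; lra). rewrite RtoC_minus. field. auto.
    + unfold ex_u, ex_v, ex_a, ex_b. destruct z as [x y]. unfold RtoC, Cplus, Cminus, Copp, Cmult. simpl.
      f_equal; field.
  - eapply cder_ext_loc; [|apply cder_ex_f1, Hz].
    generalize (locally_ball0 1 z Hz). apply filter_imp. intros y Hy. symmetry. apply C_derive_ex_f, Hy.
Qed.

(** The product of [z] with the conjugate of [1 + k z] has the imaginary part of [z], because
    [k |z|^2] is real. *)
Lemma Im_moebius (z : C) (k : R) : (RtoC 1 + RtoC k * z)%C <> RtoC 0 ->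
  0 < 1 + 2 * k * fst z + k * k * (fst z * fst z + snd z * snd z) /\
  Im (z / (RtoC 1 + RtoC k * z))%C =
    snd z / (1 + 2 * k * fst z + k * k * (fst z * fst z + snd z * snd z)).
Proof.
  intros N. apply Cmod_gt_0 in N. assert (E := Cmod_sqr (RtoC 1 + RtoC k * z)%C).
  destruct z as [x y]. simpl in *.
  assert (P : 0 < 1 + 2 * k * x + k * k * (x * x + y * y)) by nra.
  split; auto. field. apply Rgt_not_eq, Rlt_gt. nra.
Qed.

(* For [z = r e^(it)], [sin t / |1 + k z|^2] is increasing in [r]. *)
Lemma moebius_radial (r c s k : R) : 0 < r < 1 -> -1 <= c <= 1 -> 0 <= s -> k * k < 1 ->
  r * s / (1 + 2 * k * (r * c) + k * k * (r * r)) <= s / (1 + k * k + 2 * k * c).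
Proof.
  intros Hr Hc Hs Hk.
  assert (Hk1 : -1 < k < 1) by nra.
  assert (P : 0 < 1 + k * k + 2 * k * c).
  { destruct (Rle_lt_dec 0 k).
    - assert (0 <= k * (c + 1)) by (apply Rmult_le_pos; lra). nra.
    - assert (0 <= - k * (1 - c)) by (apply Rmult_le_pos; lra). nra. }
  assert (Q : r * (1 + k * k + 2 * k * c) <= 1 + 2 * k * (r * c) + k * k * (r * r)).
  { assert (0 <= (1 - r) * (1 - k * k * r)) by (apply Rmult_le_pos; nra). nra. }
  assert (P' : 0 < r * (1 + k * k + 2 * k * c)) by (apply Rmult_lt_0_compat; lra).
  apply Rle_div_l; [lra|].
  apply Rmult_le_reg_r with (1 + k * k + 2 * k * c); auto.
  replace (s / (1 + k * k + 2 * k * c) * (1 + 2 * k * (r * c) + k * k * (r * r)) * (1 + k * k + 2 * k * c))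
    with (s * (1 + 2 * k * (r * c) + k * k * (r * r))) by (field; lra).
  nra.
Qed.

(* The certificate is a sum of squares for [249/100]; the maximum of the left side is about [2.4853]. *)
Lemma ex_boundary_bound (c s : R) : 0 <= s -> c * c + s * s = 1 ->
  4 / 3 * (s / (289 / 225 + 16 / 15 * c)) + 81 / 50 * (s / (706 / 625 - 18 / 25 * c)) < 249 / 100.
Proof.
  intros Hs Hcs. assert (Hc : -1 <= c <= 1) by nra.
  set (E1 := 289 / 225 + 16 / 15 * c). set (E2 := 706 / 625 - 18 / 25 * c).
  assert (P1 : 0 < E1) by (unfold E1; lra). assert (P2 : 0 < E2) by (unfold E2; lra).
  replace (4 / 3 * (s / E1) + 81 / 50 * (s / E2)) with (s * (4 / 3 * E2 + 81 / 50 * E1) / (E1 * E2)) by (field; lra).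
  assert (P12 : 0 < E1 * E2) by (apply Rmult_lt_0_compat; auto).
  apply Rlt_div_l; auto.
  set (n := 4 / 3 * E2 + 81 / 50 * E1). assert (Pn : 0 < n) by (unfold n; lra).
  set (D := 249 / 100 * (E1 * E2)). assert (PD : 0 < D) by (unfold D; lra).
  assert (Key : (1 - c * c) * (n * n) < D * D).
  { unfold D, n, E1, E2.
    assert (S1 := pow2_ge_0 (c * c + 86730187 / 259203600 * c - 186 / 1000)).
    assert (S2 := pow2_ge_0 (c + 772993524264061 / 1306548571830975)). nra. }
  apply Rnot_le_lt. intros N.
  assert (X : D * D <= (s * n) * (s * n)) by (apply Rmult_le_compat; lra).
  replace (1 - c * c) with (s * s) in Key by lra. nra.
Qed.

(** Both Moebius terms are positive multiples of [Im z], so absolute values reduce to the upper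
    half; radial monotonicity then moves each term to the unit circle. *)
Lemma ex_strip : phi_maps_disk_into ex_f (W (249 / 100)).
Proof.
  intros z Hz. rewrite C_derive_ex_f by auto. split; [apply ex_f1_neq_0, Hz|].
  unfold W. rewrite phi_ex_f by auto.
  destruct (Im_moebius z ex_a (ex_u_neq_0 z Hz)) as [P1 I1].
  assert (Ev : ex_v z = (RtoC 1 + RtoC (- ex_b) * z)%C) by (unfold ex_v; rewrite RtoC_opp; ring).
  assert (Nv := ex_v_neq_0 z Hz). rewrite Ev in Nv.
  destruct (Im_moebius z (- ex_b) Nv) as [P2 I2]. rewrite <- Ev in I2. fold (ex_u z) in I1.
  assert (EI : Im (RtoC 1 + RtoC (4 / 3) * (z / ex_u z) + RtoC (81 / 50) * (z / ex_v z))%C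
     = 4 / 3 * Im (z / ex_u z)%C + 81 / 50 * Im (z / ex_v z)%C).
  { generalize (z / ex_u z)%C (z / ex_v z)%C. intros p q. destruct p, q. unfold Im. simpl. ring. }
  rewrite EI, I1, I2. clear EI I1 I2 Ev Nv.
  set (D1 := 1 + 2 * ex_a * fst z + ex_a * ex_a * (fst z * fst z + snd z * snd z)) in *.
  set (D2 := 1 + 2 * - ex_b * fst z + - ex_b * - ex_b * (fst z * fst z + snd z * snd z)) in *.
  replace (4 / 3 * (snd z / D1) + 81 / 50 * (snd z / D2)) with (snd z * (4 / 3 / D1 + 81 / 50 / D2)) by (field; lra).
  assert (P3 : 0 < 4 / 3 / D1 + 81 / 50 / D2).
  { assert (0 < 4 / 3 / D1) by (apply Rdiv_lt_0_compat; lra).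
    assert (0 < 81 / 50 / D2) by (apply Rdiv_lt_0_compat; lra). lra. }
  rewrite Rabs_mult, (Rabs_pos_eq (_ + _)) by lra.
  unfold disk in Hz. set (r := Cmod z) in *. assert (Pr : 0 <= r) by apply Cmod_ge_0.
  assert (Er : r * r = fst z * fst z + snd z * snd z) by apply Cmod_sqr.
  destruct (Req_dec r 0) as [Z|Nr].
  { assert (Y := snd_le_Cmod z). fold r in Y. assert (Y' := Rabs_pos (snd z)).
    replace (Rabs (snd z)) with 0 by lra. lra. }
  (* Polar coordinates: [c] is the cosine of the argument and [s] the absolute value of its sine. *)
  set (c := fst z / r). set (s := Rabs (snd z) / r).
  assert (Ex : fst z = r * c) by (unfold c; field; auto).
  assert (Ey : Rabs (snd z) = r * s) by (unfold s; field; auto).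
  assert (Ps : 0 <= s) by (apply Rle_div_r; [lra|rewrite Rmult_0_l; apply Rabs_pos]).
  assert (Ey2 : snd z * snd z = Rabs (snd z) * Rabs (snd z)).
  { rewrite <- Rabs_mult. symmetry. apply Rabs_pos_eq. nra. }
  assert (Ecs : c * c + s * s = 1).
  { apply Rmult_eq_reg_l with (r * r); [|nra].
    transitivity ((r * c) * (r * c) + (r * s) * (r * s)); [ring|].
    rewrite <- Ex, <- Ey, <- Ey2, Er. ring. }
  assert (Hc : -1 <= c <= 1) by nra.
  assert (M1 := moebius_radial r c s ex_a ltac:(lra) Hc Ps ltac:(unfold ex_a; lra)).
  assert (M2 := moebius_radial r c s (- ex_b) ltac:(lra) Hc Ps ltac:(unfold ex_b; lra)).
  rewrite Er, <- Ex, <- Ey in M1, M2. fold D1 in M1. fold D2 in M2.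
  assert (Bd := ex_boundary_bound c s Ps Ecs).
  replace (1 + ex_a * ex_a + 2 * ex_a * c) with (289 / 225 + 16 / 15 * c) in M1 by (unfold ex_a; field).
  replace (1 + - ex_b * - ex_b + 2 * - ex_b * c) with (706 / 625 - 18 / 25 * c) in M2 by (unfold ex_b; field).
  replace (Rabs (snd z) * (4 / 3 / D1 + 81 / 50 / D2))
    with (4 / 3 * (Rabs (snd z) / D1) + 81 / 50 * (Rabs (snd z) / D2)) by (field; lra).
  lra.
Qed.

Lemma ex_A1 : Defs.A1 ex_f.
Proof.
  assert (D0 : disk (RtoC 0)) by (unfold disk; rewrite Cmod_0; lra).
  assert (V0 : ex_v (RtoC 0) = RtoC 1) by (unfold ex_v; ring).
  assert (S0 : ex_s (RtoC 0) = RtoC 1).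
  { apply Csqrt_unique; [apply ex_T_pos, D0|simpl; lra|].
    rewrite V0. unfold ex_u. field. }
  split; [|split].
  - intros z Hz. exists (ex_f1 z). apply is_derive_cder, cder_ex_f, Hz.
  - unfold ex_f. rewrite S0, Cpow_1_l. field. apply ex_const_neq_0.
  - rewrite C_derive_ex_f by auto. unfold ex_f1. rewrite S0, V0, Cpow_1_l. field.
Qed.

(* [ex_z0 = (s^2 - 1) / (a + b s^2)] with [s = ex_s0], so that [T ex_z0 = s^2]. *)
Definition ex_z0 : C := (- 131191750 / 256895427, 73599500 / 85631809).
Definition ex_s0 : C := (10 / 13, 1 / 3).

Lemma ex_z0_disk : disk ex_z0.
Proof.
  unfold disk. apply Rnot_le_lt. intros N. assert (E := Cmod_sqr ex_z0). unfold ex_z0 in E at 3 4 5 6. simpl in E. nra.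
Qed.

Lemma ex_s_z0 : ex_s ex_z0 = ex_s0.
Proof.
  apply Csqrt_unique; [apply ex_T_pos, ex_z0_disk|unfold ex_s0; simpl; lra|].
  assert (N := ex_v_neq_0 _ ex_z0_disk).
  assert (E : (ex_s0 * ex_s0 * ex_v ex_z0)%C = ex_u ex_z0).
  { unfold ex_s0, ex_u, ex_v, ex_z0, ex_a, ex_b, RtoC, Cplus, Cminus, Copp, Cmult. simpl. f_equal; lra. }
  rewrite <- E. field. exact N.
Qed.

(** Division by [q] is multiplication by its conjugate up to a positive factor, so the numerical
    sign test is free of inverses. *)
Lemma Cdot_div_neg (z p q : C) : q <> RtoC 0 -> Cdot z (p * Cconj q)%C < 0 -> Cdot z (p / q)%C < 0.
Proof.
  intros N H. apply Cmod_gt_0 in N. assert (E := Cmod_sqr q).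
  assert (P : 0 < fst q * fst q + snd q * snd q) by nra.
  replace (Cdot z (p / q)%C) with (Cdot z (p * Cconj q)%C / (fst q * fst q + snd q * snd q)).
  - apply Rlt_div_l; auto. lra.
  - destruct z, p, q. unfold Cdot. simpl in *. field. apply Rgt_not_eq, Rlt_gt. nra.
Qed.

Lemma ex_not_Sstar : ~ Sstar ex_f.
Proof.
  intros HS.
  assert (X : 0 <= Cdot ex_z0 (ex_f ex_z0 / C_derive ex_f ex_z0)%C).
  { apply Sstar_Cdot_nonneg; auto; [|apply ex_z0_disk].
    intros z Hz. rewrite C_derive_ex_f by auto. apply ex_f1_neq_0, Hz. }
  revert X. apply Rlt_not_le. rewrite C_derive_ex_f by apply ex_z0_disk.
  assert (Nv := ex_v_neq_0 _ ex_z0_disk). assert (Ns := ex_s_neq_0 _ ex_z0_disk).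
  assert (Nc := ex_const_neq_0).
  replace (ex_f ex_z0 / ex_f1 ex_z0)%C
    with (((ex_s ex_z0 ^ 7 - RtoC 1) * (ex_v ex_z0 * ex_v ex_z0)) /
          (RtoC (7 / 2 * (ex_a + ex_b)) * ex_s ex_z0 ^ 5))%C
    by (unfold ex_f, ex_f1; field; auto).
  apply Cdot_div_neg; [apply Cmult_neq_0; auto; now apply Cpow_nz|].
  (* All entries are now rational numbers, and the inequality is evaluated exactly. *)
  rewrite ex_s_z0. unfold Cdot, ex_z0, ex_s0, ex_v, ex_a, ex_b, Cconj, RtoC, Cplus, Cminus, Copp, Cmult. simpl. lra.
Qed.

Theorem theorem1p3 :
  Rbar_le (Finite (sqrt 3)) (gamma Sstar) /\
  Rbar_lt (gamma Sstar) (Finite (5 / 2)).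
Proof.
  unfold gamma.
  match goal with |- context [Lub_Rbar ?E] => destruct (Lub_Rbar_correct E) as [Hub Hleast] end.
  split.
  - apply Hub. split; [apply sqrt_pos|]. exact strip_sqrt3_starlike.
  (* A least upper bound of numbers below 5/2 could equal 5/2, hence the intermediate bound 249/100:
     a larger admissible [g] would force [ex_f] to be starlike. *)
  - apply Rbar_le_lt_trans with (Finite (249 / 100)); [|simpl; lra].
    apply Hleast. intros g [_ Hg]. simpl. apply Rnot_lt_le. intros Hlt.
    apply ex_not_Sstar, Hg; [apply ex_A1|].
    intros z Hz. destruct (ex_strip z Hz) as [A B]. split; auto. unfold W in *. lra.
Qed.
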